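(* Let $\kappa,\lambda\in\mathbb{R}$, let ${\rm Y}$ be a locally ${\sf CAT}(\kappa)$ space and let ${\sf E}\colon{\rm Y}\to\mathbb{R}\cup\{+\infty\}$ be $\lambda$-convex and lower semicontinuous. Let $y\in\overline{D({\sf E})}$ and let $(y_t)$ be the gradient flow trajectory of ${\sf E}$ starting from $y$ (with $y_0:=y$). Then for every $t>0$ the vectors $\frac1h({\sf G}_{y_t}^{y_{t+h}})'_0\in{\rm T}_{y_t}{\rm Y}$ (defined for $h>0$ small enough) converge strongly in ${\rm T}_{y_t}{\rm Y}$, as $h\downarrow0$, to the element of minimal norm of $-\partial^-{\sf E}(y_t)$. The same holds at $t=0$ if and only if $y\in D(|\partial^-{\sf E}|)$. Moreover $D(-\partial^-{\sf E})=D(|\partial^-{\sf E}|)$, and \[ |\partial^-{\sf E}|(z)=\min_{v\in-\partial^-{\sf E}(z)}|v|_z\qquad\text{for every }z\in D({\sf E}), \] where the minimum of the empty set is $+\infty$. In particular $D(-\partial^-{\sf E})$ is dense in $D({\sf E})$.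
   Context: Locally ${\sf CAT}(\kappa)$ space: complete geodesic metric space $({\rm Y},{\sf d}_{\rm Y})$ in which every point has a neighbourhood that is ${\sf CAT}(\kappa)$ (geodesic triangles of perimeter $<2D_\kappa$ are thinner than comparison triangles in the model plane $\mathbb{M}_\kappa$ of constant curvature $\kappa$; $D_\kappa=\pi/\sqrt\kappa$ if $\kappa>0$, $\infty$ otherwise). For $y\in{\rm Y}$, ${\sf r}_y:=\sup\{r\le D_\kappa/2:\bar B_r(y)\text{ is }{\sf CAT}(\kappa)\}$ and for $z\in B_{{\sf r}_y}(y)$, ${\sf G}_y^z\colon[0,1]\to{\rm Y}$ is the unique constant speed geodesic from $y$ to $z$ (the vectors in the claim are defined for $h$ with $y_{t+h}\in B_{{\sf r}_{y_t}}(y_t)$). Tangent cone ${\rm T}_y{\rm Y}$: completion of the set of constant speed geodesics $\gamma$ emanating from $y$ modulo ${\sf d}_y(\gamma,\eta):=\lim_{t\downarrow0}{\sf d}_{\rm Y}(\gamma_t,\eta_t)/t=0$, with distance ${\sf d}_y$; $\gamma'_0$ the class of $\gamma$, $0_y$ that of the constant curve; $\alpha\gamma'_0$ ($\alpha\ge0$) the class of $t\mapsto\gamma_{\alpha t}$, extended by continuity; $|v|_y:={\sf d}_y(v,0_y)$, $\langle v,w\rangle_y:=\frac12(|v|_y^2+|w|_y^2-{\sf d}_y^2(v,w))$; strong convergence means convergence in ${\sf d}_y$. $\lambda$-convexity: ${\sf E}(\gamma_t)\le(1-t){\sf E}(\gamma_0)+t{\sf E}(\gamma_1)-\frac\lambda2t(1-t){\sf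 d}^2_{\rm Y}(\gamma_0,\gamma_1)$ along every constant speed geodesic $\gamma\colon[0,1]\to{\rm Y}$; $D({\sf E})=\{{\sf E}<\infty\}$. Slope: $|\partial^-{\sf E}|(y):=\limsup_{z\to y}\frac{({\sf E}(y)-{\sf E}(z))^+}{{\sf d}_{\rm Y}(y,z)}$ for $y\in D({\sf E})$; $D(|\partial^-{\sf E}|)$ is where it is finite. Minus-subdifferential: for $y\in D({\sf E})$, $-\partial^-{\sf E}(y)$ is the set of $v\in{\rm T}_y{\rm Y}$ such that for every $z\in{\rm Y}$ there is a geodesic $\gamma\colon[0,1]\to{\rm Y}$ from $y$ to $z$ with ${\sf E}(y)-\langle v,\gamma'_0\rangle_y+\frac\lambda2{\sf d}^2_{\rm Y}(y,z)\le{\sf E}(z)$; $D(-\partial^-{\sf E})$ is the set where it is nonempty; when nonempty it has a unique element of minimal norm. Gradient flow trajectory starting from $y\in\overline{D({\sf E})}$: a locally absolutely continuous curve $(0,\infty)\ni t\mapsto y_t$ with $y_t\to y$ as $t\downarrow0$ such that for every $w\in{\rm Y}$, $\frac{{\rm d}}{{\rm d}t}\frac{{\sf d}^2_{\rm Y}(y_t,w)}{2}+{\sf E}(y_t)+\frac\lambda2{\sf d}^2_{\rm Y}(y_t,w)\le{\sf E}(w)$ for a.e. $t>0$ (equivalently, energy dissipation formulations); it exists and is unique. *)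

(* Defs.v *)
From HB Require Import structures.
From mathcomp Require Import all_boot all_order all_algebra.
From mathcomp Require Import all_classical all_reals all_analysis.
Set Implicit Arguments. Unset Strict Implicit. Unset Printing Implicit Defensive.
Import Order.TTheory GRing.Theory Num.Theory.
Import numFieldNormedType.Exports.
Local Open Scope classical_set_scope.
Local Open Scope ring_scope.

Definition is_metric {R : realType} {Y : Type} (d : Y -> Y -> R) : Prop :=
  (forall x y, 0 <= d x y) /\ (forall x y, d x y = 0 <-> x = y) /\
  (forall x y, d x y = d y x) /\ (forall x y z, d x z <= d x y + d y z).

Definition cauchy_seq {R : realType} {T : Type} (d : T -> T -> R) (u : nat -> T) :=
  forall e : R, 0 < e -> exists N : nat, forall m n, (N <= m)%N -> (N <= n)%N ->
    d (u m) (u n) < e.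

Definition seq_conv {R : realType} {Y : Type} (d : Y -> Y -> R) (u : nat -> Y) (l : Y) :=
  forall e : R, 0 < e -> exists N : nat, forall n, (N <= n)%N -> d (u n) l < e.

Definition complete_metric {R : realType} {Y : Type} (d : Y -> Y -> R) :=
  forall u, cauchy_seq d u -> exists l, seq_conv d u l.

Definition cs_geodesic {R : realType} {Y : Type} (d : Y -> Y -> R) (g : R -> Y) (x z : Y) :=
  g 0 = x /\ g 1 = z /\
  forall s t, 0 <= s <= 1 -> 0 <= t <= 1 -> d (g s) (g t) = `|s - t| * d x z.

Definition geodesic_space {R : realType} {Y : Type} (d : Y -> Y -> R) :=
  forall x z, exists g, cs_geodesic d g x z.

Definition Dk {R : realType} (kappa : R) : \bar R :=
  if 0 < kappa then (pi / Num.sqrt kappa)%:E else +oo%E.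

Definition edot {R : realType} (p q : R * R * R) : R :=
  p.1.1 * q.1.1 + p.1.2 * q.1.2 + p.2 * q.2.
Definition ldot {R : realType} (p q : R * R * R) : R :=
  p.1.1 * q.1.1 + p.1.2 * q.1.2 - p.2 * q.2.

(* M_kappa: sphere of radius 1/sqrt kappa (kappa>0), plane {x3 = 0} (kappa=0),
   upper sheet of the hyperboloid <p,p>_L = 1/kappa (kappa<0) *)
Definition in_model {R : realType} (kappa : R) (p : R * R * R) : Prop :=
  if 0 < kappa then edot p p = kappa^-1
  else if kappa == 0 then p.2 = 0
  else ldot p p = kappa^-1 /\ 0 < p.2.

Definition acosh {R : realType} (x : R) : R := ln (x + Num.sqrt (x ^+ 2 - 1)).

Definition model_dist {R : realType} (kappa : R) (p q : R * R * R) : R :=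
  if 0 < kappa then acos (kappa * edot p q) / Num.sqrt kappa
  else if kappa == 0 then
    Num.sqrt ((p.1.1 - q.1.1) ^+ 2 + (p.1.2 - q.1.2) ^+ 2 + (p.2 - q.2) ^+ 2)
  else acosh (kappa * ldot p q) / Num.sqrt (- kappa).

Definition CAT_set {R : realType} {Y : Type} (kappa : R) (d : Y -> Y -> R) (U : set Y) : Prop :=
  (forall x z, U x -> U z -> ((d x z)%:E < Dk kappa)%E ->
     exists g, cs_geodesic d g x z /\ forall s, 0 <= s <= 1 -> U (g s)) /\
  (forall x1 x2 x3 g12 g13 g23, U x1 -> U x2 -> U x3 ->
     cs_geodesic d g12 x1 x2 -> cs_geodesic d g13 x1 x3 -> cs_geodesic d g23 x2 x3 ->
     (forall s, 0 <= s <= 1 -> U (g12 s) /\ U (g13 s) /\ U (g23 s)) ->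
     ((d x1 x2 + d x1 x3 + d x2 x3)%:E < 2%:E * Dk kappa)%E ->
     forall a1 a2 a3, in_model kappa a1 -> in_model kappa a2 -> in_model kappa a3 ->
       model_dist kappa a1 a2 = d x1 x2 -> model_dist kappa a1 a3 = d x1 x3 ->
       model_dist kappa a2 a3 = d x2 x3 ->
     forall s t p q, 0 <= s <= 1 -> 0 <= t <= 1 -> in_model kappa p -> in_model kappa q ->
       model_dist kappa a1 p = s * d x1 x2 -> model_dist kappa p a2 = (1 - s) * d x1 x2 ->
       model_dist kappa a1 q = t * d x1 x3 -> model_dist kappa q a3 = (1 - t) * d x1 x3 ->
       d (g12 s) (g13 t) <= model_dist kappa p q).

Definition locally_CAT {R : realType} {Y : Type} (kappa : R) (d : Y -> Y -> R) : Prop :=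
  is_metric d /\ complete_metric d /\ geodesic_space d /\
  forall y, exists U : set Y,
    (exists r, 0 < r /\ forall z, d y z < r -> U z) /\ CAT_set kappa d U.

(* z belongs to the open ball B_{r_y}(y), r_y = sup{r <= D_kappa/2 : closed ball CAT(kappa)} *)
Definition in_rball {R : realType} {Y : Type} (kappa : R) (d : Y -> Y -> R) (y z : Y) : Prop :=
  exists r : R, 0 < r /\ ((2 * r)%:E <= Dk kappa)%E /\
    CAT_set kappa d [set w | d y w <= r] /\ d y z < r.

Definition domE {R : realType} {Y : Type} (E : Y -> \bar R) (y : Y) : Prop := (E y < +oo)%E.

Definition lconvex {R : realType} {Y : Type} (d : Y -> Y -> R) (lam : R) (E : Y -> \bar R) :=
  forall g x z (t : R), cs_geodesic d g x z -> 0 <= t <= 1 ->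
    (E (g t) <= (1 - t)%:E * E x + t%:E * E z - (lam / 2 * t * (1 - t) * d x z ^+ 2)%:E)%E.

Definition lsc {R : realType} {Y : Type} (d : Y -> Y -> R) (E : Y -> \bar R) :=
  forall y (c : R), (c%:E < E y)%E ->
    exists r, 0 < r /\ forall z, d y z < r -> (c%:E < E z)%E.

Definition in_closure_dom {R : realType} {Y : Type} (d : Y -> Y -> R) (E : Y -> \bar R) (y : Y) :=
  forall e : R, 0 < e -> exists z, domE E z /\ d y z < e.

(* descending slope: limsup_{z -> y} (E y - E z)^+ / d(y,z) (sup of the empty set read as 0) *)
Definition slope {R : realType} {Y : Type} (d : Y -> Y -> R) (E : Y -> \bar R) (y : Y) : \bar R :=
  ereal_inf [set ereal_sup
      ([set (maxe (E y - E z) 0 * ((d y z)^-1)%:E)%E | z in [set z | 0 < d y z < r]]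
         `|` [set 0%E]) | r in [set r : R | 0 < r]].

Definition germ {R : realType} {Y : Type} (d : Y -> Y -> R) (y : Y) (g : R -> Y) : Prop :=
  g 0 = y /\ exists T L : R, 0 < T /\ 0 <= L /\
    forall s t, 0 <= s <= T -> 0 <= t <= T -> d (g s) (g t) = L * `|s - t|.

Definition gdist {R : realType} {Y : Type} (d : Y -> Y -> R) (g h : R -> Y) : R :=
  lim ((fun t : R => d (g t) (h t) / t) @ 0^'+).

(* elements of T_y Y: d_y-Cauchy sequences of geodesics from y (completion) *)
Definition in_tcone {R : realType} {Y : Type} (d : Y -> Y -> R) (y : Y) (V : nat -> R -> Y) :=
  (forall n, germ d y (V n)) /\ cauchy_seq (gdist d) V.

Definition tdist {R : realType} {Y : Type} (d : Y -> Y -> R) (V W : nat -> R -> Y) : R :=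
  limn (fun n => gdist d (V n) (W n)).

Definition tzero {R : realType} {Y : Type} (y : Y) : nat -> R -> Y := fun _ _ => y.
Definition of_germ {R : realType} {Y : Type} (g : R -> Y) : nat -> R -> Y := fun _ => g.
Definition tscale {R : realType} {Y : Type} (a : R) (V : nat -> R -> Y) : nat -> R -> Y :=
  fun n t => V n (a * t).

Definition tnorm {R : realType} {Y : Type} (d : Y -> Y -> R) (y : Y) (V : nat -> R -> Y) : R :=
  tdist d V (tzero y).
Definition tinner {R : realType} {Y : Type} (d : Y -> Y -> R) (y : Y) (V W : nat -> R -> Y) : R :=
  (tnorm d y V ^+ 2 + tnorm d y W ^+ 2 - tdist d V W ^+ 2) / 2.

Definition msubdiff {R : realType} {Y : Type} (d : Y -> Y -> R) (lam : R) (E : Y -> \bar R)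
  (y : Y) (V : nat -> R -> Y) : Prop :=
  domE E y /\ in_tcone d y V /\
  forall z, exists g, cs_geodesic d g y z /\
    (E y - (tinner d y V (of_germ g))%:E + (lam / 2 * d y z ^+ 2)%:E <= E z)%E.

Definition dom_msubdiff {R : realType} {Y : Type} (d : Y -> Y -> R) (lam : R) (E : Y -> \bar R)
  (y : Y) : Prop := exists V, msubdiff d lam E y V.

Definition minnorm_elt {R : realType} {Y : Type} (d : Y -> Y -> R) (lam : R) (E : Y -> \bar R)
  (y : Y) (V : nat -> R -> Y) : Prop :=
  msubdiff d lam E y V /\ forall W, msubdiff d lam E y W -> tnorm d y V <= tnorm d y W.

Definition locAC {R : realType} {Y : Type} (d : Y -> Y -> R) (c : R -> Y) : Prop :=
  forall a b : R, 0 < a -> a < b -> exists m : R -> R,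
    (@lebesgue_measure R).-integrable `[a, b] (EFin \o m) /\
    forall s t, a <= s -> s <= t -> t <= b ->
      ((d (c s) (c t))%:E <= \int[@lebesgue_measure R]_(x in `[s, t]) (m x)%:E)%E.

Definition gradient_flow {R : realType} {Y : Type} (d : Y -> Y -> R) (lam : R) (E : Y -> \bar R)
  (y0 : Y) (c : R -> Y) : Prop :=
  locAC d c /\
  (forall e : R, 0 < e -> exists r, 0 < r /\ forall t, 0 < t < r -> d (c t) y0 < e) /\
  forall w : Y, {ae @lebesgue_measure R, forall t : R, 0 < t ->
    derivable (fun s : R => d (c s) w ^+ 2 / 2) t 1 /\
    ((derive1 (fun s : R => d (c s) w ^+ 2 / 2) t)%:E + E (c t) + (lam / 2 * d (c t) w ^+ 2)%:E
       <= E w)%E}.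

Definition dq_converges {R : realType} {Y : Type} (kappa : R) (d : Y -> Y -> R) (c : R -> Y)
  (t : R) (V : nat -> R -> Y) : Prop :=
  forall e : R, 0 < e -> exists r, 0 < r /\ forall h : R, 0 < h < r ->
    in_rball kappa d (c t) (c (t + h)) /\
    forall g, cs_geodesic d g (c t) (c (t + h)) -> tdist d (tscale h^-1 (of_germ g)) V < e.

(* Main.v *)
Require Import Defs.
From HB Require Import structures.
From mathcomp Require Import all_boot all_order all_algebra.
From mathcomp Require Import all_classical all_reals all_analysis measurable_realfun.
From mathcomp Require Import ring lra.
Import Order.TTheory GRing.Theory Num.Theory.
Import numFieldNormedType.Exports.
Local Open Scope classical_set_scope.
Local Open Scope ring_scope.

(** The CAT(kappa) condition enters only through the Euclidean midpoint inequality, which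
    holds at scale [rho] up to an error [O(rho ^ 4)]; this already forces the quotients
    [d (g t) (h t) / t] of two geodesics from a point to converge.  If the slope at [y] is
    finite, [lam]-convexity makes the almost steepest descent directions, scaled to have the
    slope as speed, Cauchy in the tangent cone; their limit lies in the minus-subdifferential
    and has norm equal to the slope, which bounds the norm of every element from below.
    Integrating the evolution variational inequality, with target first the starting point
    and then points along a steepest descent direction, shows that the incremental quotients of the flow
    have asymptotically the right length and the right angle with that direction.  For
    positive times the slope is finite because the flow contracts against its own time
    shifts, and the points of finite slope are dense by Ekeland's principle. *)

(** The geodesic from [c t] to [c (t + h)] changes with [h], so it is not enough that tangent
    distances exist as limits: a single quotient at a positive time must already bound the tangent
    distance, with an error depending only on a bound for the speeds. A fourth-order curvature
    error, summed over dyadic scales, provides this. Moreover the target points must lie in balls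
    that are exactly [CAT(kappa)], and no inequality with an error can show that a ball is convex;
    hence a second, error-free comparison through an increasing function [S] of the distance. On the
    energy side, everything about directions comes from one inequality between two germs, almost
    saturated by steepest descent: weight one half gives the Cauchy property, weight tending to zero
    the subdifferential inequality. The flow is known only through an inequality valid at almost
    every time, so finiteness and monotonicity of the energy along it have to be derived before its
    slope can be discussed. *)

(** * Taylor bounds for the cosine and the hyperbolic cosine *)

Section Taylor.
Context {R : realType}.
Implicit Types (f df : R -> R) (x z b : R).

(** Stands in for integration: in the chains of Taylor bounds below, the derivative of each
    difference has a sign by the preceding bound. *)
Lemma ge_init_of_derive f df b :
  (forall x, is_derive x 1 f (df x)) ->
  (forall x, 0 <= x -> x <= b -> 0 <= df x) ->
  forall z, 0 <= z -> z <= b -> f 0 <= f z.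
Proof.
move=> fdf df0 z z0 zb.
have cf : {within `[0, z], continuous f}.
  apply: continuous_subspaceT => x.
  by apply: differentiable_continuous; apply/derivable1_diffP; exact: ex_derive.
have [c] := @MVT_segment R f df 0 z z0 (fun x _ => fdf x) cf.
rewrite in_itv/= => /andP[c0 cz] e.
have := df0 c c0 (le_trans cz zb); nra.
Qed.

Lemma sin_le_id x : 0 <= x -> sin x <= x.
Proof.
move=> x0.
have := @ge_init_of_derive (fun y => y - sin y) (fun y => 1 - cos y) x _ _ x x0 (lexx x).
rewrite sin0 => H.
have : 0 <= x - sin x.
  apply: le_trans (H _ _); first by lra.
  by move=> y _ _; rewrite subr_ge0 cos_le1.
lra.
Qed.

Lemma cos_ge_taylor2 x : 0 <= x -> 1 - x ^+ 2 / 2 <= cos x.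
Proof.
move=> x0.
have := @ge_init_of_derive (fun y => cos y - 1 + y ^+ 2 / 2) (fun y => - sin y + y) x _ _ x x0 (lexx x).
rewrite cos0 => H.
have : 0 <= cos x - 1 + x ^+ 2 / 2.
  apply: le_trans (H _ _); first by lra.
    move=> y; apply: is_derive_eq.
    by rewrite ?expr1 ?scaler1 /GRing.scale/=; lra.
  by move=> y y0 _; have := sin_le_id _ y0; lra.
lra.
Qed.

Lemma sin_ge_taylor3 x : 0 <= x -> x - x ^+ 3 / 6 <= sin x.
Proof.
move=> x0.
have := @ge_init_of_derive (fun y => sin y - y + y ^+ 3 / 6) (fun y => cos y - 1 + y ^+ 2 / 2) x _ _ x x0 (lexx x).
rewrite sin0 => H.
have : 0 <= sin x - x + x ^+ 3 / 6.
  apply: le_trans (H _ _); first by lra.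
    move=> y; apply: is_derive_eq.
    by rewrite ?scaler1 /GRing.scale/=; lra.
  by move=> y y0 _; have := cos_ge_taylor2 _ y0; lra.
lra.
Qed.

Lemma cos_le_taylor4 x : 0 <= x -> cos x <= 1 - x ^+ 2 / 2 + x ^+ 4 / 24.
Proof.
move=> x0.
have := @ge_init_of_derive (fun y => 1 - y ^+ 2 / 2 + y ^+ 4 / 24 - cos y) (fun y => - y + y ^+ 3 / 6 + sin y) x _ _ x x0 (lexx x).
rewrite cos0 => H.
have : 0 <= 1 - x ^+ 2 / 2 + x ^+ 4 / 24 - cos x.
  apply: le_trans (H _ _); first by lra.
    move=> y; apply: is_derive_eq.
    by rewrite ?scaler1 /GRing.scale/=; lra.
  by move=> y y0 _; have := sin_ge_taylor3 _ y0; lra.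
lra.
Qed.

Definition cosh x := (expR x + expR (- x)) / 2.
Definition sinh x := (expR x - expR (- x)) / 2.

Lemma is_derive_cosh x : is_derive x 1 cosh (sinh x).
Proof.
apply: is_derive_eq; rewrite /sinh ?scaler1 /GRing.scale/=; lra.
Qed.

Lemma is_derive_sinh x : is_derive x 1 sinh (cosh x).
Proof.
apply: is_derive_eq; rewrite /cosh ?scaler1 /GRing.scale/=; lra.
Qed.

Lemma cosh0 : cosh 0 = 1. Proof. by rewrite /cosh oppr0 expR0; lra. Qed.
Lemma sinh0 : sinh 0 = 0. Proof. by rewrite /sinh oppr0 expR0; lra. Qed.

Lemma coshN x : cosh (- x) = cosh x.
Proof. by rewrite /cosh opprK addrC. Qed.

Lemma sinhN x : sinh (- x) = - sinh x.
Proof. by rewrite /sinh opprK; lra. Qed.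

Lemma coshD x z : cosh (x + z) = cosh x * cosh z + sinh x * sinh z.
Proof. rewrite /cosh /sinh opprD !expRD; lra. Qed.

Lemma cosh2Bsinh2 x : cosh x ^+ 2 = 1 + sinh x ^+ 2.
Proof. have := expRxMexpNx_1 x; rewrite /cosh /sinh; lra. Qed.

Lemma cosh_ge1 x : 1 <= cosh x.
Proof.
have := expRxMexpNx_1 x; have := expR_gt0 x; have := expR_gt0 (- x); rewrite /cosh.
have := sqr_ge0 (expR x - expR (- x)); nra.
Qed.

Lemma sinh_ge0 x : 0 <= x -> 0 <= sinh x.
Proof.
move=> x0; have : expR (- x) <= expR x by rewrite ler_expR; lra.
rewrite /sinh; lra.
Qed.

Lemma acoshK x : 0 <= x -> acosh (cosh x) = x.
Proof.
move=> x0; rewrite /acosh cosh2Bsinh2 (_ : _ - 1 = sinh x ^+ 2); last by ring.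
rewrite sqrtr_sqr ger0_norm ?sinh_ge0//.
by rewrite (_ : cosh x + sinh x = expR x) ?expRK// /cosh /sinh; lra.
Qed.

Lemma cosh_mono x z : 0 <= x -> x <= z -> cosh x <= cosh z.
Proof.
move=> x0 xz; rewrite (_ : z = x + (z - x)); last by ring.
have zx : 0 <= z - x by lra.
rewrite coshD; have := cosh_ge1 x; have := cosh_ge1 (z - x).
have := sinh_ge0 x x0; have := sinh_ge0 _ zx; nra.
Qed.

Lemma sinh_mono x z : 0 <= x -> x <= z -> sinh x <= sinh z.
Proof.
move=> x0 xz; have := cosh_mono _ _ x0 xz; have := cosh2Bsinh2 x; have := cosh2Bsinh2 z.
have := sinh_ge0 x x0; have := sinh_ge0 z (le_trans x0 xz); have := cosh_ge1 x; nra.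
Qed.

Lemma cosh_lt x z : 0 <= x -> x < z -> cosh x < cosh z.
Proof.
move=> x0 xz; have z0 : 0 <= z by lra.
rewrite lt_neqAle; apply/andP; split; last by apply: cosh_mono => //; exact: ltW.
apply/eqP => /(congr1 acosh); rewrite !acoshK// => xz_; move: xz; rewrite xz_ ltxx//.
Qed.

Lemma cosh_acosh z : 1 <= z -> 0 <= acosh z /\ cosh (acosh z) = z.
Proof.
move=> z1; rewrite /acosh; set s := Num.sqrt _.
have s0 : 0 <= s by exact: sqrtr_ge0.
have s2 : s ^+ 2 = z ^+ 2 - 1 by rewrite sqr_sqrtr//; nra.
split; first by apply: ln_ge0; lra.
have zs : 0 < z + s by lra.
rewrite /cosh expRN lnK; last by rewrite posrE.
have -> : (z + s)^-1 = z - s.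
  by apply: (@mulfI _ (z + s)); [rewrite gt_eqF|rewrite divff ?gt_eqF//; lra].
lra.
Qed.

Lemma cosh_ge_taylor2 x : 0 <= x -> 1 + x ^+ 2 / 2 <= cosh x.
Proof.
move=> x0.
have sg y : 0 <= y -> y <= sinh y.
  move=> y0.
  have := @ge_init_of_derive (fun y => sinh y - y) (fun y => cosh y - 1) y _ _ y y0 (lexx y).
  rewrite sinh0 => H.
  have : 0 <= sinh y - y.
    apply: le_trans (H _ _); first by lra.
      by move=> z; have := is_derive_sinh z => ds; apply: is_derive_eq.
    by move=> z _ _; rewrite subr_ge0 cosh_ge1.
  lra.
have := @ge_init_of_derive (fun y => cosh y - y ^+ 2 / 2) (fun y => sinh y - y) x _ _ x x0 (lexx x).
rewrite cosh0 => H.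
have : 1 <= cosh x - x ^+ 2 / 2.
  apply: le_trans (H _ _); first by lra.
    move=> y; have := is_derive_cosh y => dc; apply: is_derive_eq.
    by rewrite ?scaler1 /GRing.scale/=; lra.
  by move=> y y0 _; rewrite subr_ge0 sg.
lra.
Qed.

(** The bound [cosh <= 2] on [[0, 1/2]] is integrated four times; the coefficient [1/12] obtained
    for [x ^+ 4] is rounded up to [1]. The range is bounded because no polynomial dominates [cosh]
    on the half-line. *)
Lemma cosh_le_taylor4 x : 0 <= x -> x <= 2^-1 -> cosh x <= 1 + x ^+ 2 / 2 + x ^+ 4.
Proof.
move=> x0 x1.
have c2 : cosh 2^-1 <= 2 :> R.
  have := expR_ge1Dx (- 2^-1 : R); have := expRxMexpNx_1 (2^-1 : R).
  have := expR_gt0 (2^-1 : R).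
  have : expR (- 2^-1 : R) <= 1 by rewrite expR_le1; lra.
  rewrite /cosh; nra.
have cle y : 0 <= y -> y <= 2^-1 -> cosh y <= 2.
  by move=> y0 y1; apply: le_trans c2; exact: cosh_mono.
have s1 y : 0 <= y -> y <= 2^-1 -> sinh y <= 2 * y.
  move=> y0 y1.
  have := @ge_init_of_derive (fun y => 2 * y - sinh y) (fun y => 2 - cosh y) y _ _ y y0 (lexx y).
  rewrite sinh0 => H.
  have : 0 <= 2 * y - sinh y.
    apply: le_trans (H _ _); first by lra.
      move=> z; have := is_derive_sinh z => dc; apply: is_derive_eq.
      by rewrite ?scaler1 /GRing.scale/=; lra.
    by move=> z z0 zy; rewrite subr_ge0 cle//; lra.
  lra.
have c1 y : 0 <= y -> y <= 2^-1 -> cosh y <= 1 + y ^+ 2.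
  move=> y0 y1.
  have := @ge_init_of_derive (fun y => y ^+ 2 - cosh y) (fun y => 2 * y - sinh y) y _ _ y y0 (lexx y).
  rewrite cosh0 => H.
  have : -1 <= y ^+ 2 - cosh y.
    apply: le_trans (H _ _); first by lra.
      move=> z; have := is_derive_cosh z => dc; apply: is_derive_eq.
      by rewrite ?scaler1 /GRing.scale/=; lra.
    by move=> z z0 zy; rewrite subr_ge0 s1//; lra.
  lra.
have s3 y : 0 <= y -> y <= 2^-1 -> sinh y <= y + y ^+ 3 / 3.
  move=> y0 y1.
  have := @ge_init_of_derive (fun y => y + y ^+ 3 / 3 - sinh y) (fun y => 1 + y ^+ 2 - cosh y) y _ _ y y0 (lexx y).
  rewrite sinh0 => H.
  have : 0 <= y + y ^+ 3 / 3 - sinh y.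
    apply: le_trans (H _ _); first by lra.
      move=> z; have := is_derive_sinh z => dc; apply: is_derive_eq.
      by rewrite ?scaler1 /GRing.scale/=; lra.
    by move=> z z0 zy; rewrite subr_ge0 c1//; lra.
  lra.
have := @ge_init_of_derive (fun y => y ^+ 2 / 2 + y ^+ 4 / 12 - cosh y)
  (fun y => y + y ^+ 3 / 3 - sinh y) x _ _ x x0 (lexx x).
rewrite cosh0 => H.
have : -1 <= x ^+ 2 / 2 + x ^+ 4 / 12 - cosh x.
  apply: le_trans (H _ _); first by lra.
    move=> z; have := is_derive_cosh z => dc; apply: is_derive_eq.
    by rewrite ?scaler1 /GRing.scale/=; lra.
  by move=> z z0 zy; rewrite subr_ge0 s3//; lra.
have : 0 <= x ^+ 4 by exact: exprn_ge0.
lra.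
Qed.

End Taylor.

(** * Comparison triangles in the model planes and the median of a triangle *)

Section Model.
Context {R : realType}.
Implicit Types (kappa rho K a b c x z : R).

(** Two conclusions for two uses. The quadratic one carries an error that disappears after division
    by a squared scale; the one in [S] is exact and serves for the convexity of balls. They are
    stated for every [x] below the model distance, so that the CAT inequality can be substituted
    directly. *)
Definition midpoint_comparison kappa rho0 K (S : R -> R) : Prop :=
  forall a b c rho, 0 <= a -> 0 <= b -> 0 <= c -> a <= rho -> b <= rho -> c <= rho ->
    rho <= rho0 -> a <= b + c -> b <= a + c -> c <= a + b ->
  exists a1 a2 a3 p : R * R * R,
    [/\ in_model kappa a1, in_model kappa a2, in_model kappa a3 & in_model kappa p] /\
    [/\ model_dist kappa a1 a2 = c, model_dist kappa a1 a3 = b,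
        model_dist kappa a2 a3 = a, model_dist kappa a1 p = c / 2 &
        model_dist kappa p a2 = c / 2] /\
    forall x, 0 <= x -> x <= model_dist kappa p a3 ->
      S x <= (S a + S b) / 2 /\ x ^+ 2 <= (a ^+ 2 + b ^+ 2) / 2 - c ^+ 2 / 4 + K * rho ^+ 4.

Lemma sqr_le_mono x z : `|x| <= z -> x ^+ 2 <= z ^+ 2.
Proof. by move=> xz; rewrite -real_normK ?num_real//; have := normr_ge0 x; nra. Qed.

Lemma pow4_mono x z : 0 <= x -> x <= z -> x ^+ 4 <= z ^+ 4.
Proof. by move=> x0 xz; apply: lerXn2r; rewrite ?nnegrE//; lra. Qed.

(** Multiplied by [G * (1 - G)], the gap [1 - u2 - w2] becomes [(X - G) * (G - Y)]. It leaves room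
    for the square of the remaining coordinate of the apex of a comparison triangle. *)
Lemma sphere_constraint (u2 w2 X Y G : R) : 0 < G -> G < 1 -> u2 * G = X * Y ->
  w2 * (1 - G) = (1 - X) * (1 - Y) -> Y <= G -> G <= X -> u2 + w2 <= 1.
Proof.
move=> G0 G1 e1 e2 YG GX.
have GG : 0 < G * (1 - G) by nra.
rewrite -(ler_pM2l GG).
have -> : G * (1 - G) * (u2 + w2) = (u2 * G) * (1 - G) + (w2 * (1 - G)) * G by ring.
rewrite e1 e2; nra.
Qed.

(** The gap [w2 - 1 - u2], multiplied by [G * (1 + G)], is again [(X - G) * (G - Y)]. *)
Lemma hyperboloid_constraint (u2 w2 X Y G : R) : 0 < G -> u2 * G = X * Y ->
  w2 * (1 + G) = (1 + X) * (1 + Y) -> Y <= G -> G <= X -> 1 + u2 <= w2.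
Proof.
move=> G0 e1 e2 YG GX.
have GG : 0 < G * (1 + G) by nra.
rewrite -(ler_pM2l GG).
have -> : G * (1 + G) * (1 + u2) = G * (1 + G) + (u2 * G) * (1 + G) by ring.
have -> : G * (1 + G) * w2 = (w2 * (1 + G)) * G by ring.
rewrite e1 e2; nra.
Qed.

(** The side of length [c] is centred at the origin and the apex is [(u, Num.sqrt v2)]. The median
    formula is then an identity, whence the error constant [0]. *)
Lemma midpoint_comparison_flat : midpoint_comparison 0 1 0 (fun x => x ^+ 2).
Proof.
move=> a b c rho a0 b0 c0 _ _ _ _ abc bac cab.
(* For [c = 0] the quotient is [0] by the convention on division, and the triangle inequalities
   force [a = b]. *)
pose u := (b ^+ 2 - a ^+ 2) / (2 * c).
have uc : 2 * c * u = b ^+ 2 - a ^+ 2.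
  have [c_0|cn0] := eqVneq c 0.
    by rewrite c_0 mulr0 mul0r; have -> : a = b by [lra]; rewrite subrr.
  by rewrite /u; field.
pose v2 := (a ^+ 2 + b ^+ 2) / 2 - c ^+ 2 / 4 - u ^+ 2.
have v20 : 0 <= v2.
  have [c_0|cn0] := eqVneq c 0.
    by rewrite /v2 /u c_0 mulr0 invr0 mulr0; nra.
  have c2 : 0 < c ^+ 2 by rewrite exprn_even_gt0.
  (* Heron's formula: this product is sixteen times the squared area. *)
  have H : 0 <= ((a + b) ^+ 2 - c ^+ 2) * (c ^+ 2 - (a - b) ^+ 2).
    by apply: mulr_ge0; nra.
  rewrite -(pmulr_rge0 _ c2).
  have -> : c ^+ 2 * v2 = c ^+ 2 * ((a ^+ 2 + b ^+ 2) / 2 - c ^+ 2 / 4) - (2 * c * u) ^+ 2 / 4.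
    by rewrite /v2; field.
  rewrite uc; lra.
have vv : Num.sqrt v2 ^+ 2 = v2 by rewrite sqr_sqrtr.
have md : forall p q, model_dist 0 p q = Num.sqrt ((p.1.1 - q.1.1) ^+ 2 + (p.1.2 - q.1.2) ^+ 2 + (p.2 - q.2) ^+ 2).
  by move=> p q; rewrite /model_dist ltxx eqxx.
have im : forall s t, in_model 0 (s, t, 0 : R).
  by move=> s t; rewrite /in_model ltxx eqxx.
have sq s t : 0 <= t -> s = t ^+ 2 -> Num.sqrt s = t.
  by move=> t0 ->; rewrite sqrtr_sqr ger0_norm.
exists (- (c / 2), 0, 0), (c / 2, 0, 0), (u, Num.sqrt v2, 0), (0, 0, 0).
split; first by split; exact: im.
split; rewrite !md /=.
  split; apply: sq; rewrite ?divr_ge0 ?ler0n// ?subr0 ?sub0r ?sqrrN ?vv /v2; try by field.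
  - by lra.
  - by lra.
move=> x x0 xm.
have m0 := le_trans x0 xm.
have : x ^+ 2 <= Num.sqrt ((0 - u) ^+ 2 + (0 - Num.sqrt v2) ^+ 2 + (0 - 0) ^+ 2) ^+ 2 by nra.
rewrite sqr_sqrtr; last by rewrite !addr_ge0// sqr_ge0.
rewrite !sub0r !sqrrN vv /v2; have := sqr_ge0 c; lra.
Qed.

(** Here [w] is the cosine of the median. The crude bound [X ^+ 2 / 3 <= 1 - w], available since
    [X <= 2], makes [X ^+ 4] of order [P ^+ 4]; put back into the Taylor bound of [cos X], it gives
    the sharp quadratic term. *)
Lemma sphere_estimate (A B g P X w : R) : 0 <= A -> A <= P -> 0 <= B -> B <= P ->
  0 <= g -> g <= P / 2 -> 0 <= X -> X <= 2 -> w <= 1 -> 0 <= w ->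
  w * cos g = (cos A + cos B) / 2 -> w <= cos X ->
  1 - cos X <= (1 - cos A + (1 - cos B)) / 2 /\
  X ^+ 2 <= (A ^+ 2 + B ^+ 2) / 2 - g ^+ 2 + 4 * P ^+ 4.
Proof.
move=> A0 AP B0 BP g0 gP X0 Xh w1 w0 wE cX; have cg1 := cos_le1 g.
have cgA := cos_ge_taylor2 _ A0; have cgB := cos_ge_taylor2 _ B0.
have cgg := cos_le_taylor4 _ g0; have cgX := cos_le_taylor4 _ X0.
have cgg2 := cos_ge_taylor2 _ g0.
split; first by nra.
have P0 : 0 <= P by lra.
have [A2 B2 g2] : [/\ A ^+ 2 <= P ^+ 2, B ^+ 2 <= P ^+ 2 & g ^+ 2 <= P ^+ 2 / 4].
  by split; nra.
set s := 1 - w.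
have sE : cos g * s = cos g - (cos A + cos B) / 2 by rewrite /s; lra.
have s0 : 0 <= s by rewrite /s; lra.
have s1 : s <= P ^+ 2 / 2 by rewrite /s; nra.
have g4 : g ^+ 4 <= P ^+ 4 / 16.
  have -> : g ^+ 4 = (g ^+ 2) ^+ 2 by ring.
  have -> : P ^+ 4 / 16 = (P ^+ 2 / 4) ^+ 2 by field.
  by have := sqr_ge0 g; nra.
have P4E : P ^+ 4 = (P ^+ 2) ^+ 2 by ring.
have s2 : s <= (A ^+ 2 + B ^+ 2) / 4 - g ^+ 2 / 2 + P ^+ 4 / 8.
  have : (1 - cos g) * s <= P ^+ 4 / 16.
    have : (1 - cos g) * s <= P ^+ 2 / 8 * (P ^+ 2 / 2) by apply: ler_pM; lra.
    lra.
  by have : 0 <= P ^+ 4 by [exact: exprn_ge0]; lra.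
have X2 : X ^+ 2 / 3 <= s.
  have -> : s = 1 - w by [].
  have X4 : X ^+ 4 <= 4 * X ^+ 2.
    have -> : X ^+ 4 = X ^+ 2 * X ^+ 2 by ring.
    have : X ^+ 2 <= 4 by nra.
    by have := sqr_ge0 X; nra.
  lra.
have X4 : X ^+ 4 <= 9 / 4 * P ^+ 4.
  have -> : X ^+ 4 = (X ^+ 2) ^+ 2 by ring.
  rewrite P4E; have := sqr_ge0 X; nra.
by have : 0 <= P ^+ 4 by [exact: exprn_ge0]; move: cX; rewrite -/s; rewrite /s in s2; lra.
Qed.

(** With the midpoint at the north pole and the side ending at [(- sin g, 0, cos g)] and
    [(sin g, 0, cos g)], the two other sides impose linear equations on [u] and [w]. Sum-to-product
    formulas in the half sum and half difference of [A] and [B] reduce the existence of [v] to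
    [sphere_constraint]. *)
Lemma sphere_triangle (A B g : R) : 0 <= A -> A <= 2^-1 -> 0 <= B -> B <= 2^-1 ->
  0 <= g -> g <= 2^-1 -> g <= (A + B) / 2 -> `|(A - B) / 2| <= g ->
  exists u v w, [/\ 0 < w, w * cos g = (cos A + cos B) / 2,
    u * sin g = (cos A - cos B) / 2 & u ^+ 2 + v ^+ 2 + w ^+ 2 = 1].
Proof.
move=> A0 A1 B0 B1 g0 g1 tri1 tri2; have pih := @pihalf_ge1 R.
pose p := (A + B) / 2; pose q := (A - B) / 2.
have cAB1 : cos A + cos B = 2 * (cos p * cos q).
  have -> : A = p + q by rewrite /p /q; field.
  have -> : B = p - q by rewrite /p /q; field.
  by rewrite cosD cosB; ring.
have cAB2 : cos A - cos B = - 2 * (sin p * sin q).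
  have -> : A = p + q by rewrite /p /q; field.
  have -> : B = p - q by rewrite /p /q; field.
  by rewrite cosD cosB; ring.
have cosp x : 0 <= x -> x <= 2^-1 -> 0 < cos x by move=> ? ?; apply: cos_gt0_pihalf; lra.
have cg := cosp g g0 g1; have cA0 := cosp A A0 A1; have cB0 := cosp B B0 B1.
pose w := (cos A + cos B) / (2 * cos g).
pose u := (cos A - cos B) / (2 * sin g).
have wE : w * cos g = (cos A + cos B) / 2 by rewrite /w; field; rewrite gt_eqF.
have w0 : 0 < w by apply: divr_gt0; [exact: addr_gt0|exact: mulr_gt0].
suff [uE uw] : u * sin g = (cos A - cos B) / 2 /\ u ^+ 2 + w ^+ 2 <= 1.
  exists u, (Num.sqrt (1 - u ^+ 2 - w ^+ 2)), w; split => //.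
  by rewrite sqr_sqrtr; [ring|lra].
have [g_0|gn0] := eqVneq g 0.
  have AB : A = B by move: tri2; rewrite g_0 normr_le0 => /eqP; lra.
  rewrite /u /w AB subrr !mul0r g_0 cos0 expr0n add0r; split => //.
  have -> : (cos B + cos B) / (2 * 1) = cos B by field.
  by have := cos2Dsin2 B; have := sqr_ge0 (sin B); lra.
have sinm x z : 0 <= x -> x <= z -> z <= 2^-1 -> sin x <= sin z.
  by move=> x0 xz z1; rewrite leNgt (@ltr_sin R) -?leNgt// in_itv/=; lra.
have sing x : 0 <= x -> x <= 2^-1 -> 0 <= sin x by move=> ? ?; apply: sin_ge0_pi; lra.
have sg : 0 < sin g by apply: sin_gt0_pi; rewrite lt_def gn0 g0/=; lra.
have uE : u * sin g = (cos A - cos B) / 2 by rewrite /u; field; rewrite gt_eqF.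
split=> //.
have e1 := cos2Dsin2 g; have e2 := cos2Dsin2 p; have e3 := cos2Dsin2 q.
have q1 : `|q| <= 2^-1 by exact: le_trans tri2 g1.
have p1 : p <= 2^-1 by rewrite /p; lra.
apply: (@sphere_constraint (u ^+ 2) (w ^+ 2) (sin p ^+ 2) (sin q ^+ 2) (sin g ^+ 2)).
- by rewrite exprn_gt0.
- by have : 0 < cos g ^+ 2 by [rewrite exprn_gt0]; lra.
- by rewrite -!exprMn uE cAB2; field.
- have -> : 1 - sin g ^+ 2 = cos g ^+ 2 by lra.
  rewrite -exprMn wE cAB1.
  have -> : 1 - sin p ^+ 2 = cos p ^+ 2 by lra.
  have -> : 1 - sin q ^+ 2 = cos q ^+ 2 by lra.
  by field.
- apply: sqr_le_mono.
  have -> : `|sin q| = sin `|q|.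
    have [q0|q0] := leP 0 q; first by rewrite !ger0_norm// sing// (le_trans (ler_norm q)).
    rewrite (ltr0_norm q0) -normrN -sinN ger0_norm//; apply: sing.
      by rewrite oppr_ge0 ltW.
    by rewrite -(ltr0_norm q0).
  exact: sinm.
- apply: sqr_le_mono; rewrite ger0_norm ?sing//.
  exact: sinm.
Qed.

(** The threshold makes all sides at most [1/2] after rescaling by [Num.sqrt kappa]. Scaling back
    divides a fourth-order error by a square, whence the factor [kappa] in the constant. *)
Lemma midpoint_comparison_sphere kappa : 0 < kappa ->
  midpoint_comparison kappa (2 * Num.sqrt kappa)^-1 (4 * kappa)
    (fun x => 1 - cos (Num.sqrt kappa * x)).
Proof.
move=> k0 a b c rho a0 b0 c0 ar br cr rr abc bac cab.
set k := Num.sqrt kappa.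
have kp : 0 < k by rewrite sqrtr_gt0.
have k2 : k ^+ 2 = kappa by rewrite sqr_sqrtr// ltW.
have kn : k != 0 by rewrite gt_eqF.
have md s1 s2 s3 t1 t2 t3 :
    model_dist kappa (s1 / k, s2 / k, s3 / k) (t1 / k, t2 / k, t3 / k)
    = acos (s1 * t1 + s2 * t2 + s3 * t3) / k.
  by rewrite /model_dist k0 /edot/= -/k -{1}k2; congr (acos _ / _); field.
have im s1 s2 s3 : s1 ^+ 2 + s2 ^+ 2 + s3 ^+ 2 = 1 -> in_model kappa (s1 / k, s2 / k, s3 / k).
  move=> e; rewrite /in_model k0 /edot/= -k2.
  have -> : s1 / k * (s1 / k) + s2 / k * (s2 / k) + s3 / k * (s3 / k)
    = (s1 ^+ 2 + s2 ^+ 2 + s3 ^+ 2) / k ^+ 2 by field.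
  by rewrite e mul1r.
have ck x : k * x / k = x by rewrite mulrAC divff// mul1r.
have pi2 := @pi_ge2 R.
have acE s t : 0 <= k * t -> k * t <= 1 -> s = cos (k * t) -> acos s / k = t.
  move=> t0 t1 ->; rewrite cosK ?ck// in_itv/= t0.
  by apply: le_trans t1 (le_trans _ pi2); rewrite ler1n.
pose A := k * a; pose B := k * b; pose g := k * (c / 2); pose P := k * rho.
have P1 : P <= 2^-1.
  rewrite /P -ler_pdivlMl//; apply: le_trans rr _.
  by rewrite -/k invfM mulrC.
have h2 : 2^-1 <= 1 :> R by lra.
have [A0 B0 g0] : [/\ 0 <= A, 0 <= B & 0 <= g].
  by split; apply: mulr_ge0; rewrite ?(ltW kp)// divr_ge0.
have [AP BP gP] : [/\ A <= P, B <= P & g <= P / 2].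
  by rewrite /A /B /g /P -mulrA; split; rewrite ler_pM2l//; lra.
have tri1 : g <= (A + B) / 2.
  by rewrite /A /B /g -mulrDr -mulrA ler_pM2l//; lra.
have tri2 : `|(A - B) / 2| <= g.
  rewrite /A /B /g -mulrBr -mulrA normrM gtr0_norm// ler_pM2l// ler_norml; lra.
have g1 : g <= 2^-1 by lra.
have [u [v [w [w0 wE uE uvw]]]] :=
  sphere_triangle _ _ _ A0 (le_trans AP P1) B0 (le_trans BP P1) g0 g1 tri1 tri2.
have e1 := cos2Dsin2 g.
exists (- sin g / k, 0 / k, cos g / k), (sin g / k, 0 / k, cos g / k),
  (u / k, v / k, w / k), (0 / k, 0 / k, 1 / k).
split.
  split; apply: im => //; last by rewrite !expr0n !add0r expr1n.
    by rewrite sqrrN expr0n addr0 addrC.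
  by rewrite expr0n addr0 addrC.
rewrite !md.
split.
  split; apply: acE => //.
  - by rewrite mulr_ge0// ltW.
  - by move: g1; rewrite /g; lra.
  - have -> : k * c = g + g by rewrite /g; field.
    rewrite cosD; ring.
  - by rewrite -/B; lra.
  - by rewrite -/B mul0r addr0 mulNr (mulrC (sin g)) (mulrC (cos g)) uE wE; field.
  - by rewrite -/A; lra.
  - by rewrite -/A mul0r addr0 (mulrC (sin g)) (mulrC (cos g)) uE wE; field.
  - exact: le_trans g1 h2.
  - by rewrite !mulr0 !add0r mulr1.
  - exact: le_trans g1 h2.
  - by rewrite !mul0r !add0r mul1r.
rewrite !mul0r mul1r !add0r => x x0 xm.
have w1 : w <= 1.
  rewrite leNgt; apply/negP => w1; have : 1 < w ^+ 2 by rewrite exprn_egt1.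
  by have := sqr_ge0 u; have := sqr_ge0 v; move: uvw; clear; lra.
pose X := k * x.
have X0 : 0 <= X by apply: mulr_ge0 => //; exact: ltW.
have Xm : X <= acos w by move: xm; rewrite /X ler_pdivlMr// mulrC.
have wI : -1 <= w <= 1 by rewrite w1 andbT; apply: le_trans (ltW w0); rewrite oppr_le0.
have am := acos_lepi wI; have am0 := acos_ge0 wI.
have cX : w <= cos X.
  rewrite -[leLHS]acosK ?in_itv//= leNgt (@ltr_cos R) -?leNgt// in_itv/= ?am0 ?am// X0.
  exact: le_trans Xm am.
(* As [w] is positive, the median is at most [pi / 2], which is below [2]. *)
have Xh : X <= 2.
  apply: le_trans (ltW (@pihalf_lt2 R)); rewrite -acos0; apply: le_trans Xm _.
  have h0I : -1 <= (0 : R) <= 1 by rewrite ler01 oppr_le0 ler01.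
  have a1 := acos_lepi h0I; have a0' := acos_ge0 h0I.
  rewrite leNgt -(@ltr_cos R); last 2 first.
  - by rewrite in_itv/= a0'.
  - by rewrite in_itv/= am0.
  by rewrite !acosK// ?in_itv//= -leNgt ltW.
have [S1 XX] := sphere_estimate _ _ _ _ _ _ A0 AP B0 BP g0 gP X0 Xh w1 (ltW w0) wE cX.
split; first exact: S1.
have kk : 0 < k ^+ 2 by rewrite k2.
rewrite -(ler_pM2l kk).
have -> : k ^+ 2 * x ^+ 2 = X ^+ 2 by rewrite /X; ring.
have -> : k ^+ 2 * ((a ^+ 2 + b ^+ 2) / 2 - c ^+ 2 / 4 + 4 * kappa * rho ^+ 4)
  = (A ^+ 2 + B ^+ 2) / 2 - g ^+ 2 + 4 * P ^+ 4.
  by rewrite /A /B /g /P -k2; field.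
exact: XX.
Qed.

(** The spherical construction carried over to the hyperboloid, with its vertex in the role of the
    north pole. *)
Lemma hyperbolic_triangle (A B g : R) : 0 <= g -> g <= (A + B) / 2 -> `|(A - B) / 2| <= g ->
  exists u v w, [/\ 0 < w, w * cosh g = (cosh A + cosh B) / 2,
    u * sinh g = (cosh B - cosh A) / 2 & w ^+ 2 - u ^+ 2 - v ^+ 2 = 1].
Proof.
move=> g0 tri1 tri2.
pose p := (A + B) / 2; pose q := (A - B) / 2.
have cAB1 : cosh A + cosh B = 2 * (cosh p * cosh q).
  have -> : A = p + q by rewrite /p /q; field.
  have -> : B = p + - q by rewrite /p /q; field.
  by rewrite !coshD coshN sinhN; ring.
have cAB2 : cosh B - cosh A = - 2 * (sinh p * sinh q).
  have -> : A = p + q by rewrite /p /q; field.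
  have -> : B = p + - q by rewrite /p /q; field.
  by rewrite !coshD coshN sinhN; ring.
have coshp x : 0 < cosh x by apply: lt_le_trans (cosh_ge1 x).
pose w := (cosh A + cosh B) / (2 * cosh g).
pose u := (cosh B - cosh A) / (2 * sinh g).
have wE : w * cosh g = (cosh A + cosh B) / 2 by rewrite /w; field; rewrite gt_eqF.
have w0 : 0 < w by apply: divr_gt0; [exact: addr_gt0|exact: mulr_gt0].
suff [uE uw] : u * sinh g = (cosh B - cosh A) / 2 /\ 1 + u ^+ 2 <= w ^+ 2.
  exists u, (Num.sqrt (w ^+ 2 - 1 - u ^+ 2)), w; split => //.
  by rewrite sqr_sqrtr; [ring|lra].
have [g_0|gn0] := eqVneq g 0.
  have AB : A = B by move: tri2; rewrite g_0 normr_le0 => /eqP; lra.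
  rewrite /u /w AB subrr !mul0r g_0 cosh0 expr0n addr0; split => //.
  have -> : (cosh B + cosh B) / (2 * 1) = cosh B by field.
  by rewrite exprn_ege1// cosh_ge1.
have gp : 0 < g by rewrite lt_def gn0.
have sg : 0 < sinh g.
  have := cosh_lt 0 g (lexx 0) gp; rewrite cosh0; have := cosh2Bsinh2 g.
  by have := sinh_ge0 g g0; nra.
have uE : u * sinh g = (cosh B - cosh A) / 2 by rewrite /u; field; rewrite gt_eqF.
split=> //.
have e1 := cosh2Bsinh2 g; have e2 := cosh2Bsinh2 p; have e3 := cosh2Bsinh2 q.
apply: (@hyperboloid_constraint (u ^+ 2) (w ^+ 2) (sinh p ^+ 2) (sinh q ^+ 2) (sinh g ^+ 2)).
- by rewrite exprn_gt0.
- by rewrite -!exprMn uE cAB2; field.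
- by rewrite -e1 -e2 -e3 -!exprMn wE cAB1; field.
- apply: sqr_le_mono.
  have -> : `|sinh q| = sinh `|q|.
    have [q0|q0] := leP 0 q; first by rewrite !ger0_norm// sinh_ge0.
    rewrite (ltr0_norm q0) -normrN -sinhN ger0_norm//; apply: sinh_ge0.
    by rewrite oppr_ge0 ltW.
  exact: sinh_mono.
- by apply: sqr_le_mono; rewrite ger0_norm ?sinh_ge0//; exact: sinh_mono.
Qed.

(** The lower bound [1 + X ^+ 2 / 2 <= cosh X] has no fourth-order correction, so that, unlike on
    the sphere, no preliminary bound on [X] enters. *)
Lemma hyperbolic_estimate (A B g P X w : R) : 0 <= A -> A <= P -> 0 <= B -> B <= P ->
  P <= 2^-1 -> 0 <= g -> 0 <= X -> 1 <= w ->
  w * cosh g = (cosh A + cosh B) / 2 -> cosh X <= w ->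
  cosh X <= (cosh A + cosh B) / 2 /\
  X ^+ 2 <= (A ^+ 2 + B ^+ 2) / 2 - g ^+ 2 + 4 * P ^+ 4.
Proof.
move=> A0 AP B0 BP P1 g0 X0 w1 wE cX; have cg1 := cosh_ge1 g.
have cgA := cosh_le_taylor4 _ A0 (le_trans AP P1).
have cgB := cosh_le_taylor4 _ B0 (le_trans BP P1).
have cgg := cosh_ge_taylor2 _ g0; have cgX := cosh_ge_taylor2 _ X0.
have A4 := pow4_mono _ _ A0 AP; have B4 := pow4_mono _ _ B0 BP.
have wg : w - 1 <= (w - 1) * cosh g by rewrite ler_peMr// subr_ge0.
split; first by lra.
have P4 : 0 <= P ^+ 4 by rewrite exprn_even_ge0.
lra.
Qed.

Lemma midpoint_comparison_hyperbolic kappa : kappa < 0 ->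
  midpoint_comparison kappa (2 * Num.sqrt (- kappa))^-1 (4 * - kappa)
    (fun x => cosh (Num.sqrt (- kappa) * x)).
Proof.
move=> k0 a b c rho a0 b0 c0 ar br cr rr abc bac cab.
set k := Num.sqrt (- kappa).
have kp : 0 < k by rewrite sqrtr_gt0 oppr_gt0.
have k2 : k ^+ 2 = - kappa by rewrite sqr_sqrtr// oppr_ge0 ltW.
have kE : kappa = - k ^+ 2 by rewrite k2 opprK.
have kn : k != 0 by rewrite gt_eqF.
have nk : (0 < kappa) = false by apply/negbTE; rewrite -leNgt ltW.
have nk0 : (kappa == 0) = false by rewrite lt_eqF.
have md s1 s2 s3 t1 t2 t3 :
    model_dist kappa (s1 / k, s2 / k, s3 / k) (t1 / k, t2 / k, t3 / k)
    = acosh (s3 * t3 - s1 * t1 - s2 * t2) / k.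
  by rewrite /model_dist nk nk0 /ldot/= -/k {1}kE; congr (acosh _ / _); field.
have im s1 s2 s3 : s3 ^+ 2 - s1 ^+ 2 - s2 ^+ 2 = 1 -> 0 < s3 ->
    in_model kappa (s1 / k, s2 / k, s3 / k).
  move=> e s30; rewrite /in_model nk nk0 /ldot/=; split; last by rewrite divr_gt0.
  have -> : s1 / k * (s1 / k) + s2 / k * (s2 / k) - s3 / k * (s3 / k)
    = (s3 ^+ 2 - s1 ^+ 2 - s2 ^+ 2) / - k ^+ 2 by field.
  by rewrite e mul1r -kE.
have ck x : k * x / k = x by rewrite mulrAC divff// mul1r.
have acE s t : 0 <= k * t -> s = cosh (k * t) -> acosh s / k = t.
  by move=> t0 ->; rewrite acoshK.
pose A := k * a; pose B := k * b; pose g := k * (c / 2); pose P := k * rho.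
have P1 : P <= 2^-1.
  rewrite /P -ler_pdivlMl//; apply: le_trans rr _.
  by rewrite -/k invfM mulrC.
have [A0 B0 g0] : [/\ 0 <= A, 0 <= B & 0 <= g].
  by split; apply: mulr_ge0; rewrite ?(ltW kp)// divr_ge0.
have [AP BP] : A <= P /\ B <= P by rewrite /A /B /P; split; rewrite ler_pM2l.
have tri1 : g <= (A + B) / 2.
  by rewrite /A /B /g -mulrDr -mulrA ler_pM2l//; lra.
have tri2 : `|(A - B) / 2| <= g.
  rewrite /A /B /g -mulrBr -mulrA normrM gtr0_norm// ler_pM2l// ler_norml; lra.
have [u [v [w [w0 wE uE uvw]]]] := hyperbolic_triangle _ _ _ g0 tri1 tri2.
have e1 := cosh2Bsinh2 g.
have cgp : 0 < cosh g by apply: lt_le_trans (cosh_ge1 g).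
exists (- sinh g / k, 0 / k, cosh g / k), (sinh g / k, 0 / k, cosh g / k),
  (u / k, v / k, w / k), (0 / k, 0 / k, 1 / k).
split.
  split; apply: im => //; rewrite ?expr0n ?expr1n ?sqrrN/= ?subr0//.
    by rewrite e1 addrK.
  by rewrite e1 addrK.
rewrite !md.
split.
  split; apply: acE => //.
  - by rewrite mulr_ge0// ltW.
  - have -> : k * c = g + g by rewrite /g; field.
    rewrite coshD; ring.
  - by rewrite -/B mul0r subr0 mulNr opprK (mulrC (sinh g)) (mulrC (cosh g)) uE wE; field.
  - by rewrite -/A mul0r subr0 (mulrC (sinh g)) (mulrC (cosh g)) uE wE; field.
  - by rewrite !mulr0 !subr0 mulr1.
  - by rewrite !mul0r !subr0 mul1r.
rewrite !mul0r mul1r !subr0 => x x0 xm.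
have w1 : 1 <= w.
  rewrite leNgt; apply/negP => w1; have : w ^+ 2 < 1 by rewrite expr_lt1// ltW.
  by have := sqr_ge0 u; have := sqr_ge0 v; move: uvw; clear; lra.
pose X := k * x.
have X0 : 0 <= X by apply: mulr_ge0 => //; exact: ltW.
have Xm : X <= acosh w by move: xm; rewrite /X ler_pdivlMr// mulrC.
have cX : cosh X <= w.
  have [aw <-] := cosh_acosh _ w1.
  exact: cosh_mono.
have [S1 XX] := hyperbolic_estimate _ _ _ _ _ _ A0 AP B0 BP P1 g0 X0 w1 wE cX.
split; first exact: S1.
have kk : 0 < k ^+ 2 by rewrite exprn_gt0.
rewrite -(ler_pM2l kk).
have -> : k ^+ 2 * x ^+ 2 = X ^+ 2 by rewrite /X; ring.
have -> : k ^+ 2 * ((a ^+ 2 + b ^+ 2) / 2 - c ^+ 2 / 4 + 4 * - kappa * rho ^+ 4)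
  = (A ^+ 2 + B ^+ 2) / 2 - g ^+ 2 + 4 * P ^+ 4.
  by rewrite /A /B /g /P -k2; field.
exact: XX.
Qed.

(** The bound against [Dk kappa] keeps triangles with sides below [rho0] under the perimeter
    threshold of the CAT condition. *)
Lemma midpoint_comparisonP kappa : exists rho0 K (S : R -> R),
  [/\ 0 < rho0, 0 <= K, ((2 * rho0)%:E <= Dk kappa)%E,
    (forall x z, 0 <= x -> x < z -> z <= rho0 -> S x < S z) &
    midpoint_comparison kappa rho0 K S].
Proof.
have [k0|k0|->] := ltgtP kappa 0.
- exists (2 * Num.sqrt (- kappa))^-1, (4 * - kappa), (fun x => cosh (Num.sqrt (- kappa) * x)).
  have kp : 0 < Num.sqrt (- kappa) by rewrite sqrtr_gt0; lra.
  split; last exact: midpoint_comparison_hyperbolic.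
  - by rewrite invr_gt0; apply: mulr_gt0.
  - by lra.
  - by rewrite /Dk ltNge (ltW k0)/= leey.
  - move=> x z x0 xz _; apply: cosh_lt; last by rewrite ltr_pM2l.
    by apply: mulr_ge0 => //; exact: ltW.
- exists (2 * Num.sqrt kappa)^-1, (4 * kappa), (fun x => 1 - cos (Num.sqrt kappa * x)).
  have kp : 0 < Num.sqrt kappa by rewrite sqrtr_gt0.
  split; last exact: midpoint_comparison_sphere.
  - by rewrite invr_gt0; apply: mulr_gt0.
  - by lra.
  - rewrite /Dk k0 lee_fin invfM mulrA divff ?mul1r; last by lra.
    have := @pi_ge2 R; have : 0 < (Num.sqrt kappa)^-1 by rewrite invr_gt0.
    nra.
  - move=> x z x0 xz zr.
    have z1 : Num.sqrt kappa * z <= 1.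
      rewrite -ler_pdivlMl// mulr1; apply: le_trans zr _.
      by rewrite lef_pV2 ?posrE ?mulr_gt0//; lra.
    have kx : 0 <= Num.sqrt kappa * x by apply: mulr_ge0 => //; exact: ltW.
    have kxz : Num.sqrt kappa * x < Num.sqrt kappa * z by rewrite ltr_pM2l.
    have := @pi_ge2 R => pi2.
    by rewrite ltrD2l ltrN2 (@ltr_cos R)// in_itv/=; lra.
- exists 1, 0, (fun x => x ^+ 2); split => //; last exact: midpoint_comparison_flat.
  - by rewrite /Dk ltxx leey.
  - by move=> x z x0 xz _; nra.
Qed.

Lemma model_distxx kappa (a : R * R * R) : in_model kappa a -> model_dist kappa a a = 0.
Proof.
rewrite /in_model /model_dist; case: (ltgtP kappa 0) => k0.
- by move=> [-> _]; rewrite divff ?lt_eqF// /acosh expr1n subrr sqrtr0 addr0 ln1 mul0r.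
- by move=> ->; rewrite divff ?gt_eqF// acos1 mul0r.
- by move=> _; rewrite !subrr expr0n/= !addr0 sqrtr0.
Qed.

End Model.

(** Each [t] is the midpoint of an endpoint and another parameter, so the supremum [M] of [f]
    satisfies [M <= M / 2 + delta]; as [M] is finite, it can be cancelled. *)
Lemma midpoint_convex_le {R : realType} (f : R -> R) (B delta : R) :
  (forall t, 0 <= t -> t <= 1 -> f t <= B) -> f 0 <= 0 -> f 1 <= 0 -> 0 <= delta ->
  (forall s t, 0 <= s -> s <= 1 -> 0 <= t -> t <= 1 ->
     f ((s + t) / 2) <= (f s + f t) / 2 + delta) ->
  forall t, 0 <= t -> t <= 1 -> f t <= 2 * delta.
Proof.
move=> fB f0 f1 d0 fm.
pose A := [set f t | t in [set t | 0 <= t /\ t <= 1]].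
have hA : has_sup A.
  split; first by exists (f 0), 0 => //=; split; lra.
  by exists B => _ [t [t0 t1] <-]; exact: fB.
have AM t : 0 <= t -> t <= 1 -> f t <= sup A.
  by move=> t0 t1; apply: ub_le_sup; [exact: hA.2|exists t].
have : sup A <= sup A / 2 + delta.
  apply: ge_sup; first exact: hA.1.
  move=> _ [t [t0 t1] <-].
  have [th|th] := leP t 2^-1.
    have := fm 0 (2 * t) (lexx _) ler01.
    have -> : (0 + 2 * t) / 2 = t by field.
    have t2 : 0 <= 2 * t by lra.
    have t3 : 2 * t <= 1 by lra.
    by move=> /(_ t2 t3); have := AM _ t2 t3; lra.
  have := fm 1 (2 * t - 1) ler01 (lexx _).
  have -> : (1 + (2 * t - 1)) / 2 = t by field.
  have t2 : 0 <= 2 * t - 1 by lra.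
  have t3 : 2 * t - 1 <= 1 by lra.
  by move=> /(_ t2 t3); have := AM _ t2 t3; lra.
by move=> H t t0 t1; have := AM t t0 t1; lra.
Qed.

(** * Elementary facts on geodesics in metric spaces *)

Section Metric.
Context {R : realType} {Y : Type} {d : Y -> Y -> R}.
Hypothesis dM : is_metric d.

Lemma dist_ge0 x y : 0 <= d x y. Proof. by case: dM => H _; exact: H. Qed.
Lemma dist_sym x y : d x y = d y x. Proof. by case: dM => _ [_ [H _]]; exact: H. Qed.
Lemma dist_tri y x z : d x z <= d x y + d y z.
Proof. by case: dM => _ [_ [_ H]]; exact: H. Qed.
Lemma distxx x : d x x = 0. Proof. by case: dM => _ [H _]; exact/H. Qed.
Lemma dist_eq0 x y : d x y = 0 -> x = y. Proof. by case: dM => _ [H _] /H. Qed.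

Lemma geodesic_dist0 g x z t : cs_geodesic d g x z -> 0 <= t -> t <= 1 ->
  d x (g t) = t * d x z.
Proof.
move=> [g0 [g1 gd]] t0 t1; rewrite -{1}g0 gd ?lexx ?ler01 ?t0 ?t1//.
by rewrite sub0r normrN ger0_norm.
Qed.

Lemma sub_geodesic g x z s t : cs_geodesic d g x z -> 0 <= s -> s <= 1 -> 0 <= t -> t <= 1 ->
  cs_geodesic d (fun u => g (s + u * (t - s))) (g s) (g t).
Proof.
move=> [g0 [g1 gd]] s0 s1 t0 t1; split; first by rewrite mul0r addr0.
split; first by rewrite mul1r addrC subrK.
have I u : 0 <= u <= 1 -> 0 <= s + u * (t - s) <= 1.
  by move=> /andP[u0 u1]; apply/andP; split; nra.
move=> u v uI vI; rewrite !gd ?I ?s0 ?s1 ?t0 ?t1//.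
have -> : s + u * (t - s) - (s + v * (t - s)) = (u - v) * (t - s) by ring.
by rewrite normrM (distrC s t) mulrA.
Qed.

Lemma geodesic_in_ball g x z y t r : cs_geodesic d g x z -> d y x < r -> d y z < r ->
  0 <= t -> t <= 1 -> d y (g t) < 3 * r.
Proof.
move=> gG yx yz t0 t1.
have := geodesic_dist0 _ _ _ _ gG t0 t1.
have := dist_tri x y (g t); have := dist_tri y x z; rewrite (dist_sym x y).
have := dist_ge0 x z; have := dist_ge0 y x; have := dist_ge0 y z; nra.
Qed.

End Metric.

(** The CAT(0) inequality up to an error of fourth order in the size [rho] of the triangle, which
    still tends to [0] after division by [rho ^+ 2]. *)
Definition local_quadratic {R : realType} {Y : Type} (d : Y -> Y -> R) (y : Y) (r K : R) :=
  forall x z0 z1 g rho t, d y x < r -> d y z0 < r -> d y z1 < r ->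
    cs_geodesic d g z0 z1 -> d x z0 <= rho -> d x z1 <= rho -> d z0 z1 <= rho ->
    0 <= t -> t <= 1 ->
    d x (g t) ^+ 2 <= (1 - t) * d x z0 ^+ 2 + t * d x z1 ^+ 2
                      - t * (1 - t) * d z0 z1 ^+ 2 + K * rho ^+ 4.

(** * The local quadratic inequality and the convexity of small balls *)

Section LocalCAT.
Context {R : realType} {Y : Type} {d : Y -> Y -> R} {kappa : R}.
Hypothesis HCAT : locally_CAT kappa d.

Let dM : is_metric d. Proof. by case: HCAT. Qed.
Let geo : geodesic_space d. Proof. by case: HCAT => _ [_ []]. Qed.

Lemma local_midpoint y : exists r K (S : R -> R), [/\ 0 < r, 0 <= K,
  ((2 * r)%:E <= Dk kappa)%E,
  (forall x z, 0 <= x -> x < z -> z <= 4 * r -> S x < S z) &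
  exists U : set Y, [/\ CAT_set kappa d U, forall z, d y z < 4 * r -> U z &
  forall x z0 z1 g, d y x < r -> d y z0 < r -> d y z1 < r -> cs_geodesic d g z0 z1 ->
    S (d x (g 2^-1)) <= (S (d x z0) + S (d x z1)) / 2 /\
    forall rho, d x z0 <= rho -> d x z1 <= rho -> d z0 z1 <= rho ->
      d x (g 2^-1) ^+ 2 <= (d x z0 ^+ 2 + d x z1 ^+ 2) / 2 - d z0 z1 ^+ 2 / 4 + K * rho ^+ 4]].
Proof.
have [rho0 [K [S [rho00 K0 Drho Smono mid]]]] := midpoint_comparisonP kappa.
have [_ [_ [_ /(_ y)[U [[r0 [r00 UB]] CU]]]]] := HCAT.
pose r := Num.min r0 rho0 / 4.
have rp : 0 < r by rewrite /r divr_gt0// lt_min r00.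
have rr0 : 4 * r <= r0.
  by rewrite /r mulrC divfK ?pnatr_eq0// ge_min lexx.
have rrho : 4 * r <= rho0.
  by rewrite /r mulrC divfK ?pnatr_eq0// ge_min lexx orbT.
have inU z : d y z < 4 * r -> U z by move=> zr; apply: UB; lra.
exists r, K, S; split => //.
- by apply: le_trans Drho; rewrite lee_fin; lra.
- by move=> x z x0 xz zr; apply: Smono => //; lra.
exists U; split => // x z0 z1 g yx yz0 yz1 gG.
have [g13 G13] := geo z0 x; have [g23 G23] := geo z1 x.
have gU h p q : cs_geodesic d h p q -> d y p < r -> d y q < r ->
    forall s, 0 <= s <= 1 -> U (h s).
  move=> hG yp yq s /andP[s0 s1]; apply: inU.
  have := geodesic_in_ball dM _ _ _ _ _ _ hG yp yq s0 s1.
  by have := dist_ge0 dM y (h s); lra.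
have d2 p q : d y p < r -> d y q < r -> d p q < 2 * r.
  by move=> yp yq; have := dist_tri dM y p q; rewrite (dist_sym dM p y); lra.
have main rho : d x z0 <= rho -> d x z1 <= rho -> d z0 z1 <= rho -> rho <= rho0 ->
    S (d x (g 2^-1)) <= (S (d x z0) + S (d x z1)) / 2 /\
    d x (g 2^-1) ^+ 2 <= (d x z0 ^+ 2 + d x z1 ^+ 2) / 2 - d z0 z1 ^+ 2 / 4 + K * rho ^+ 4.
  move=> r1 r2 r3 r4.
  have := mid (d z1 x) (d z0 x) (d z0 z1) rho (dist_ge0 dM _ _) (dist_ge0 dM _ _) (dist_ge0 dM _ _).
  rewrite (dist_sym dM z1 x) (dist_sym dM z0 x) => /(_ r2 r1 r3 r4).
  have t1 : d x z1 <= d x z0 + d z0 z1 by exact: dist_tri.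
  have t2 : d x z0 <= d x z1 + d z0 z1 by rewrite (dist_sym dM z0 z1); exact: dist_tri.
  have t3 : d z0 z1 <= d x z1 + d x z0.
    by have := dist_tri dM x z0 z1; rewrite (dist_sym dM z0 x); lra.
  move=> /(_ t1 t2 t3)[a1 [a2 [a3 [p [[m1 m2 m3 mp] [[e12 e13 e23 e1p ep2] H]]]]]].
  have D : d (g 2^-1) x <= model_dist kappa p a3.
    have gx : g13 1 = x by case: G13 => _ [].
    rewrite -[in leLHS]gx.
    case: CU => _ /(_ z0 z1 x g g13 g23); apply.
    - by apply: inU; lra.
    - by apply: inU; lra.
    - by apply: inU; lra.
    - exact: gG.
    - exact: G13.
    - exact: G23.
    - by move=> s sI; split; [|split]; [exact: (gU _ _ _ gG)|exact: (gU _ _ _ G13)|exact: (gU _ _ _ G23)].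
    - have : ((4 * rho0)%:E <= 2%:E * Dk kappa)%E.
        have -> : (4 * rho0)%:E = (2%:E * (2 * rho0)%:E)%E :> \bar R.
          by rewrite -EFinM; congr (_%:E); ring.
        by rewrite lee_pmul2l// ?fin_numE// lte_fin.
      apply: lt_le_trans; rewrite lte_fin.
      by have := d2 _ _ yz0 yz1; have := d2 _ _ yz0 yx; have := d2 _ _ yz1 yx; lra.
    - exact: m1.
    - exact: m2.
    - exact: m3.
    - exact: e12.
    - by rewrite (dist_sym dM z0 x).
    - by rewrite (dist_sym dM z1 x).
    - by rewrite invr_ge0 ler0n invf_le1//; lra.
    - by rewrite lexx ler01.
    - exact: mp.
    - exact: m3.
    - by rewrite e1p mulrC.
    - by rewrite ep2; field.
    - by rewrite mul1r e13 (dist_sym dM z0 x).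
    - by rewrite subrr mul0r model_distxx.
  have := H _ (dist_ge0 dM _ _) D; rewrite (dist_sym dM (g _) x) => -[h1 h2].
  by split; lra.
split.
  have L1 := d2 _ _ yx yz0; have L2 := d2 _ _ yx yz1; have L3 := d2 _ _ yz0 yz1.
  by have [||||] := main (2 * r); lra.
move=> rho r1 r2 r3.
have [rl|rl] := leP rho rho0; first by have [] := main rho r1 r2 r3 rl.
have L1 := d2 _ _ yx yz0; have L2 := d2 _ _ yx yz1; have L3 := d2 _ _ yz0 yz1.
have [||||_] := main rho0; try by lra.
have := pow4_mono _ _ (ltW rho00) (ltW rl); nra.
Qed.

(** Subtracting [q], whose midpoint defect is exactly the term in the squared length, leaves a
    function that is midpoint convex up to the error. Points of the geodesic are within [2 * rho] of
    [x], so the error is [16 * K * rho ^+ 4], which [midpoint_convex_le] doubles. *)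
Lemma local_quadraticP y : exists r K, [/\ 0 < r, 0 <= K & local_quadratic d y r K].
Proof.
have [r [K [S [r0 K0 _ _ [U [_ _ mid]]]]]] := local_midpoint y.
exists (r / 3), (32 * K); split; [by lra|by lra|].
move=> x z0 z1 g rho t yx yz0 yz1 gG r1 r2 r3 t0 t1.
pose q s := (1 - s) * d x z0 ^+ 2 + s * d x z1 ^+ 2 - s * (1 - s) * d z0 z1 ^+ 2.
have gr s : 0 <= s -> s <= 1 -> d y (g s) < r.
  by move=> s0 s1; have := geodesic_in_ball dM _ _ _ _ _ _ gG yz0 yz1 s0 s1; lra.
have rho0 : 0 <= rho by apply: le_trans r3; exact: dist_ge0.
have xg s : 0 <= s -> s <= 1 -> d x (g s) <= 2 * rho.
  move=> s0 s1; have := dist_tri dM z0 x (g s); rewrite (geodesic_dist0 _ _ _ _ gG)//.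
  by have := dist_ge0 dM z0 z1; nra.
have K4 : 0 <= K * (2 * rho) ^+ 4 by rewrite mulr_ge0// exprn_ge0//; lra.
have := @midpoint_convex_le R (fun s => d x (g s) ^+ 2 - q s)
  ((2 * rho) ^+ 2 + d z0 z1 ^+ 2) (K * (2 * rho) ^+ 4) _ _ _ K4 _ t t0 t1.
rewrite /q => H.
suff : d x (g t) ^+ 2 - q t <= 2 * (K * (2 * rho) ^+ 4) by rewrite /q; lra.
apply: H.
- move=> s s0 s1; have := xg s s0 s1; have := dist_ge0 dM x (g s).
  have := sqr_ge0 (d x z0); have := sqr_ge0 (d x z1); have := sqr_ge0 (d z0 z1).
  set u := d x (g s); set a := _ ^+ 2; set b := _ ^+ 2; set c := _ ^+ 2 => a0 b0 c0 u0 u1.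
  have : u ^+ 2 <= (2 * rho) ^+ 2 by nra.
  have : 0 <= (1 - s) * c + s * b by nra.
  have : s * (1 - s) * a <= a by have : s * (1 - s) <= 1 by [nra]; nra.
  lra.
- by case: gG => -> _; lra.
- by case: gG => _ [-> _]; lra.
move=> s u s0 s1 u0 u1.
have sG := sub_geodesic _ _ _ _ _ gG s0 s1 u0 u1.
have yx' : d y x < r by lra.
have [_] := mid x (g s) (g u) _ yx' (gr s s0 s1) (gr u u0 u1) sG.
have dsu : d (g s) (g u) = `|s - u| * d z0 z1.
  by case: gG => _ [_]; apply; apply/andP.
have su1 : `|s - u| <= 1 by rewrite ler_norml; lra.
have su2 : d (g s) (g u) <= 2 * rho.
  by rewrite dsu; have := dist_ge0 dM z0 z1; have := normr_ge0 (s - u); nra.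
move=> /(_ _ (xg s s0 s1) (xg u u0 u1) su2).
have -> : s + 2^-1 * (u - s) = (s + u) / 2 by field.
rewrite dsu exprMn real_normK ?num_real//; lra.
Qed.

(** Thinness of triangles is inherited from [U]; what has to be shown is that a small closed ball
    contains its geodesics. Since [S] of the distance to [y] is midpoint convex without error,
    [midpoint_convex_le] applies with [delta = 0]. *)
Lemma in_rball_near y : exists r, 0 < r /\ forall z, d y z < r -> in_rball kappa d y z.
Proof.
have [r [K [S [r0 K0 Dr Smono [U [CU UB mid]]]]]] := local_midpoint y.
pose r' := r / 6.
exists r'; split; first by rewrite /r'; lra.
move=> z yz; exists r'; split; first by rewrite /r'; lra.
split; first by apply: le_trans Dr; rewrite lee_fin /r'; lra.
split => //.
have quasi g x w : d y x <= r' -> d y w <= r' -> cs_geodesic d g x w ->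
    forall s, 0 <= s -> s <= 1 -> d y (g s) <= r'.
  move=> yx yw gG.
  have gr s : 0 <= s -> s <= 1 -> d y (g s) < r.
    move=> s0 s1; have := @geodesic_in_ball _ _ _ dM _ _ _ y s (r / 5) gG.
    by rewrite /r' in yx yw *; move=> H; have := H; lra.
  have Sle a b : 0 <= a -> a <= b -> b <= r -> S a <= S b.
    move=> a0; rewrite le_eqVlt => /orP[/eqP->//|ab br].
    by apply: ltW; apply: Smono => //; lra.
  have := @midpoint_convex_le R (fun s => S (d y (g s)) - S r') (S r - S r') 0 _ _ _ (lexx 0) _.
  move=> H s s0 s1; rewrite leNgt; apply/negP => lt_s.
  have : S r' < S (d y (g s)).
    apply: Smono => //; first by rewrite /r'; lra.
    by have := gr s s0 s1; lra.
  suff : S (d y (g s)) - S r' <= 2 * 0 by lra.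
  apply: H => //.
  - by move=> u u0 u1; rewrite lerD2r; apply: Sle; rewrite ?(dist_ge0 dM)// ltW// gr.
  - by case: gG => -> _; rewrite subr_le0; apply: Sle; rewrite ?(dist_ge0 dM)// /r'; lra.
  - by case: gG => _ [-> _]; rewrite subr_le0; apply: Sle; rewrite ?(dist_ge0 dM)// /r'; lra.
  move=> u v u0 u1 v0 v1.
  have uG := sub_geodesic _ _ _ _ _ gG u0 u1 v0 v1.
  have yy : d y y < r by rewrite (distxx dM).
  have [+ _] := mid y (g u) (g v) _ yy (gr u u0 u1) (gr v v0 v1) uG.
  have -> : u + 2^-1 * (v - u) = (u + v) / 2 by field.
  lra.
split.
  move=> x w /= yx yw _; have [g gG] := geo x w.
  by exists g; split => // s /andP[s0 s1]; exact: (quasi g x w).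
case: CU => _ CU x1 x2 x3 g12 g13 g23 /= U1 U2 U3 G12 G13 G23 UU.
have inU w : d y w <= r' -> U w by move=> yw; apply: UB; rewrite /r' in yw; lra.
apply: (CU x1 x2 x3 g12 g13 g23 (inU _ U1) (inU _ U2) (inU _ U3) G12 G13 G23).
by move=> s sI; have [? [? ?]] := UU s sI; split; [|split]; exact: inU.
Qed.

End LocalCAT.

(** * Limits in epsilon form *)

Section RealLimits.
Context {R : realType}.

Lemma cvg_right0P (f : R -> R) l : f @ 0^'+ --> l <->
  forall e, 0 < e -> exists2 r, 0 < r & forall t, 0 < t -> t < r -> `|f t - l| < e.
Proof.
split=> [/cvgrPdist_lt fl e e0|H].
  have [r /= r0 H] := fl e e0; exists r => // t t0 tr.
  by rewrite distrC; apply: H => //=; rewrite sub0r normrN gtr0_norm.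
apply/cvgrPdist_lt => e e0; have [r r0 Hr] := H e e0.
exists r => // t /=; rewrite sub0r normrN => tr t0; rewrite distrC.
by apply: Hr => //; rewrite -(gtr0_norm t0).
Qed.

Lemma cvgn_eps (u : nat -> R) l :
  (forall e, 0 < e -> exists N : nat, forall n, (N <= n)%N -> `|u n - l| < e) ->
  u @ \oo --> l.
Proof.
move=> H; apply/cvgrPdist_lt => e e0; have [N HN] := H e e0.
by exists N => // n /= Nn; rewrite distrC; exact: HN.
Qed.

Lemma cauchy_cvgn (u : nat -> R) :
  (forall e, 0 < e -> exists N : nat, forall m n, (N <= m)%N -> (N <= n)%N -> `|u m - u n| < e) ->
  forall e, 0 < e -> exists N : nat, forall n, (N <= n)%N -> `|u n - limn u| < e.
Proof.
move=> H.
have cu : cvgn u.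
  apply: cauchy_cvg; apply/cauchy_exP => e e0; have [N HN] := H e e0.
  by exists (u N); exists N => // n /= Nn; apply: HN.
move=> e e0; have /cvgrPdist_lt/(_ e e0)[N _ HN] := cu.
by exists N => n Nn; rewrite distrC; apply: HN.
Qed.

Lemma le_of_eps (a b : R) : (forall e, 0 < e -> a <= b + e) -> a <= b.
Proof. by move=> H; apply/ler_addgt0Pr. Qed.

Lemma pow2_ge_succ (n : nat) : n.+1%:R <= 2 ^+ n :> R.
Proof.
elim: n => [|n IH]; first by rewrite expr0.
by rewrite exprS -addn1 natrD; have : 0 <= n%:R :> R by [rewrite ler0n]; move: IH; rewrite -addn1 natrD; lra.
Qed.

End RealLimits.

(** Keeps visible the time [T] and the speed [L] hidden in [germ], on which the quantitative
    estimates depend. *)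
Definition germ_on {R : realType} {Y : Type} (d : Y -> Y -> R) (y : Y) (T L : R) (g : R -> Y) :=
  [/\ g 0 = y, 0 < T, 0 <= L &
    forall s t, 0 <= s <= T -> 0 <= t <= T -> d (g s) (g t) = L * `|s - t|].

(** * The tangent cone: existence of its distances and its metric structure *)

Section Tangent.
Context {R : realType} {Y : Type} {d : Y -> Y -> R} {y : Y} {r K : R}.
Hypotheses (dM : is_metric d) (r0 : 0 < r) (K0 : 0 <= K).
Hypothesis LQ : local_quadratic d y r K.
Implicit Types (g h k : R -> Y) (V W Z : nat -> R -> Y).

Lemma germP g : germ d y g <-> exists T L, germ_on d y T L g.
Proof.
split=> [[g0 [T [L [T0 [L0 H]]]]]|[T [L [g0 T0 L0 H]]]]; first by exists T, L.
by split => //; exists T, L.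
Qed.

Lemma germ_onW g T L T' : germ_on d y T L g -> 0 < T' -> T' <= T -> germ_on d y T' L g.
Proof.
move=> [g0 T0 L0 H] T'0 TT; split => // s t /andP[s0 s1] /andP[t0 t1].
by apply: H; apply/andP; split => //; lra.
Qed.

Lemma germ_on_dist g T L t : germ_on d y T L g -> 0 <= t -> t <= T -> d y (g t) = L * t.
Proof.
move=> [g0 T0 L0 H] t0 tT; rewrite -{1}g0 H ?lexx ?t0 ?tT ?ltW//.
by rewrite sub0r normrN ger0_norm.
Qed.

Lemma germ_on_geodesic g T L t : germ_on d y T L g -> 0 <= t -> t <= T ->
  cs_geodesic d (fun u => g (u * t)) y (g t).
Proof.
move=> gG t0 tT; have [g0 T0 L0 H] := gG; split; first by rewrite mul0r.
split; first by rewrite mul1r.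
move=> u v /andP[u0 u1] /andP[v0 v1]; rewrite (germ_on_dist _ _ _ _ gG)//.
rewrite H; try by apply/andP; split; nra.
by rewrite -mulrBl normrM (ger0_norm t0); ring.
Qed.

(** The quadratic inequality is applied along [g] from the vertex [h t], then along [h] from the
    vertex [g (th * t)]. All terms in the lengths [L1 * t] and [L2 * t] cancel, and each application
    contributes one error. *)
Lemma germ_contract g h T L1 L2 L t th : germ_on d y T L1 g -> germ_on d y T L2 h ->
  L1 <= L -> L2 <= L -> 0 < t -> t <= T -> L * t < r -> 0 < th -> th <= 1 ->
  d (g (th * t)) (h (th * t)) ^+ 2 <= th ^+ 2 * d (g t) (h t) ^+ 2 + 2 * K * (2 * L * t) ^+ 4.
Proof.
move=> gG hG L1L L2L t0 tT Lt th0 th1.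
have t0' := ltW t0.
have [_ T0 L10 _] := gG; have [_ _ L20 _] := hG.
have dg := germ_on_dist _ _ _ _ gG t0' tT.
have dh := germ_on_dist _ _ _ _ hG t0' tT.
have tt0 : 0 <= th * t by nra.
have ttT : th * t <= T by nra.
have dgt := germ_on_dist _ _ _ _ gG tt0 ttT.
have yy : d y y < r by rewrite (distxx dM).
have Lt0 : 0 <= L * t by nra.
have LL : L1 * (th * t) <= L1 * t by apply: ler_wpM2l => //; nra.
have gr : d y (g t) < r by rewrite dg; nra.
have hr : d y (h t) < r by rewrite dh; nra.
have gtr : d y (g (th * t)) < r.
  by rewrite dgt; nra.
have T1 := dist_tri dM y (h t) (g t); have T2 := dist_tri dM y (g (th * t)) (h t).
have := LQ (h t) y (g t) _ (2 * L * t) th hr yy gr (germ_on_geodesic _ _ _ _ gG t0' tT).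
rewrite (dist_sym dM (h t) y) dh dg (dist_sym dM (h t) (g t)).
have e1 : L2 * t <= 2 * L * t by nra.
have e2 : d (g t) (h t) <= 2 * L * t.
  by move: T1; rewrite (dist_sym dM (h t) y) dh dg (dist_sym dM (h t) (g t)); nra.
have e3 : L1 * t <= 2 * L * t by nra.
move=> /(_ e1 e2 e3 (ltW th0) th1) H1.
have := LQ (g (th * t)) y (h t) _ (2 * L * t) th gtr yy hr (germ_on_geodesic _ _ _ _ hG t0' tT).
rewrite (dist_sym dM (g (th * t)) y) dh dgt (dist_sym dM _ (h t)).
have e4 : L1 * (th * t) <= 2 * L * t.
  by nra.
have e5 : d (h t) (g (th * t)) <= 2 * L * t.
  move: T2; rewrite (dist_sym dM (g (th * t)) y) dh dgt (dist_sym dM (g (th * t)) (h t)).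
  by nra.
move=> /(_ e4 e5 e1 (ltW th0) th1) H2.
set D := d (g t) (h t) in H1 *; set F := d (h t) (g (th * t)) in H1 H2.
set E4 := (2 * L * t) ^+ 4 in H1 H2 *.
have E40 : 0 <= K * E4 by rewrite mulr_ge0// exprn_even_ge0.
apply: le_trans H2 _.
have H3 : th * F ^+ 2 <= th * ((1 - th) * (L2 * t) ^+ 2 + th * D ^+ 2 - th * (1 - th) * (L1 * t) ^+ 2 + K * E4).
  by rewrite ler_pM2l.
have H4 : th * (K * E4) <= K * E4 by nra.
have -> : 2 * K * E4 = K * E4 + K * E4 by ring.
have -> : (L1 * (th * t)) ^+ 2 = th ^+ 2 * (L1 * t) ^+ 2 by ring.
lra.
Qed.

(** Half of it bounds the error of one halving: [2 * K * (2 * L * v) ^+ 4] divided by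
    [u ^+ 2 >= v ^+ 2 / 4], up to the factor [v ^+ 2]. The other half pays for the geometric series
    of all smaller scales. *)
Definition germ_const (L : R) := 256 * K * L ^+ 4.

Lemma germ_const_ge0 L : 0 <= germ_const L.
Proof. by apply: mulr_ge0; [exact: mulr_ge0|exact: exprn_even_ge0]. Qed.

(** Using [germ_contract] directly with ratio [s / t] would leave an error of order
    [t ^+ 4 / s ^+ 2], unbounded as [s] tends to [0]. With ratios of at least one half each error is
    of the order of the squared scale, and these errors sum geometrically. *)
Lemma quotient_contract g h T L1 L2 L s t : germ_on d y T L1 g -> germ_on d y T L2 h ->
  L1 <= L -> L2 <= L -> t <= T -> L * t < r -> 0 < s -> s <= t ->
  (d (g s) (h s) / s) ^+ 2 <= (d (g t) (h t) / t) ^+ 2 + germ_const L * t ^+ 2.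
Proof.
move=> gG hG L1L L2L tT Lt s0 st.
have t0 : 0 < t by lra.
have [_ _ L10 _] := gG.
have C0 := germ_const_ge0 L.
have step u v : 0 < v -> v <= T -> L * v < r -> v / 2 <= u -> u <= v ->
    (d (g u) (h u) / u) ^+ 2 <= (d (g v) (h v) / v) ^+ 2 + germ_const L / 2 * v ^+ 2.
  move=> v0 vT Lv vu uv.
  have u0 : 0 < u by lra.
  have th0 : 0 < u / v by rewrite divr_gt0.
  have th1 : u / v <= 1 by rewrite ler_pdivrMr// mul1r.
  have uE : u / v * v = u by rewrite divfK// gt_eqF.
  have := germ_contract _ _ _ _ _ _ v (u / v) gG hG L1L L2L v0 vT Lv th0 th1.
  rewrite uE => H.
  have u2 : 0 < u ^+ 2 by rewrite exprn_gt0.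
  rewrite -(ler_pM2r u2) expr_div_n divfK ?gt_eqF//.
  apply: (le_trans H); rewrite [leRHS]mulrDl; apply: lerD.
    rewrite le_eqVlt; apply/orP; left; apply/eqP.
    by field; rewrite gt_eqF.
  rewrite /germ_const.
  have -> : 2 * K * (2 * L * v) ^+ 4 = K * L ^+ 4 * v ^+ 2 * (32 * v ^+ 2) by ring.
  have -> : 256 * K * L ^+ 4 / 2 * v ^+ 2 * u ^+ 2 = K * L ^+ 4 * v ^+ 2 * (128 * u ^+ 2) by field.
  have : 0 <= K * L ^+ 4 * v ^+ 2.
    by rewrite mulr_ge0 ?sqr_ge0// mulr_ge0// exprn_even_ge0.
  have : 32 * v ^+ 2 <= 128 * u ^+ 2 by nra.
  by move=> a b; rewrite ler_wpM2l.
have iter n : forall v, 0 < v -> v <= T -> L * v < r -> v / 2 ^+ n <= s -> s <= v ->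
    (d (g s) (h s) / s) ^+ 2 <= (d (g v) (h v) / v) ^+ 2 + germ_const L * v ^+ 2.
  elim: n => [|n IH] v v0 vT Lv vs sv.
    have -> : s = v by move: vs; rewrite expr0 divr1; lra.
    by have : 0 <= germ_const L * v ^+ 2 by [rewrite mulr_ge0// sqr_ge0]; lra.
  have vv : 0 <= germ_const L * v ^+ 2 by rewrite mulr_ge0// sqr_ge0.
  have [hs|hs] := leP (v / 2) s; first by have := step s v v0 vT Lv hs sv; lra.
  have e1 : 0 < v / 2 by lra.
  have e2 : v / 2 <= T by lra.
  have e3 : L * (v / 2) < r by nra.
  have e4 : v / 2 / 2 ^+ n <= s by move: vs; rewrite exprS invfM mulrA.
  have := IH _ e1 e2 e3 e4 (ltW hs).
  have e5 : v / 2 <= v by lra.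
  have := step (v / 2) v v0 vT Lv (lexx _) e5; lra.
pose n := Num.bound (t / s).
apply: (iter n) => //.
rewrite ler_pdivrMr ?exprn_gt0// mulrC -ler_pdivrMr//.
have := @archi_boundP _ (t / s); rewrite divr_ge0 ?(ltW t0) ?(ltW s0)// => /(_ isT).
rewrite -/n => nb; have := @pow2_ge_succ R n; rewrite -addn1 natrD; lra.
Qed.

(** By [quotient_contract] the squared quotient at any smaller time lies below [F t], so it
    converges to the infimum of [F]. The third clause bounds the limit by the quotient at one
    positive time; this is what applies to geodesics that vary with the time step. *)
Lemma gdist_limit g h : germ d y g -> germ d y h ->
  [/\ 0 <= gdist d g h,
   (forall e, 0 < e -> exists2 u, 0 < u & forall t, 0 < t -> t < u ->
      `|d (g t) (h t) / t - gdist d g h| < e) &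
   forall T L1 L2 L t, germ_on d y T L1 g -> germ_on d y T L2 h -> L1 <= L -> L2 <= L ->
     0 < t -> t <= T -> L * t < r ->
     gdist d g h ^+ 2 <= (d (g t) (h t) / t) ^+ 2 + germ_const L * t ^+ 2].
Proof.
move=> /germP[T1 [L1 gG1]] /germP[T2 [L2 hG2]].
pose L := Num.max L1 L2.
have L1L : L1 <= L by rewrite le_max lexx.
have L2L : L2 <= L by rewrite le_max lexx orbT.
have [_ T10 L10 _] := gG1; have [_ T20 _ _] := hG2.
have L0 : 0 <= L by lra.
pose T := Num.min (Num.min T1 T2) (r / (2 * (L + 1))).
have rL : 0 < r / (2 * (L + 1)) by rewrite divr_gt0//; lra.
have T0 : 0 < T by rewrite /T !lt_min T10 T20 rL.
have TT1 : T <= T1 by rewrite /T !ge_min lexx.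
have TT2 : T <= T2 by rewrite /T !ge_min lexx orbT.
have LT : L * T < r.
  have : T <= r / (2 * (L + 1)) by rewrite /T ge_min lexx orbT.
  rewrite ler_pdivlMr; last by lra.
  nra.
have gG := germ_onW _ _ _ _ gG1 T0 TT1.
have hG := germ_onW _ _ _ _ hG2 T0 TT2.
pose q t := d (g t) (h t) / t.
have q0 t : 0 < t -> 0 <= q t by move=> t0; rewrite divr_ge0 ?dist_ge0// ltW.
pose F t := q t ^+ 2 + germ_const L * t ^+ 2.
pose A := [set F t | t in [set t | 0 < t /\ t <= T]].
have C0 := germ_const_ge0 L.
have F0 t : 0 <= F t by rewrite addr_ge0 ?sqr_ge0// mulr_ge0// sqr_ge0.
have hA : has_inf A.
  split; first by exists (F T), T => //=; split.
  by exists 0 => _ [t _ <-]; exact: F0.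
pose m := inf A.
have m0 : 0 <= m by apply: lb_le_inf; [exact: hA.1|move=> _ [t _ <-]; exact: F0].
have mF t : 0 < t -> t <= T -> m <= F t.
  by move=> t0 tT; apply: ge_inf; [exact: hA.2|exists t].
have qm e : 0 < e -> exists2 u, 0 < u & forall t, 0 < t -> t < u -> `|q t ^+ 2 - m| < e.
  move=> e0; have [_ [t1 [t10 t1T] <-] Ft1] := @inf_adherent _ A e e0 hA.
  pose u := Num.min t1 (e / (germ_const L * T + 1)).
  have den : 0 < germ_const L * T + 1 by nra.
  exists u; first by rewrite lt_min t10 divr_gt0.
  move=> t t0; rewrite lt_min => /andP[tt1 te].
  have tT : t <= T by lra.
  have Lt1 : L * t1 < r by nra.
  have up := quotient_contract _ _ _ _ _ _ t t1 gG hG L1L L2L t1T Lt1 t0 (ltW tt1).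
  have lo := mF t t0 tT.
  move: te; rewrite ltr_pdivlMr// => te.
  have : germ_const L * t ^+ 2 < e.
    have : germ_const L * t ^+ 2 <= t * (germ_const L * T).
      have -> : germ_const L * t ^+ 2 = t * (germ_const L * t) by ring.
      by rewrite ler_pM2l// ler_wpM2l.
    nra.
  rewrite -/m in Ft1; rewrite /F in Ft1 lo; rewrite /q in Ft1 lo *.
  by rewrite ltr_norml => ?; apply/andP; split; lra.
have sm : Num.sqrt m ^+ 2 = m by rewrite sqr_sqrtr.
have qs e : 0 < e -> exists2 u, 0 < u & forall t, 0 < t -> t < u -> `|q t - Num.sqrt m| < e.
  move=> e0; have e2 : 0 < e ^+ 2 by rewrite exprn_gt0.
  have [u u0 H] := qm (e ^+ 2) e2; exists u => // t t0 tu.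
  have := H t t0 tu; have := q0 t t0; have := sqrtr_ge0 m; rewrite -{2}sm.
  set a := q t; set b := Num.sqrt m => b0 a0.
  by rewrite !ltr_norml => /andP[h1 h2]; apply/andP; split; nra.
have cq : q @ 0^'+ --> Num.sqrt m by apply/cvg_right0P.
have gE : gdist d g h = Num.sqrt m by apply: cvg_lim.
rewrite gE; split => //.
move=> T' L1' L2' L' t gG' hG' l1 l2 t0 tT' Lt'.
rewrite sm; apply: le_of_eps => e e0.
have [u u0 H] := qm e e0.
pose s := Num.min (u / 2) t.
have s0 : 0 < s by rewrite lt_min t0 andbT; lra.
have st : s <= t by rewrite ge_min lexx orbT.
have su : s < u by have : s <= u / 2 by [rewrite ge_min lexx]; lra.
have := H s s0 su; rewrite ltr_norml => /andP[h1 h2].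
have := quotient_contract _ _ _ _ _ _ s t gG' hG' l1 l2 tT' Lt' s0 st.
by move: h1; rewrite /q; lra.
Qed.

Lemma gdist_ge0 g h : germ d y g -> germ d y h -> 0 <= gdist d g h.
Proof. by move=> gG hG; have [] := gdist_limit _ _ gG hG. Qed.

Lemma gdist_eps g h : germ d y g -> germ d y h -> forall e, 0 < e ->
  exists2 u, 0 < u & forall t, 0 < t -> t < u -> `|d (g t) (h t) / t - gdist d g h| < e.
Proof. by move=> gG hG; have [] := gdist_limit _ _ gG hG. Qed.

Lemma gdist_unique g h l : (forall e, 0 < e -> exists2 u, 0 < u &
  forall t, 0 < t -> t < u -> `|d (g t) (h t) / t - l| < e) -> gdist d g h = l.
Proof. by move=> H; apply: cvg_lim => //; apply/cvg_right0P. Qed.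

Lemma gdistxx g : gdist d g g = 0.
Proof.
by apply: gdist_unique => e e0; exists 1 => // t _ _; rewrite (distxx dM) mul0r subrr normr0.
Qed.

Lemma gdist_sym g h : gdist d g h = gdist d h g.
Proof.
rewrite /gdist (_ : (fun t => d (g t) (h t) / t) = (fun t => d (h t) (g t) / t))//.
by apply/funext => t; rewrite (dist_sym dM).
Qed.

Lemma gdist_tri h g k : germ d y g -> germ d y h -> germ d y k ->
  gdist d g k <= gdist d g h + gdist d h k.
Proof.
move=> gG hG kG; apply: le_of_eps => e e0.
have e3 : 0 < e / 3 by lra.
have [u1 u10 H1] := gdist_eps _ _ gG kG _ e3.
have [u2 u20 H2] := gdist_eps _ _ gG hG _ e3.
have [u3 u30 H3] := gdist_eps _ _ hG kG _ e3.
pose t := Num.min u1 (Num.min u2 u3) / 2.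
have m0 : 0 < Num.min u1 (Num.min u2 u3) by rewrite !lt_min u10 u20.
have t0 : 0 < t by rewrite /t; lra.
have [t1 t2 t3] : [/\ t < u1, t < u2 & t < u3].
  have h1 : Num.min u1 (Num.min u2 u3) <= u1 by rewrite ge_min lexx.
  have h2 : Num.min u1 (Num.min u2 u3) <= u2 by rewrite !ge_min lexx orbT.
  have h3 : Num.min u1 (Num.min u2 u3) <= u3 by rewrite !ge_min lexx !orbT.
  by rewrite /t; split; lra.
have := H1 t t0 t1; have := H2 t t0 t2; have := H3 t t0 t3.
have T : d (g t) (k t) / t <= d (g t) (h t) / t + d (h t) (k t) / t.
  by rewrite -mulrDl ler_pM2r ?invr_gt0//; exact: dist_tri.
by rewrite !ltr_norml => /andP[? ?] /andP[? ?] /andP[? ?]; lra.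
Qed.

Lemma germ_cst : germ d y (fun _ => y).
Proof.
by split=> //; exists 1, 0; do 2!split => //; move=> s t _ _; rewrite (distxx dM) mul0r.
Qed.

Lemma gdist_norm g T L : germ_on d y T L g -> gdist d g (fun _ => y) = L.
Proof.
move=> gG; have [_ T0 _ _] := gG; apply: gdist_unique => e e0; exists T => // t t0 tT.
rewrite (dist_sym dM) (germ_on_dist _ _ _ _ gG (ltW t0) (ltW tT)).
by rewrite mulfK ?gt_eqF// subrr normr0.
Qed.

Lemma of_germ_tcone g : germ d y g -> in_tcone d y (of_germ g).
Proof.
by move=> gG; split => // e e0; exists 0%N => m n _ _; rewrite gdistxx.
Qed.

Lemma tzero_tcone : in_tcone d y (tzero y).
Proof. exact: of_germ_tcone germ_cst. Qed.

Lemma gdist_lip g h g' h' : germ d y g -> germ d y h -> germ d y g' -> germ d y h' ->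
  `|gdist d g h - gdist d g' h'| <= gdist d g g' + gdist d h h'.
Proof.
move=> gG hG gG' hG'.
have := gdist_tri g' g h gG gG' hG; have := gdist_tri h' g' h gG' hG' hG.
have := gdist_tri g g' h' gG' gG hG'; have := gdist_tri h g h' gG hG hG'.
by rewrite (gdist_sym g' g) (gdist_sym h' h) ler_norml; lra.
Qed.

Lemma tdist_eps V W : in_tcone d y V -> in_tcone d y W -> forall e, 0 < e ->
  exists N : nat, forall n, (N <= n)%N -> `|gdist d (V n) (W n) - tdist d V W| < e.
Proof.
move=> [VG VC] [WG WC]; apply: cauchy_cvgn => e e0.
have e2 : 0 < e / 2 by lra.
have [N1 H1] := VC _ e2; have [N2 H2] := WC _ e2.
exists (maxn N1 N2) => m n; rewrite !geq_max => /andP[m1 m2] /andP[n1 n2].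
have := gdist_lip _ _ _ _ (VG m) (WG m) (VG n) (WG n).
have := H1 _ _ m1 n1; have := H2 _ _ m2 n2; lra.
Qed.

Lemma tdist_unique V W l : (forall e, 0 < e -> exists N : nat, forall n, (N <= n)%N ->
  `|gdist d (V n) (W n) - l| < e) -> tdist d V W = l.
Proof. by move=> H; apply: cvg_lim => //; exact: cvgn_eps. Qed.

Lemma tdist_germ g h : tdist d (of_germ g) (of_germ h) = gdist d g h.
Proof. by apply: tdist_unique => e e0; exists 0%N => n _; rewrite subrr normr0. Qed.

Lemma tnorm_germ g T L : germ_on d y T L g -> tnorm d y (of_germ g) = L.
Proof. by move=> gG; rewrite /tnorm tdist_germ (gdist_norm _ _ _ gG). Qed.

Lemma tdist_tri W V Z : in_tcone d y V -> in_tcone d y W -> in_tcone d y Z ->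
  tdist d V Z <= tdist d V W + tdist d W Z.
Proof.
move=> VC WC ZC; apply: le_of_eps => e e0.
have e3 : 0 < e / 3 by lra.
have [N1 H1] := tdist_eps _ _ VC ZC _ e3.
have [N2 H2] := tdist_eps _ _ VC WC _ e3.
have [N3 H3] := tdist_eps _ _ WC ZC _ e3.
pose n := maxn N1 (maxn N2 N3).
have n1 : (N1 <= n)%N by rewrite leq_maxl.
have n2 : (N2 <= n)%N by rewrite /n leq_max leq_maxl orbT.
have n3 : (N3 <= n)%N by rewrite /n leq_max leq_maxr orbT.
have := H1 n n1; have := H2 n n2; have := H3 n n3.
have := gdist_tri (W n) (V n) (Z n) (VC.1 n) (WC.1 n) (ZC.1 n).
by rewrite !ltr_norml => ? /andP[? ?] /andP[? ?] /andP[? ?]; lra.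
Qed.

Lemma tdist_sym V W : tdist d V W = tdist d W V.
Proof.
rewrite /tdist (_ : (fun n => gdist d (V n) (W n)) = (fun n => gdist d (W n) (V n)))//.
by apply/funext => n; exact: gdist_sym.
Qed.

Lemma tdist_ge0 V W : in_tcone d y V -> in_tcone d y W -> 0 <= tdist d V W.
Proof.
move=> VC WC; apply: le_of_eps => e e0.
have [N /(_ N (leqnn N))] := tdist_eps _ _ VC WC _ e0.
have := gdist_ge0 _ _ (VC.1 N) (WC.1 N).
by rewrite ltr_norml => ? /andP[? ?]; lra.
Qed.

(** Cauchy-Schwarz is the triangle inequality in disguise: for norms [a], [b] and distance [D], the
    inequality [|a - b| <= D] squares to [(a ^+ 2 + b ^+ 2 - D ^+ 2) / 2 <= a * b]. *)
Lemma tinner_le V W : in_tcone d y V -> in_tcone d y W ->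
  tinner d y V W <= tnorm d y V * tnorm d y W.
Proof.
move=> VC WC; rewrite /tinner /tnorm.
have zC := tzero_tcone.
have := tdist_tri W V _ VC WC zC; have := tdist_tri V W _ WC VC zC.
have := tdist_ge0 V W VC WC; rewrite (tdist_sym W V).
set a := tdist d V (tzero y); set b := tdist d W (tzero y); set D := tdist d V W; nra.
Qed.

End Tangent.

(** * The descending slope as a one-sided Lipschitz bound *)

Section Slope.
Context {R : realType} {Y : Type} {d : Y -> Y -> R} {E : Y -> \bar R} {y : Y} {ey : R}.
Hypotheses (dM : is_metric d) (Eb : forall z, (-oo < E z)%E) (Ey : E y = ey%:E).

Lemma energy_real z b : (E z <= b%:E)%E -> exists2 b', E z = b'%:E & b' <= b.
Proof.
move=> zb; case e: (E z) => [b'| |].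
- by exists b' => //; rewrite -lee_fin -e.
- by move: zb; rewrite e leNgt ltry.
- by have := Eb z; rewrite e ltxx.
Qed.

Lemma slope_ge0 : (0 <= slope d E y)%E.
Proof.
apply: le_ereal_inf_tmp => _ [r r0 <-]; apply: ereal_sup_ubound; by right.
Qed.

Lemma slope_finite : (slope d E y < +oo)%E -> exists2 S, 0 <= S & slope d E y = S%:E.
Proof.
move=> H; have := slope_ge0; move: H; case: (slope d E y) => // S _; rewrite lee_fin => S0.
by exists S.
Qed.

Lemma slope_lower_bound S : slope d E y = S%:E -> forall e, 0 < e ->
  exists2 r, 0 < r & forall z, d y z < r -> ((ey - (S + e) * d y z)%:E <= E z)%E.
Proof.
move=> SE e e0.
have : (slope d E y < (S + e)%:E)%E by rewrite SE lte_fin; lra.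
move=> /ereal_inf_lt[_ [r r0 <-] H]; exists r => // z zr.
have [z0|z0] := eqVneq (d y z) 0.
  by rewrite z0 mulr0 subr0 -(dist_eq0 dM _ _ z0) Ey.
have zp : 0 < d y z by rewrite lt_def z0 dist_ge0.
case ez : (E z) => [b| |]; [|by rewrite leey|by have := Eb z; rewrite ez ltxx].
rewrite lee_fin.
have : (maxe (E y - E z) 0 * ((d y z)^-1)%:E < (S + e)%:E)%E.
  apply: le_lt_trans H; apply: ereal_sup_ubound; left; exists z => //=.
  by rewrite zp.
rewrite Ey ez -EFinB -EFin_max -EFinM lte_fin ltr_pdivrMr//.
have : ey - b <= Num.max (ey - b) 0 by rewrite le_max lexx.
lra.
Qed.

Lemma slope_upper_bound C r : 0 < r -> 0 <= C ->
  (forall z, d y z < r -> ((ey - C * d y z)%:E <= E z)%E) -> (slope d E y <= C%:E)%E.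
Proof.
move=> r0 C0 H; apply: (@le_trans _ _ (ereal_sup
      ([set (maxe (E y - E z) 0 * ((d y z)^-1)%:E)%E | z in [set z | 0 < d y z < r]]
         `|` [set 0%E]))).
  by apply: ereal_inf_lbound; exists r.
apply: ge_ereal_sup => _ [[z /= /andP[z0 zr] <-]|->]; last by rewrite lee_fin.
have := H z zr; case ez : (E z) => [b| |].
- rewrite lee_fin => Hz.
  rewrite Ey -EFinB -EFin_max -EFinM lee_fin ler_pdivrMr// ge_max; apply/andP; split; first by lra.
  by rewrite mulr_ge0// ltW.
- by rewrite Ey /= max_r ?mul0e ?lee_fin// leNye.
- by have := Eb z; rewrite ez ltxx.
Qed.

Lemma slope_witness S e r : slope d E y = S%:E -> 0 < e -> e <= S -> 0 < r ->
  exists z, [/\ 0 < d y z, d y z < r & (E z <= (ey - (S - e) * d y z)%:E)%E].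
Proof.
move=> SE e0 eS r0.
have : ((S - e)%:E < ereal_sup
      ([set (maxe (E y - E z) 0 * ((d y z)^-1)%:E)%E | z in [set z | (0 < d y z < r)%R]]
         `|` [set 0%E]))%E.
  apply: (@lt_le_trans _ _ (slope d E y)); first by rewrite SE lte_fin; lra.
  by apply: ereal_inf_lbound; exists r.
(* The value [0] adjoined in [slope] cannot exceed [S - e], because [e <= S]. *)
move=> /ereal_sup_gt[_ [[z /= /andP[z0 zr] <-]|->]]; last by rewrite lte_fin; lra.
case ez : (E z) => [b| |].
- rewrite Ey -EFinB -EFin_max -EFinM lte_fin ltr_pdivlMr// => H.
  exists z; split => //; rewrite ez lee_fin.
  move: H; rewrite lt_max => /orP[|]; first by lra.
  have : 0 <= (S - e) * d y z by apply: mulr_ge0; [lra|exact: ltW].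
  lra.
- rewrite Ey /= max_r ?mul0e ?lte_fin ?leNye//; lra.
- by have := Eb z; rewrite ez ltxx.
Qed.

End Slope.

(** [main] is multiplied by [2 * t], its product [S * dp] is split by the arithmetic-geometric mean
    inequality, then [dp2] and [gdle2] are inserted; dividing by [t ^+ 2] leaves an error of order
    [t]. *)
Lemma germ_slope_estimate {R : realType} (t e L1 L2 L a1 a2 C S K G lam ey dp D gd : R) :
  0 < t -> t <= 1 -> 0 <= e -> e <= 1 -> 0 <= K -> 0 <= G -> 0 <= D -> D <= L * t ->
  ey - S * dp <= (1 - e) * (ey - a1 * t + C * t ^+ 2) + e * (ey - a2 * t + C * t ^+ 2)
    - lam / 2 * e * (1 - e) * D ^+ 2 ->
  dp ^+ 2 <= (1 - e) * (L1 * t) ^+ 2 + e * (L2 * t) ^+ 2 - e * (1 - e) * D ^+ 2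
    + K * (2 * L * t) ^+ 4 ->
  t ^+ 2 * gd ^+ 2 <= D ^+ 2 + G * t ^+ 4 ->
  2 * ((1 - e) * a1 + e * a2) <= S ^+ 2 + ((1 - e) * L1 ^+ 2 + e * L2 ^+ 2
    - e * (1 - e) * gd ^+ 2) + (2 * C + 4 * `|lam| * L ^+ 2 + (G + 16 * K * L ^+ 4)) * t.
Proof.
move=> t0 t1 e0 e1 K0 G0 D0 DL main dp2 gdle2.
have tt : 0 < t ^+ 2 by rewrite exprn_gt0.
have l0 := normr_ge0 lam.
have ee : 0 <= e * (1 - e) by apply: mulr_ge0 => //; rewrite subr_ge0.
have ee1 : e * (1 - e) <= 1 by clear - e0 e1; nra.
set A := (1 - e) * a1 + e * a2.
have lD : - lam * (e * (1 - e) * D ^+ 2) <= `|lam| * (L * t) ^+ 2.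
  have u0 : 0 <= e * (1 - e) * D ^+ 2 by rewrite mulr_ge0// sqr_ge0.
  have u1 : e * (1 - e) * D ^+ 2 <= (L * t) ^+ 2.
    rewrite -[leRHS]mul1r; apply: ler_pM => //; first exact: sqr_ge0.
    by apply: sqr_le_mono; rewrite ger0_norm.
  have nl : - lam <= `|lam| by rewrite -normrN ler_norm.
  by clear - u0 u1 nl l0; nra.
have amgm : 2 * t * (S * dp) <= t ^+ 2 * S ^+ 2 + dp ^+ 2.
  by have := sqr_ge0 (t * S - dp); clear; lra.
have m2 : 2 * t * (t * A) <= 2 * t * (S * dp + C * t ^+ 2 + `|lam| / 2 * (L * t) ^+ 2).
  by rewrite ler_pM2l ?mulr_gt0// /A; clear - main lD; lra.
have t4 : t ^+ 4 <= t ^+ 3 by rewrite exprS ler_piMl// exprn_ge0// ltW.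
have gde : e * (1 - e) * (t ^+ 2 * gd ^+ 2) <= e * (1 - e) * D ^+ 2 + G * t ^+ 4.
  have h1 : e * (1 - e) * (t ^+ 2 * gd ^+ 2) <= e * (1 - e) * (D ^+ 2 + G * t ^+ 4) by rewrite ler_wpM2l.
  have h2 : 0 <= G * t ^+ 4 by rewrite mulr_ge0// exprn_even_ge0.
  have h3 : e * (1 - e) * (G * t ^+ 4) <= G * t ^+ 4 by rewrite ler_piMl.
  by clear - h1 h3; lra.
rewrite -(ler_pM2l tt).
have q1 : (G + 16 * K * L ^+ 4) * t ^+ 4 <= (G + 16 * K * L ^+ 4) * t ^+ 3.
  by rewrite ler_wpM2l// addr_ge0// mulr_ge0 ?exprn_even_ge0// mulr_ge0.
have q2 : 0 <= `|lam| * L ^+ 2 * t ^+ 3.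
  by rewrite mulr_ge0 ?exprn_ge0 ?(ltW t0)// mulr_ge0// sqr_ge0.
move: m2 amgm dp2 gde q1 q2.
have -> : K * (2 * L * t) ^+ 4 = 16 * K * L ^+ 4 * t ^+ 4 by ring.
have -> : 2 * t * (t * A) = t ^+ 2 * (2 * A) by ring.
have -> : 2 * t * (S * dp + C * t ^+ 2 + `|lam| / 2 * (L * t) ^+ 2)
  = 2 * t * (S * dp) + 2 * C * t ^+ 3 + `|lam| * L ^+ 2 * t ^+ 3 by field.
by rewrite !exprMn; clear; lra.
Qed.

(** * Steepest descent directions and the minus-subdifferential *)

Section Subdifferential.
Context {R : realType} {Y : Type} {d : Y -> Y -> R} {lam : R} {E : Y -> \bar R}.
Context {y : Y} {ey r K : R}.
Hypotheses (dM : is_metric d) (geo : geodesic_space d) (Eb : forall z, (-oo < E z)%E).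
Hypotheses (Ecvx : lconvex d lam E) (Ey : E y = ey%:E).
Hypotheses (r0 : 0 < r) (K0 : 0 <= K) (LQ : local_quadratic d y r K).

Lemma convex_real g x z (b1 b2 t : R) : cs_geodesic d g x z -> 0 <= t -> t <= 1 ->
  (E x <= b1%:E)%E -> (E z <= b2%:E)%E ->
  (E (g t) <= ((1 - t) * b1 + t * b2 - lam / 2 * t * (1 - t) * d x z ^+ 2)%:E)%E.
Proof.
move=> gG t0 t1 /(energy_real Eb)[c1 e1 c1b] /(energy_real Eb)[c2 e2 c2b].
have tI : 0 <= t <= 1 by rewrite t0.
have := Ecvx _ _ _ _ gG tI.
rewrite e1 e2 => H; apply: le_trans H _; rewrite lee_fin; nra.
Qed.

Lemma geodesic_germ g z : cs_geodesic d g y z -> germ_on d y 1 (d y z) g.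
Proof.
move=> [g0 [g1 gd]]; split => //; first exact: dist_ge0.
by move=> s t sI tI; rewrite gd// mulrC.
Qed.

(** The linear coefficient is the quantity that membership in the minus-subdifferential bounds by an
    inner product. The rest of the convexity term is quadratic in [t], as [germ_slope_inequality]
    requires. *)
Lemma geodesic_energy g z b : cs_geodesic d g y z -> E z = b%:E -> forall t, 0 <= t -> t <= 1 ->
  (E (g t) <= (ey - (ey - b + lam / 2 * d y z ^+ 2) * t + `|lam| / 2 * d y z ^+ 2 * t ^+ 2)%:E)%E.
Proof.
move=> gG zE t t0 t1.
have := @convex_real g y z ey b t gG t0 t1; rewrite Ey zE !lexx => /(_ isT isT) H.
apply: le_trans H _; rewrite lee_fin.
have : lam * (d y z * t) ^+ 2 <= `|lam| * (d y z * t) ^+ 2.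
  by rewrite ler_wpM2r ?sqr_ge0// ler_norm.
by rewrite exprMn; lra.
Qed.

(* Compare the energy at fraction [e] of the geodesic from [g t] to [h t] with the
   slope bound, using [(S + e) D <= t (S + e)^2 / 2 + D^2 / (2 t)], and let [t] tend to 0. *)
Lemma germ_slope_inequality g h T L1 L2 a1 a2 C S e :
  germ_on d y T L1 g -> germ_on d y T L2 h -> 0 <= C -> 0 <= S ->
  (forall t, 0 <= t -> t <= T -> (E (g t) <= (ey - a1 * t + C * t ^+ 2)%:E)%E) ->
  (forall t, 0 <= t -> t <= T -> (E (h t) <= (ey - a2 * t + C * t ^+ 2)%:E)%E) ->
  slope d E y = S%:E -> 0 <= e -> e <= 1 ->
  (1 - e) * a1 + e * a2 <=
    S ^+ 2 / 2 + ((1 - e) * L1 ^+ 2 + e * L2 ^+ 2 - e * (1 - e) * gdist d g h ^+ 2) / 2.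
Proof.
move=> gG hG C0 S0 Eg Eh SE e0 e1; apply: le_of_eps => eta eta0.
have [_ T0 L10 _] := gG; have [_ _ L20 _] := hG.
pose L := L1 + L2.
have L1L : L1 <= L by rewrite /L; lra.
have L2L : L2 <= L by rewrite /L; lra.
have L0 : 0 <= L by lra.
pose G := @germ_const _ K L.
have G0 : 0 <= G by exact: germ_const_ge0.
pose eps := Num.min 1 (eta / (2 * S + 1)).
have S1 : 0 < 2 * S + 1 by lra.
have eps0 : 0 < eps by rewrite lt_min ltr01 divr_gt0.
have eps1 : eps <= 1 by rewrite ge_min lexx.
have epsS : eps * (2 * S + 1) <= eta.
  by rewrite -ler_pdivlMr// /eps ge_min lexx orbT.
have SS : (S + eps) ^+ 2 <= S ^+ 2 + eta by nra.
have [del del0 low] := slope_lower_bound dM Eb Ey _ SE _ eps0.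
pose B := 2 * C + 4 * `|lam| * L ^+ 2 + (G + 16 * K * L ^+ 4).
have l0 := normr_ge0 lam.
have B2 : 0 <= 4 * `|lam| * L ^+ 2 by rewrite mulr_ge0 ?sqr_ge0// mulr_ge0.
have B3 : 0 <= 16 * K * L ^+ 4 by rewrite mulr_ge0 ?exprn_even_ge0// mulr_ge0.
have B0 : 0 <= B by rewrite /B; lra.
pose t := Num.min (Num.min T 1) (Num.min (Num.min (r / (2 * (L + 1))) (del / (3 * L + 1))) (eta / (B + 1))).
have L3 : 0 < 3 * L + 1 by lra.
have L4 : 0 < 2 * (L + 1) by lra.
have B1 : 0 < B + 1 by lra.
have t0 : 0 < t by rewrite !lt_min T0 ltr01 !divr_gt0.
have tT : t <= T by rewrite !ge_min lexx.
have t1 : t <= 1 by rewrite !ge_min lexx !orbT.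
have tr : t * (2 * (L + 1)) <= r by rewrite -ler_pdivlMr// !ge_min lexx !orbT.
have td : t * (3 * L + 1) <= del by rewrite -ler_pdivlMr// !ge_min lexx !orbT.
have tB : t * (B + 1) <= eta by rewrite -ler_pdivlMr// !ge_min lexx !orbT.
have Lt0 : 0 <= L * t by nra.
have Lt : L * t < r by nra.
have dg := germ_on_dist _ _ _ _ gG (ltW t0) tT.
have dh := germ_on_dist _ _ _ _ hG (ltW t0) tT.
have gr : d y (g t) < r by rewrite dg; nra.
have hr : d y (h t) < r by rewrite dh; nra.
have [gam gamG] := geo (g t) (h t).
set D := d (g t) (h t).
have D0 : 0 <= D by exact: dist_ge0.
have DL : D <= L * t.
  by have := dist_tri dM y (g t) (h t); rewrite (dist_sym dM (g t) y) dg dh -/D /L; lra.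
pose p := gam e; pose dp := d y p.
have dp0 : 0 <= dp by exact: dist_ge0.
have dpL : dp < del.
  have := dist_tri dM (g t) y p; rewrite (geodesic_dist0 _ _ _ _ gamG)// -/dp dg -/D.
  by have : e * D <= D by [nra]; nra.
have yy : d y y < r by rewrite (distxx dM).
have dp2 : dp ^+ 2 <= (1 - e) * (L1 * t) ^+ 2 + e * (L2 * t) ^+ 2 - e * (1 - e) * D ^+ 2
    + K * (2 * L * t) ^+ 4.
  have := LQ y (g t) (h t) gam (2 * L * t) e yy gr hr gamG.
  have b1 : L1 * t <= 2 * L * t by rewrite ler_pM2r//; lra.
  have b2 : L2 * t <= 2 * L * t by rewrite ler_pM2r//; lra.
  have b3 : D <= 2 * L * t by lra.
  by rewrite dg dh => /(_ b1 b2 b3 e0 e1).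
have hg : germ d y g by apply/germP; exists T, L1.
have hh : germ d y h by apply/germP; exists T, L2.
have [_ _ /(_ T L1 L2 L t gG hG L1L L2L t0 tT Lt)] := gdist_limit dM r0 K0 LQ g h hg hh.
rewrite -/D -/G expr_div_n; set gd := gdist d g h => gdle.
have tt : 0 < t ^+ 2 by rewrite exprn_gt0.
have gdle2 : t ^+ 2 * gd ^+ 2 <= D ^+ 2 + G * t ^+ 4.
  have : t ^+ 2 * gd ^+ 2 <= t ^+ 2 * (D ^+ 2 / t ^+ 2 + G * t ^+ 2) by rewrite ler_pM2l.
  have -> // : t ^+ 2 * (D ^+ 2 / t ^+ 2 + G * t ^+ 2) = D ^+ 2 + G * t ^+ 4.
  by field; rewrite gt_eqF.
have := convex_real _ _ _ _ _ _ gamG e0 e1 (Eg t (ltW t0) tT) (Eh t (ltW t0) tT).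
move=> /(le_trans (low _ dpL)); rewrite -/dp -/D lee_fin => main.
have := germ_slope_estimate _ _ _ _ _ _ _ _ _ _ _ _ _ _ _ _ t0 t1 e0 e1 K0 G0 D0 DL main dp2 gdle2.
by rewrite -/B; lra.
Qed.

(** A geodesic to an almost optimal point for the slope, run at speed [S], has decay rate about
    [S * (S - e)], as along a gradient. Half of [eta] pays for [e], the other half for the convexity
    term, small because the point is close. For [S = 0] no such point need exist, and the constant
    germ serves. *)
Lemma descent_germ S eta : slope d E y = S%:E -> 0 <= S -> 0 < eta ->
  exists v T, germ_on d y T S v /\
    forall t, 0 <= t -> t <= T -> (E (v t) <= (ey - (S ^+ 2 - eta) * t)%:E)%E.
Proof.
move=> SE S0 eta0; have [S_0|Sn0] := eqVneq S 0.
  exists (fun _ => y), 1; rewrite S_0; split.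
    by split => // s t _ _; rewrite (distxx dM) mul0r.
  by move=> t t0 _; rewrite Ey lee_fin; nra.
have Sp : 0 < S by rewrite lt_def Sn0.
pose e := Num.min S (eta / (2 * S)).
have S2 : 0 < 2 * S by lra.
have e0 : 0 < e by rewrite lt_min Sp divr_gt0.
have eS : e <= S by rewrite ge_min lexx.
have eeta : e * (2 * S) <= eta by rewrite -ler_pdivlMr// ge_min lexx orbT.
have l0 := normr_ge0 lam.
have dn : 0 < `|lam| * S + 1 by nra.
have rr : 0 < eta / (`|lam| * S + 1) by rewrite divr_gt0.
have [z [z0 zr Ez]] := slope_witness Eb Ey _ _ _ SE e0 eS rr.
have [g gG] := geo y z.
set D := d y z in z0 zr Ez *.
have DS : 0 < S / D by rewrite divr_gt0.
exists (fun t => g (t * (S / D))), (D / S).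
have I s : 0 <= s <= D / S -> 0 <= s * (S / D) <= 1.
  move=> /andP[s0 s1]; apply/andP; split; first by rewrite mulr_ge0// ltW.
  by rewrite mulrA ler_pdivrMr// mul1r -ler_pdivlMr.
split.
  split => //; first by rewrite mul0r; case: gG.
    by rewrite divr_gt0.
  move=> s t sI tI; case: gG => _ [_ ->]; rewrite ?I//.
  rewrite -mulrBl normrM (gtr0_norm DS) -/D; field; by rewrite gt_eqF.
move=> t t0 tT; set u := t * (S / D).
have /andP[u0 u1] : 0 <= u <= 1 by apply: I; rewrite t0.
have Eyy : (E y <= ey%:E)%E by rewrite Ey.
have := convex_real _ _ _ _ _ _ gG u0 u1 Eyy Ez; move=> /le_trans; apply.
rewrite lee_fin -/D.
have uD : u * D = t * S by rewrite /u; field; rewrite gt_eqF.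
have tS : 0 <= t * S by rewrite mulr_ge0.
have h1 : - lam * (u * (1 - u) * D ^+ 2) <= `|lam| * (t * S * D).
  have -> : t * S * D = u * D ^+ 2 by rewrite -uD; ring.
  have D2 : 0 < D ^+ 2 by rewrite exprn_gt0.
  have uu0 : 0 <= u * (1 - u) * D ^+ 2 by rewrite mulr_ge0 ?(ltW D2)//; nra.
  have uu1 : u * (1 - u) * D ^+ 2 <= u * D ^+ 2 by rewrite ler_pM2r//; nra.
  have : - lam <= `|lam| by rewrite -normrN ler_norm.
  nra.
move: zr; rewrite ltr_pdivlMr// => zr.
have h2 : `|lam| * (t * S * D) <= t * eta.
  have : `|lam| * S * D <= eta by nra.
  move=> /(ler_wpM2l t0); lra.
have h3 : t * (e * (2 * S)) <= t * eta by rewrite ler_wpM2l.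
have h4 : u * (ey - (S - e) * D) = u * ey - (S - e) * (t * S) by rewrite -uD; ring.
by rewrite h4; lra.
Qed.

(** Elements of the tangent cone are Cauchy sequences of germs, so a sequence of almost steepest
    germs with vanishing loss is itself the candidate for the gradient; no limit has to be
    constructed. *)
Definition descent_seq (S : R) (V : nat -> R -> Y) := forall n, exists T,
  germ_on d y T S (V n) /\
  forall t, 0 <= t -> t <= T -> (E (V n t) <= (ey - (S ^+ 2 - n.+1%:R^-1) * t)%:E)%E.

Lemma descent_seq_exists S : slope d E y = S%:E -> 0 <= S -> exists V, descent_seq S V.
Proof.
move=> SE S0; suff : forall n, exists v, exists T, germ_on d y T S v /\
  forall t, 0 <= t -> t <= T -> (E (v t) <= (ey - (S ^+ 2 - n.+1%:R^-1) * t)%:E)%E.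
  by move=> /choice[V HV]; exists V.
by move=> n; apply: descent_germ => //; rewrite invr_gt0 ltr0Sn.
Qed.

Lemma invn_small (e : R) : 0 < e -> exists N : nat, forall n, (N <= n)%N -> n.+1%:R^-1 < e.
Proof.
move=> e0; exists (Num.bound e^-1) => n Nn.
rewrite -[ltRHS]invrK ltf_pV2 ?posrE ?invr_gt0 ?ltr0Sn//.
have := @archi_boundP _ e^-1; rewrite invr_ge0 ltW// => /(_ isT) H.
apply: lt_trans H _; rewrite ltr_nat ltnS//.
Qed.

(** Two almost steepest germs of speed [S] nearly saturate [germ_slope_inequality]. At weight one
    half, the average of their losses bounds one eighth of the squared distance between them, whence
    the threshold [e ^+ 2 / 8]. *)
Lemma descent_tcone S V : slope d E y = S%:E -> 0 <= S -> descent_seq S V ->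
  in_tcone d y V /\ tnorm d y V = S.
Proof.
move=> SE S0 HV.
have Vg n : germ d y (V n) by have [T [gG _]] := HV n; apply/germP; exists T, S.
split; last first.
  apply: tdist_unique => e e0; exists 0%N => n _; have [T [gG _]] := HV n.
  by rewrite (gdist_norm dM _ _ _ gG) subrr normr0.
split => // e e0.
have e2 : 0 < e ^+ 2 / 8 by rewrite divr_gt0 ?exprn_gt0.
have [N HN] := invn_small _ e2; exists N => m n Nm Nn.
have [T1 [g1 E1]] := HV m; have [T2 [g2 E2]] := HV n.
have [_ T10 _ _] := g1; have [_ T20 _ _] := g2.
pose T := Num.min T1 T2.
have T0 : 0 < T by rewrite lt_min T10.
have TT1 : T <= T1 by rewrite ge_min lexx.
have TT2 : T <= T2 by rewrite ge_min lexx orbT.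
have g1' := germ_onW _ _ _ _ g1 T0 TT1; have g2' := germ_onW _ _ _ _ g2 T0 TT2.
have F1 t : 0 <= t -> t <= T -> (E (V m t) <= (ey - (S ^+ 2 - m.+1%:R^-1) * t + 0 * t ^+ 2)%:E)%E.
  by move=> t0 tT; rewrite mul0r addr0; apply: E1 => //; lra.
have F2 t : 0 <= t -> t <= T -> (E (V n t) <= (ey - (S ^+ 2 - n.+1%:R^-1) * t + 0 * t ^+ 2)%:E)%E.
  by move=> t0 tT; rewrite mul0r addr0; apply: E2 => //; lra.
have h0 : 0 <= 2^-1 :> R by lra.
have h1 : 2^-1 <= 1 :> R by lra.
have := germ_slope_inequality _ _ _ _ _ _ _ _ _ _ g1' g2' (lexx 0) S0 F1 F2 SE h0 h1.
have := HN _ Nm; have := HN _ Nn; have := gdist_ge0 dM r0 K0 LQ _ _ (Vg m) (Vg n).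
move: (m.+1%:R^-1) (n.+1%:R^-1) (gdist d (V m) (V n)) => a b D D0 ae be H.
by have : D ^+ 2 < e ^+ 2 by [lra]; nra.
Qed.

(** Cauchy-Schwarz turns the subdifferential inequality into a linear lower bound for [E] with
    constant [tnorm d y W]; the term in [lam] is absorbed by [e] on a small ball. *)
Lemma msubdiff_slope W : msubdiff d lam E y W -> (slope d E y <= (tnorm d y W)%:E)%E.
Proof.
move=> [_ [WC H]]; apply/lee_addgt0Pr => e e0; rewrite -EFinD.
have l0 := normr_ge0 lam.
have dn : 0 < `|lam| + 1 by lra.
have W0 : 0 <= tnorm d y W by exact: (tdist_ge0 dM r0 K0 LQ _ _ WC (tzero_tcone dM)).
apply: (slope_upper_bound Eb Ey _ (e / (`|lam| + 1))).
- by rewrite divr_gt0.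
- by lra.
move=> z; rewrite ltr_pdivlMr// => zr.
have [g [gG]] := H z.
have gg := geodesic_germ _ _ gG.
have gger : germ d y g by apply/germP; exists 1, (d y z).
have := tinner_le dM r0 K0 LQ W (of_germ g) WC (of_germ_tcone dM _ gger).
rewrite (tnorm_germ dM _ _ _ gg) Ey; set I := tinner _ _ _ _; set w := tnorm d y W in W0 *.
have D0 := dist_ge0 dM y z; set D := d y z in zr D0 *.
move=> CS; case ez : (E z) => [b| |]; [|by rewrite !leey|by have := Eb z; rewrite ez ltxx].
rewrite -EFinB -EFinD !lee_fin => Hz.
have : - lam * D ^+ 2 <= e * D.
  have : - lam <= `|lam| by rewrite -normrN ler_norm.
  have := sqr_ge0 D; nra.
nra.
Qed.

(** First-order optimality: [germ_slope_inequality] is applied to [V n] and the geodesic to [z],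
    with a small weight [e] on the latter. The terms of order zero in [e] cancel up to the loss of
    [V n], and those of order one form the required inequality. *)
Lemma descent_msubdiff S V : slope d E y = S%:E -> 0 <= S -> descent_seq S V ->
  msubdiff d lam E y V.
Proof.
move=> SE S0 HV; have [VC VN] := descent_tcone _ _ SE S0 HV.
split; first by rewrite /domE Ey ltry.
split=> // z; have [g gG] := geo y z; exists g; split => //.
case ez : (E z) => [b| |]; [|by rewrite leey|by have := Eb z; rewrite ez ltxx].
have gg := geodesic_germ _ _ gG.
have gger : germ d y g by apply/germP; exists 1, (d y z).
have gC := of_germ_tcone dM _ gger.
rewrite /tinner VN (tnorm_germ dM _ _ _ gg) Ey -EFinB -EFinD lee_fin.
set D := d y z; set GD := tdist d V (of_germ g).
have GD0 : 0 <= GD by exact: (tdist_ge0 dM r0 K0 LQ).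
pose a2 := ey - b + lam / 2 * D ^+ 2.
suff : a2 <= (S ^+ 2 + D ^+ 2 - GD ^+ 2) / 2 by rewrite /a2; lra.
have main e n : 0 < e -> e <= 1 -> e * a2 <= n.+1%:R^-1
    + e * (S ^+ 2 + D ^+ 2 - (1 - e) * gdist d (V n) g ^+ 2) / 2.
  move=> e0 e1; have [T [vG Ev]] := HV n.
  have [_ T10 _ _] := vG.
  pose T' := Num.min T 1.
  have T0 : 0 < T' by rewrite lt_min T10 ltr01.
  have TT1 : T' <= T by rewrite ge_min lexx.
  have TT2 : T' <= 1 by rewrite ge_min lexx orbT.
  have v' := germ_onW _ _ _ _ vG T0 TT1; have g' := germ_onW _ _ _ _ gg T0 TT2.
  have C0 : 0 <= `|lam| / 2 * D ^+ 2 by rewrite mulr_ge0 ?sqr_ge0// mulr_ge0.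
  have F1 t : 0 <= t -> t <= T' ->
     (E (V n t) <= (ey - (S ^+ 2 - n.+1%:R^-1) * t + `|lam| / 2 * D ^+ 2 * t ^+ 2)%:E)%E.
    move=> t0 tT; have tT' : t <= T by lra.
    apply: le_trans (Ev t t0 tT') _.
    by rewrite lee_fin lerDl mulr_ge0// sqr_ge0.
  have F2 t : 0 <= t -> t <= T' -> (E (g t) <= (ey - a2 * t + `|lam| / 2 * D ^+ 2 * t ^+ 2)%:E)%E.
    by move=> t0 tT; apply: geodesic_energy => //; lra.
  have := germ_slope_inequality _ _ _ _ _ _ _ _ _ _ v' g' C0 S0 F1 F2 SE (ltW e0) e1.
  have : 0 <= n.+1%:R^-1 :> R by rewrite invr_ge0 ler0n.
  rewrite -/D; move: (n.+1%:R^-1) (gdist d (V n) g) => q G q0 H.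
  have : 0 <= e * q by nra.
  lra.
(* The index goes to infinity before [e] goes to [0], since the loss [n.+1%:R^-1] carries no factor
   [e]. *)
have lim e : 0 < e -> e <= 1 -> a2 <= (S ^+ 2 + D ^+ 2 - (1 - e) * GD ^+ 2) / 2.
  move=> e0 e1; rewrite -(ler_pM2l e0); apply: le_of_eps => eta eta0.
  have c0 : 0 < eta / 2 by lra.
  have [N1 H1] := invn_small _ c0.
  have [N2 H2] := tdist_eps dM r0 K0 LQ _ _ VC gC (Num.min 1 (eta / (2 * (2 * GD + 1)))) ltac:(by rewrite lt_min ltr01 divr_gt0//; lra).
  pose n := maxn N1 N2.
  have n1 : (N1 <= n)%N by exact: leq_maxl.
  have n2 : (N2 <= n)%N by exact: leq_maxr.
  have := H1 n n1; have := H2 n n2; have := main e n e0 e1.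
  have gd0 := gdist_ge0 dM r0 K0 LQ _ _ (VC.1 n) gger.
  rewrite /of_germ; set G := gdist d (V n) g in gd0 *; move: (n.+1%:R^-1) => q.
  rewrite -/GD => M; rewrite lt_min => /andP[G1 G2] q1.
  move: G2; rewrite ltr_pdivlMr; last by lra.
  move=> G2.
  have : GD ^+ 2 - G ^+ 2 <= eta.
    have h : GD - G <= `|G - GD| by rewrite distrC ler_norm.
    have [le|le] := leP GD G; first by nra.
    have : `|G - GD| * (2 * (2 * GD + 1)) >= (GD - G) * (2 * (2 * GD + 1)).
      by rewrite ler_wpM2r//; lra.
    nra.
  move=> hG; have : e * ((1 - e) * (GD ^+ 2 - G ^+ 2)) <= eta.
    have : e * (1 - e) <= 1 by nra.
    have : 0 <= e * (1 - e) by nra.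
    nra.
  lra.
apply: le_of_eps => eta eta0.
pose e := Num.min 1 (eta / (GD ^+ 2 + 1)).
have den : 0 < GD ^+ 2 + 1 by have := sqr_ge0 GD; lra.
have e0 : 0 < e by rewrite lt_min ltr01 divr_gt0.
have e1 : e <= 1 by rewrite ge_min lexx.
have ee : e * (GD ^+ 2 + 1) <= eta by rewrite -ler_pdivlMr// ge_min lexx orbT.
by have := lim e e0 e1; lra.
Qed.

Lemma descent_minnorm S V : slope d E y = S%:E -> 0 <= S -> descent_seq S V ->
  minnorm_elt d lam E y V.
Proof.
move=> SE S0 HV; split; first exact: (descent_msubdiff S).
move=> W /msubdiff_slope; have [_ ->] := descent_tcone _ _ SE S0 HV.
by rewrite SE lee_fin.
Qed.

End Subdifferential.

(** * Monotonicity from an almost everywhere derivative bound *)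

Section Monotonicity.
Context {R : realType}.
Local Notation mu := (@lebesgue_measure R).

(** Continuation from [a]: the first condition forbids an upward jump on arrival at the supremum of
    the good times, and the second allows one to go past it. *)
Lemma locally_nonincreasing (f : R -> R) (a b : R) : a <= b ->
  (forall x, a < x -> x <= b -> forall e, 0 < e -> exists2 r, 0 < r &
     forall z, a <= z -> z <= x -> x - r < z -> f x <= f z + e) ->
  (forall x, a <= x -> x < b -> exists2 r, 0 < r &
     forall s, x < s -> s < x + r -> s <= b -> f s <= f x) ->
  f b <= f a.
Proof.
move=> ab fl fr.
pose Z := [set s | [/\ a <= s, s <= b & forall z, a <= z -> z <= s -> f z <= f a]].
have Za : Z a by split=> // z az za; have -> : z = a by lra.
have hZ : has_sup Z by split; [exists a|exists b => s []].
set x := sup Z.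
have ax : a <= x by apply: ub_le_sup => //; exact: hZ.2.
have xb : x <= b by apply: ge_sup; [exact: hZ.1|move=> s []].
have below z : a <= z -> z < x -> f z <= f a.
  move=> az zx; have e0 : 0 < x - z by lra.
  have [s [_ _ Hs] zs] := @sup_adherent _ Z _ e0 hZ.
  by apply: Hs => //; rewrite -/x in zs; lra.
have atx : f x <= f a.
  move: ax; rewrite le_eqVlt => /orP[/eqP<-//|ax].
  apply: le_of_eps => e e0; have [r r0 H] := fl x ax xb e e0.
  pose z := Num.max a (x - r / 2).
  have za : a <= z by rewrite le_max lexx.
  have zx : z < x by rewrite gt_max ax/=; lra.
  have zr : x - r < z by rewrite lt_max; apply/orP; right; lra.
  by have := H z za (ltW zx) zr; have := below z za zx; lra.
move: xb; rewrite le_eqVlt => /orP[/eqP<-//|xb].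
have [r r0 H] := fr x ax xb.
pose s := Num.min b (x + r / 2).
have xs : x < s by rewrite lt_min xb/=; lra.
have sb : s <= b by rewrite ge_min lexx.
have sr : s <= x + r / 2 by rewrite ge_min lexx orbT.
suff : Z s by move=> Zs; have : s <= x by [apply: ub_le_sup => //; exact: hZ.2]; lra.
split=> //; first by lra.
move=> z az zs; have [zx|xz|->//] := ltgtP z x; first exact: below.
by apply: le_trans atx; apply: H => //; lra.
Qed.

Lemma null_set_small_integral (m : R -> R) (N : set R) (e : R) :
  mu.-integrable setT (EFin \o m) -> mu.-negligible N -> 0 < e ->
  exists U, [/\ open U, N `<=` U & (\int[mu]_(x in U) (`|m x|)%:E <= e%:E)%E].
Proof.
move=> im [A [mA A0 NA]] e0.
have [del [del0 H]] := integral_normr_continuous im e0.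
have Afin : (mu A < +oo)%E by rewrite A0.
have [U [oU AU Udel]] := lebesgue_regularity_outer mA Afin del0.
have mU : measurable U by exact: open_measurable.
exists U; split => //; first exact: subset_trans AU.
have mUA : measurable (U `\` A) by exact: measurableD.
have Us : (mu U < del%:E)%E.
  rewrite (_ : U = (U `\` A) `|` A); last by rewrite setUC setDUK.
  by rewrite measureU0.
have := H U mU Us; rewrite /Rintegral => /ltW; rewrite -lee_fin fineK//.
have : mu.-integrable U (EFin \o m) by apply: integrableS im.
move=> /integrable_abse/integrable_fin_num.
exact.
Qed.

Lemma integral_modulus (m : R -> R) (a b : R) :
  mu.-integrable `[a, b] (EFin \o m) -> forall e, 0 < e -> exists2 r, 0 < r &
  forall s t, a <= s -> s <= t -> t <= b -> t - s < r ->
    (\int[mu]_(x in `[s, t]) (m x)%:E <= e%:E)%E.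
Proof.
move=> im e e0.
pose m' := m \_ `[a, b].
have mab : measurable (`[a, b] : set (measurableTypeR R)) by exact: measurable_itv.
have im' : mu.-integrable setT (EFin \o m').
  have -> : EFin \o m' = (EFin \o m) \_ `[a, b].
    by apply/funext => x; rewrite /m' /patch/=; case: ifP.
  exact: (@integrable_mkcond _ (measurableTypeR R) R mu _ (EFin \o m) mab).1 im.
have [r [r0 H]] := integral_normr_continuous im' e0.
exists r => // s t as_ st tb str.
have mst : measurable (`[s, t] : set (measurableTypeR R)) by exact: measurable_itv.
have stab : `[s, t] `<=` `[a, b].
  by move=> x /=; rewrite !in_itv/= => /andP[? ?]; apply/andP; split; lra.
have ist : mu.-integrable `[s, t] (EFin \o m') by apply: integrableS im'.
have mus : (mu `[s, t] < r%:E)%E.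
  rewrite lebesgue_measure_itv/=; case: ifP => _; last by rewrite lte_fin.
  by rewrite -EFinB lte_fin.
have := H _ mst mus; rewrite /Rintegral => /ltW; rewrite -lee_fin fineK; last first.
  exact: (@integrable_fin_num _ (measurableTypeR R) R mu _ mst _ (integrable_abse ist)).
apply: le_trans.
have -> : (\int[mu]_(x in `[s, t]) (m x)%:E = \int[mu]_(x in `[s, t]) (m' x)%:E)%E.
  by apply: eq_integral => x; rewrite inE => xst; rewrite /m' /patch mem_set//; exact: stab.
apply: le_trans (lee_abs _) _.
apply: le_trans (le_abse_integral mu mst (measurable_int mu ist)) _.
by [].
Qed.

(** The exceptional null set is covered by an open set [U] on which [m] has small integral.
    Subtracting [e * s] settles the points outside [U]; subtracting the integral of [m] over the
    part of [U] before [s] settles those inside. The total cost is at most [eta]. *)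
Lemma ae_nonincreasing (f m : R -> R) (a b : R) : a <= b ->
  mu.-integrable `[a, b] (EFin \o m) -> (forall x, 0 <= m x) ->
  (forall s t, a <= s -> s <= t -> t <= b ->
     ((f t - f s)%:E <= \int[mu]_(x in `[s, t]) (m x)%:E)%E) ->
  {ae mu, forall t, a < t -> t < b -> forall e, 0 < e -> exists2 r, 0 < r &
     forall s, t < s -> s < t + r -> f s - f t <= e * (s - t)} ->
  f b <= f a.
Proof.
move=> ab im m0 ac dae; apply: le_of_eps => eta eta0.
pose m' := m \_ `[a, b].
have im' : mu.-integrable setT (EFin \o m').
  have -> : EFin \o m' = (EFin \o m) \_ `[a, b].
    by apply/funext => x; rewrite /m' /patch/=; case: ifP.
  have mab : measurable (`[a, b] : set (measurableTypeR R)) by exact: measurable_itv.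
  exact: (@integrable_mkcond _ (measurableTypeR R) R mu _ (EFin \o m) mab).1 im.
(* The endpoint [a] joins the exceptional set because the derivative condition is available only for
   [a < t]. *)
pose N := ~` [set t | a < t -> t < b -> forall e, 0 < e -> exists2 r, 0 < r &
     forall s, t < s -> s < t + r -> f s - f t <= e * (s - t)] `|` [set a].
have nN : mu.-negligible N.
  apply: negligibleU; first exact: dae.
  by exists [set a]; split => //; exact: lebesgue_measure_set1.
have eta2 : 0 < eta / 2 by lra.
have [U [oU NU Ueta]] := null_set_small_integral _ _ _ im' nN eta2.
have mU : measurable U by exact: open_measurable.
have mUs s t : measurable (U `&` `[s, t] : set (measurableTypeR R)) by exact: measurableI.
have ims (A : set (measurableTypeR R)) : measurable A -> A `<=` `[a, b] -> mu.-integrable A (EFin \o m).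
  by move=> mA Aab; apply: integrableS im.
have sub s t : a <= s -> t <= b -> `[s, t] `<=` `[a, b].
  by move=> as_ tb x /=; rewrite !in_itv/= => /andP[? ?]; apply/andP; split; lra.
pose I s := (\int[mu]_(x in U `&` `[a, s]) (m x)%:E)%E.
have Ifin s : s <= b -> I s \is a fin_num.
  move=> sb; apply: (@integrable_fin_num _ (measurableTypeR R) R mu) => //.
  apply: ims => //.
  by apply: subset_trans (sub a s (lexx a) sb); exact: subIsetr.
have Imono s t : s <= t -> t <= b -> (I s <= I t)%E.
  move=> st tb; apply: ge0_subset_integral => //.
  - apply: (measurable_int mu); apply: ims => //.
    by apply: subset_trans (sub a t (lexx a) tb); exact: subIsetr.
  - by move=> x _; rewrite lee_fin.
  - by apply: setIS => x /=; rewrite !in_itv/= => /andP[-> ?]/=; lra.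
have Ib : (I b <= (eta / 2)%:E)%E.
  apply: le_trans Ueta.
  have -> : I b = (\int[mu]_(x in U `&` `[a, b]) (`|m' x|)%:E)%E.
    apply: eq_integral => x; rewrite inE => -[_ xab].
    by rewrite /m' /patch mem_set//= ger0_norm.
  apply: ge0_subset_integral => //.
  - by apply: (measurable_int mu); apply: (integrableS measurableT) (integrable_abse im') => //.
have Istep s t : a <= s -> s < t -> t <= b -> `[s, t] `<=` U ->
    ((f t - f s)%:E <= I t - I s)%E.
  move=> as_ st tb stU.
  have m1 : measurable_fun `]s, t] (EFin \o m).
    apply: (measurable_int mu); apply: ims => //.
    apply: subset_trans (sub s t as_ tb).
    by move=> x /=; rewrite !in_itv/= => /andP[? ->]; rewrite ltW.
  have -> : I t = (I s + \int[mu]_(x in `]s, t]) (m x)%:E)%E.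
    rewrite -ge0_integral_setU//; last 2 first.
    - by move=> x _; rewrite lee_fin.
    - apply/disj_setPS => x [[_ /=]]; rewrite !in_itv/= => /andP[_ ?] /andP[? _]; lra.
    - rewrite /I; congr (integral _ _ _); apply/seteqP; split => x /=; rewrite !in_itv/=.
        move=> [xU /andP[ax xt]]; have [xs|xs] := leP x s; [left|right].
          by rewrite ax.
        by rewrite xt.
      move=> [[xU /andP[ax xs]]|/andP[sx xt]]; first by rewrite ax/=; split => //; lra.
      split; last by apply/andP; split; lra.
      by apply: stU => /=; rewrite in_itv/= xt ltW.
    - apply/measurable_funU => //; split => //.
      apply: (measurable_int mu); apply: ims => //.
      have sb : s <= b by lra.
      by apply: subset_trans (sub a s (lexx a) sb); exact: subIsetr.
  rewrite addeAC subee ?Ifin ?add0e//; last by lra.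
  rewrite (@integral_itv_obnd_cbnd _ s (BRight t) (EFin \o m))//.
  by apply: ac => //; exact: ltW.
pose e := eta / 2 / (b - a + 1).
have den : 0 < b - a + 1 by lra.
have e0 : 0 < e by rewrite divr_gt0.
have eE : e * (b - a + 1) = eta / 2 by rewrite divfK// gt_eqF.
pose G s := fine (I s).
have Gmono s t : s <= t -> t <= b -> G s <= G t.
  by move=> st tb; rewrite -lee_fin !fineK ?Ifin ?Imono//; lra.
have Gb : G b <= eta / 2 by rewrite -lee_fin fineK ?Ifin.
have Ga : 0 <= G a by apply: fine_ge0; apply: integral_ge0 => x _; rewrite lee_fin.
have := @locally_nonincreasing (fun s => f s - e * s - G s) a b ab => H.
suff : f b - e * b - G b <= f a - e * a - G a by lra.
apply: H.
  move=> x ax xb e1 e10; have [r r0 Hr] := integral_modulus _ _ _ im e1 e10.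
  exists r => // z az zx xr; have zxr : x - z < r by lra.
  have := le_trans (ac z x az zx xb) (Hr z x az zx xb zxr); rewrite lee_fin.
  have := Gmono z x zx xb.
  by have : e * z <= e * x by [rewrite ler_pM2l]; lra.
move=> x ax xb; have [xU|xU] := pselect (U x).
  have /nbhs_ballP[r /= r0 rU] := open_nbhs_nbhs (conj oU xU).
  exists r => // s xs sr sb.
  have xsU : `[x, s] `<=` U.
    move=> z /=; rewrite in_itv/= => /andP[xz zs]; apply: rU.
    by rewrite /ball/= distrC ger0_norm; lra.
  have := Istep x s ax xs sb xsU.
  rewrite -(fineK (Ifin _ sb)) -(fineK (Ifin _ (ltW xb))) -EFinB lee_fin -/(G s) -/(G x).
  by have : e * x <= e * s by [rewrite ler_pM2l// ltW]; lra.
have xN : ~ N x by move=> /NU.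
have ax' : a < x.
  by rewrite lt_neqAle ax andbT; apply/eqP => xa; apply: xN; right.
have [r r0 Hr] : exists2 r, 0 < r & forall s, x < s -> s < x + r -> f s - f x <= e * (s - x).
  by apply: contrapT => h; apply: xN; left => /(_ ax' xb e e0).
exists r => // s xs sr sb; have := Hr s xs sr; have := Gmono x s (ltW xs) sb; lra.
Qed.

Lemma ae_exists (P : R -> Prop) (a b : R) : a < b -> {ae mu, forall t, P t} ->
  exists t, [/\ a < t, t < b & P t].
Proof.
move=> ab [A [mA A0 PA]]; apply: contrapT => H.
have sub : `]a, b[ `<=` A.
  move=> t /=; rewrite in_itv/= => /andP[ta tb]; apply: PA => /= Pt.
  by apply: H; exists t.
have mi : measurable (`]a, b[ : set (measurableTypeR R)) by exact: measurable_itv.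
have A0' : (mu A <= 0)%E by rewrite A0.
have L : (mu `]a, b[ = (b - a)%:E)%E by rewrite lebesgue_measure_itv/= lte_fin ab -EFinB.
have : ((b - a)%:E <= 0)%E.
  by rewrite -L; exact: le_trans (le_measure mu (mem_set mi) (mem_set mA) sub) A0'.
rewrite lee_fin; lra.
Qed.

Lemma derivable_right_increment (f : R -> R) (t : R) : derivable f t 1 ->
  forall e, 0 < e -> exists2 r, 0 < r & forall s, t < s -> s < t + r ->
    f s - f t <= (derive1 f t + e) * (s - t).
Proof.
move=> df e e0; have := df => /cvgrPdist_lt/(_ e e0)[r /= r0 H].
exists r => // s ts str.
have st : 0 < s - t by lra.
have h1 : s - t < r by lra.
have h2 : s - t != 0 by rewrite gt_eqF.
have := H (s - t); rewrite /ball_/= sub0r normrN gtr0_norm// => /(_ h1 h2).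
rewrite -/(derive f t 1) -derive1E /GRing.scale/= mulr1 subrK.
rewrite ltr_norml => /andP[h _].
have : (s - t)^-1 * (f s - f t) <= derive1 f t + e by lra.
by rewrite mulrC ler_pdivrMr.
Qed.

End Monotonicity.

(** * Half squared distances corrected by a quadratic function of time *)

Section QuadraticCorrection.
Context {R : realType}.

(** Bounds increments of the corrected half squared distance by the displacement [D] of the curve,
    [M] being a bound for the radius. This gives the integrable majorant that [ae_nonincreasing]
    asks for. *)
Lemma quadratic_increment (a b D M k0 k1 s t u h : R) : s <= t -> t <= u -> u <= s + h ->
  0 <= a -> 0 <= b -> 0 <= D -> a <= D + b -> a <= M -> b <= M ->
  a ^+ 2 / 2 - k0 * (u - s) - k1 * (u - s) ^+ 2 / 2
    - (b ^+ 2 / 2 - k0 * (t - s) - k1 * (t - s) ^+ 2 / 2)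
  <= M * D + (`|k0| + `|k1| * h) * (u - t).
Proof.
move=> st tu uh a0 b0 D0 aD aM bM.
have h1 : a ^+ 2 / 2 - b ^+ 2 / 2 <= M * D.
  by clear - a0 b0 D0 aD aM bM; have [ab|ab] := leP a b; nra.
have ut : 0 <= u - t by rewrite subr_ge0.
have h2 : - k0 * (u - t) <= `|k0| * (u - t).
  by rewrite ler_wpM2r// -normrN ler_norm.
have h3 : - k1 * ((u - s) ^+ 2 - (t - s) ^+ 2) / 2 <= `|k1| * h * (u - t).
  have -> : (u - s) ^+ 2 - (t - s) ^+ 2 = (u - t) * ((u - s) + (t - s)) by ring.
  have n1 : - k1 <= `|k1| by rewrite -normrN ler_norm.
  have k10 := normr_ge0 k1.
  have g0 : 0 <= (u - t) * ((u - s) + (t - s)) by rewrite mulr_ge0//; lra.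
  have g1 : (u - t) * ((u - s) + (t - s)) <= (u - t) * (2 * h) by rewrite ler_wpM2l//; lra.
  by clear - n1 k10 g0 g1; nra.
by clear - h1 h2 h3; lra.
Qed.

Lemma quadratic_correction_increment (phi : R -> R) (k0 k1 s t : R) :
  derivable phi t 1 -> derive1 phi t <= k0 + k1 * (t - s) ->
  forall e, 0 < e -> exists2 r, 0 < r & forall u, t < u -> u < t + r ->
    phi u - k0 * (u - s) - k1 * (u - s) ^+ 2 / 2
      - (phi t - k0 * (t - s) - k1 * (t - s) ^+ 2 / 2) <= e * (u - t).
Proof.
move=> dt dk e e0.
have e2 : 0 < e / 2 by lra.
have [r1 r10 H1] := derivable_right_increment _ _ dt _ e2.
have k10 := normr_ge0 k1.
have k1p : 0 < `|k1| + 1 by lra.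
exists (Num.min r1 (e / (`|k1| + 1))); first by rewrite lt_min r10 divr_gt0.
move=> u tu; rewrite -ltrBlDl lt_min => /andP[u1]; rewrite ltr_pdivlMr// => u2.
have ut : 0 < u - t by lra.
have tur : u < t + r1 by lra.
have := H1 u tu tur; set D := derive1 _ t in dk * => hu.
have h1 : (D + e / 2) * (u - t) <= (k0 + k1 * (t - s) + e / 2) * (u - t).
  by rewrite ler_pM2r//; lra.
have h2 : - k1 * (u - t) ^+ 2 <= e * (u - t).
  have -> : - k1 * (u - t) ^+ 2 = (- k1 * (u - t)) * (u - t) by ring.
  rewrite ler_pM2r//; have : - k1 <= `|k1| by rewrite -normrN ler_norm.
  nra.
by clear - hu h1 h2; lra.
Qed.

End QuadraticCorrection.

(** * The gradient flow: integrated variational inequality, energy, slope and speed *)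

Section Flow.
Context {R : realType} {Y : Type} {d : Y -> Y -> R} {lam : R} {E : Y -> \bar R}.
Context {y0 : Y} {c : R -> Y}.
Hypotheses (dM : is_metric d) (Eb : forall z, (-oo < E z)%E) (Elsc : lsc d E).
Hypotheses (y0D : in_closure_dom d E y0) (c0 : c 0 = y0) (GF : gradient_flow d lam E y0 c).
Local Notation mu := (@lebesgue_measure R).

Lemma flow_continuous t : 0 <= t -> forall e, 0 < e -> exists2 r, 0 < r &
  forall s, 0 <= s -> `|s - t| < r -> d (c s) (c t) < e.
Proof.
rewrite le_eqVlt => /orP[/eqP<-|t0] e e0.
  have [_ [/(_ e e0)[r [r0 H]] _]] := GF; exists r => // s.
  rewrite le_eqVlt => /orP[/eqP<-|s0]; first by rewrite (distxx dM).
  by rewrite subr0 gtr0_norm// c0 => sr; apply: H; rewrite s0.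
have [/(_ (t / 2) (t + 1))AC _] := GF.
have [|m [im Hm]] := AC ltac:(lra); first by lra.
have e2 : 0 < e / 2 by lra.
have [r r0 H] := integral_modulus _ _ _ im _ e2.
exists (Num.min r (Num.min (t / 2) 1)); first by rewrite !lt_min r0 ltr01 andbT; lra.
move=> s s0; rewrite !lt_min => /andP[sr /andP[st s1]].
move: sr st s1; rewrite !ltr_norml => /andP[? ?] /andP[? ?] /andP[? ?].
suff : d (c s) (c t) <= e / 2 by lra.
rewrite -lee_fin; have [st|ts] := leP s t.
  by apply: le_trans (Hm s t _ st _) (H s t _ st _ _); lra.
by rewrite (dist_sym dM); apply: le_trans (Hm t s _ (ltW ts) _) (H t s _ (ltW ts) _ _); lra.
Qed.

Lemma flow_dist_max (f : R -> R) a b : a <= b ->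
  (forall t, a <= t -> forall e, 0 < e -> exists2 r, 0 < r &
     forall s, a <= s -> `|s - t| < r -> `|f s - f t| < e) ->
  exists x, [/\ a <= x, x <= b & forall s, a <= s -> s <= b -> f s <= f x].
Proof.
move=> ab fc.
(* Freezing [f] to the left of [a] makes it continuous on the whole line. *)
pose g s := f (Num.max s a).
have cg : {within `[a, b], continuous g}.
  apply: continuous_subspaceT => t; apply/cvgrPdist_lt => e e0.
  have at_ : a <= Num.max t a by rewrite le_max lexx orbT.
  have [r r0 H] := fc _ at_ e e0.
  exists r => // s /= sr; rewrite distrC; apply: H; first by rewrite le_max lexx orbT.
  apply: le_lt_trans sr; rewrite (distrC t s) /Num.max.
  case: ltP => h1; case: ltP => h2 //; rewrite ?subrr ?normr0 ?normr_ge0//.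
  - have : 0 <= t - a by lra.
    have h : s - t < 0 by lra.
    by move=> h3; rewrite (ltr0_norm h) ler_norml; lra.
  - have h : 0 <= s - t by lra.
    by rewrite (ger0_norm h) ler_norml; lra.
have [x] := EVT_max ab cg; rewrite in_itv/= => /andP[ax xb] H.
exists x; split => // s as_ sb.
have := H s; rewrite in_itv/= as_ sb /g => /(_ isT).
by rewrite (max_l as_) (max_l ax).
Qed.

Lemma flow_radius_max t h w : 0 <= t -> 0 <= h ->
  exists x, [/\ 0 <= x, x <= h & forall s, 0 <= s -> s <= h -> d (c (t + s)) w <= d (c (t + x)) w].
Proof.
move=> t0 h0; apply: (@flow_dist_max (fun s => d (c (t + s)) w)) => // s s0 e e0.
have ts : 0 <= t + s by lra.
have [r r0 H] := flow_continuous _ ts _ e0; exists r => // u u0 us.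
have tu : 0 <= t + u by lra.
have := H (t + u) tu; rewrite opprD addrACA subrr add0r => /(_ us).
have := dist_tri dM (c (t + s)) (c (t + u)) w; have := dist_tri dM (c (t + u)) (c (t + s)) w.
rewrite (dist_sym dM (c (t + s)) (c (t + u))).
by rewrite ltr_norml; lra.
Qed.

(** The hypothesis bounds, by an affine function of time, the derivative that the variational
    inequality allows, in a form that makes sense for infinite energy. Monotonicity of the corrected
    function [f] takes the place of an integration. *)
Lemma evi_interior s h w (ew k0 k1 : R) : 0 < s -> 0 < h -> E w = ew%:E ->
  (forall r, 0 < r -> r < h ->
     (ew%:E <= (k0 + k1 * r)%:E + E (c (s + r)) + (lam / 2 * d (c (s + r)) w ^+ 2)%:E)%E) ->
  d (c (s + h)) w ^+ 2 / 2 <= d (c s) w ^+ 2 / 2 + k0 * h + k1 * h ^+ 2 / 2.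
Proof.
move=> s0 h0 Ew Hk.
pose f t := d (c t) w ^+ 2 / 2 - k0 * (t - s) - k1 * (t - s) ^+ 2 / 2.
suff : f (s + h) <= f s.
  by rewrite /f; lra.
have sh : s < s + h by lra.
have [/(_ s (s + h) s0 sh)[m [im Hm]] [_ /(_ w) EV]] := GF.
have s0' := ltW s0; have h0' := ltW h0.
have [x [_ _ Mx]] := flow_radius_max s h w s0' h0'.
pose M := d (c (s + x)) w.
have M0 : 0 <= M by exact: dist_ge0.
have cM t : s <= t -> t <= s + h -> d (c t) w <= M.
  move=> st th; have := Mx (t - s); rewrite (addrC s) subrK.
  by apply; lra.
pose C := `|k0| + `|k1| * h.
have k00 := normr_ge0 k0; have k10 := normr_ge0 k1.
have C0 : 0 <= C by rewrite /C; nra.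
pose m' x := M * `|m x| + C.
have muE t u : t <= u -> (mu `[t, u] = (u - t)%:E)%E.
  rewrite lebesgue_measure_itv/= lte_fin le_eqVlt => /orP[/eqP->|->]; last by rewrite EFinB.
  by rewrite ltxx subrr.
have mab : measurable (`[s, s + h] : set (measurableTypeR R)) by exact: measurable_itv.
have inm : mu.-integrable `[s, s + h] (fun x => (`|m x|)%:E).
  exact: integrable_abse im.
have im' : mu.-integrable `[s, s + h] (EFin \o m').
  have -> : EFin \o m' = (fun x => (M%:E * (`|m x|)%:E + cst C%:E x)%E).
    by apply/funext => z.
  apply: integrableD => //; first exact: integrableZl.
  apply/integrableP; split; first exact: measurable_cst.
  apply: (@le_lt_trans _ _ (`|C%:E| * h%:E)%E); last by rewrite -EFinM ltry.
  have -> : h%:E = mu `[s, s + h] by rewrite muE ?(ltW sh)// addrAC subrr add0r.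
  by rewrite (integral_cst mu mab `|C%:E|%E).
have m'0 z : 0 <= m' z by rewrite /m' addr_ge0// mulr_ge0.
have subst t u : s <= t -> u <= s + h -> `[t, u] `<=` `[s, s + h].
  by move=> st uh z /=; rewrite !in_itv/= => /andP[? ?]; apply/andP; split; lra.
apply: (@ae_nonincreasing R f m' s (s + h)) => //; first by lra.
- move=> t u st tu uh.
  have mtu : measurable (`[t, u] : set (measurableTypeR R)) by exact: measurable_itv.
  have itu : mu.-integrable `[t, u] (fun x => (`|m x|)%:E).
    by apply: integrableS inm => //; exact: subst.
  have itm : mu.-integrable `[t, u] (EFin \o m).
    by apply: integrableS im => //; exact: subst.
  have -> : (\int[mu]_(x in `[t, u]) (m' x)%:E
      = M%:E * \int[mu]_(x in `[t, u]) (`|m x|)%:E + (C * (u - t))%:E)%E.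
    have mm : measurable_fun `[t, u] (fun x : measurableTypeR R => (`|m x|)%:E).
      exact: (measurable_int mu itu).
    have mM : measurable_fun `[t, u] (fun x : measurableTypeR R => (M%:E * (`|m x|)%:E)%E).
      exact: measurable_funeM.
    have p1 (z : measurableTypeR R) : [set` `[t, u]] z -> (0 <= M%:E * (`|m z|)%:E)%E.
      by move=> _; rewrite mule_ge0// lee_fin.
    have p2 (z : measurableTypeR R) : [set` `[t, u]] z -> (0 <= cst C%:E z)%E.
      by move=> _; rewrite /= lee_fin.
    have mC : measurable_fun `[t, u] (cst C%:E : measurableTypeR R -> \bar R).
      exact: measurable_cst.
    have p3 (z : measurableTypeR R) : [set` `[t, u]] z -> (0 <= (`|m z|)%:E)%E.
      by move=> _; rewrite lee_fin.
    transitivity (\int[mu]_(x in `[t, u]) (M%:E * (`|m x|)%:E + cst C%:E x))%E.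
      by apply: eq_integral.
    rewrite (ge0_integralD mu mtu p1 mM p2 mC) (ge0_integralZl mu mtu mm p3)//.
    congr (_ + _)%E.
    by rewrite EFinM -(muE t u tu); exact: (integral_cst mu mtu C%:E).
  have dtu : ((d (c t) (c u))%:E <= \int[mu]_(x in `[t, u]) (`|m x|)%:E)%E.
    apply: le_trans (Hm t u st tu uh) _.
    apply: le_trans (lee_abs _) _.
    exact: le_trans (le_abse_integral mu mtu (measurable_int mu itm)) _.
  have Mle : ((M * d (c t) (c u))%:E <= M%:E * \int[mu]_(x in `[t, u]) (`|m x|)%:E)%E.
    by rewrite EFinM lee_wpmul2l// lee_fin.
  apply: le_trans (leeD Mle (lexx _)); rewrite -EFinD lee_fin.
  have tu' : t <= s + h by lra.
  have su : s <= u by lra.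
  have := cM t st tu'; have := cM u su uh; have := dist_ge0 dM (c t) w; have := dist_ge0 dM (c u) w.
  have := dist_tri dM (c t) (c u) w; have := dist_ge0 dM (c t) (c u).
  rewrite (dist_sym dM (c u) (c t)) /f.
  by move=> D0 aD a0 b0 aM bM; exact: quadratic_increment.
have [A [mA A0 HA]] := EV; exists A; split => // t /= nP; apply: HA => /= Ht.
apply: nP => st th e e0.
have t0 : 0 < t by lra.
have [dt Hd] := Ht t0.
have ts0 : 0 < t - s by rewrite subr_gt0.
have tsh : t - s < h by rewrite ltrBlDl.
have := Hk (t - s) ts0 tsh; rewrite (addrC s) subrK => Hkt.
have dk : derive1 (fun s => d (c s) w ^+ 2 / 2) t <= k0 + k1 * (t - s).
  move: Hd Hkt; rewrite Ew; case ect : (E (c t)) => [b| |].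
  - by rewrite -!EFinD !lee_fin; lra.
  - by rewrite addey// addye// leye_eq.
  - by have := Eb (c t); rewrite ect ltxx.
exact: quadratic_correction_increment.
Qed.

(** The gradient flow is absolutely continuous only away from time [0]. A start at [s = 0] is
    therefore approached through [s + a], using continuity at [s]. *)
Lemma evi_integrated s h w (ew k0 k1 : R) : 0 <= s -> 0 <= h -> E w = ew%:E ->
  (forall r, 0 < r -> r < h ->
     (ew%:E <= (k0 + k1 * r)%:E + E (c (s + r)) + (lam / 2 * d (c (s + r)) w ^+ 2)%:E)%E) ->
  d (c (s + h)) w ^+ 2 / 2 <= d (c s) w ^+ 2 / 2 + k0 * h + k1 * h ^+ 2 / 2.
Proof.
move=> s0; rewrite le_eqVlt => /orP[/eqP<-|h0] Ew Hk.
  by rewrite addr0 expr0n/= !mulr0 mul0r !addr0.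
apply: le_of_eps => eta eta0.
set D0 := d (c s) w.
have D00 : 0 <= D0 by exact: dist_ge0.
pose e := Num.min 1 (eta / (2 * D0 + 2)).
have den : 0 < 2 * D0 + 2 by lra.
have e0 : 0 < e by rewrite lt_min ltr01 divr_gt0.
have e1 : e <= 1 by rewrite ge_min lexx.
have ee : e * (2 * D0 + 2) <= eta by rewrite -ler_pdivlMr// ge_min lexx orbT.
have [r r0 H] := flow_continuous _ s0 _ e0.
pose B := `|k0| + `|k1| * h + 1.
have k00 := normr_ge0 k0; have k10 := normr_ge0 k1.
have B0 : 0 < B by rewrite /B; nra.
pose a := Num.min (r / 2) (Num.min (h / 2) (eta / (2 * B))).
have B2 : 0 < 2 * B by lra.
have a0 : 0 < a.
  by rewrite !lt_min; apply/andP; split; [lra|apply/andP; split; [lra|exact: divr_gt0]].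
have ar : a <= r / 2 by rewrite ge_min lexx.
have ah : a <= h / 2 by rewrite !ge_min lexx !orbT.
have aB : a * (2 * B) <= eta by rewrite -ler_pdivlMr// !ge_min lexx !orbT.
have sa : 0 < s + a by lra.
have ha : 0 < h - a by lra.
have := evi_interior (s + a) (h - a) w ew (k0 + k1 * a) k1 sa ha Ew.
have -> : s + a + (h - a) = s + h by ring.
have Hk' u : 0 < u -> u < h - a -> (ew%:E <= (k0 + k1 * a + k1 * u)%:E + E (c (s + a + u))
    + (lam / 2 * d (c (s + a + u)) w ^+ 2)%:E)%E.
  move=> u0 uh; have := Hk (a + u) ltac:(lra) ltac:(lra).
  by rewrite addrA (_ : k0 + k1 * (a + u) = k0 + k1 * a + k1 * u)//; ring.
move=> /(_ Hk') main.
have car : `|s + a - s| < r by rewrite addrC addKr gtr0_norm//; lra.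
have dsa := H (s + a) (ltW sa) car.
have tri := dist_tri dM (c s) (c (s + a)) w.
have da : d (c (s + a)) w ^+ 2 <= D0 ^+ 2 + eta.
  by have := dist_ge0 dM (c (s + a)) w; rewrite -/D0 in tri; nra.
have k0a : - k0 * a <= `|k0| * a by rewrite ler_pM2r// -normrN ler_norm.
have k1a : - k1 * a ^+ 2 <= `|k1| * h * a.
  have -> : `|k1| * h * a = `|k1| * (h * a) by ring.
  have : - k1 <= `|k1| by rewrite -normrN ler_norm.
  have : a ^+ 2 <= h * a by nra.
  have := sqr_ge0 a; nra.
have Ba : B * a <= eta / 2 by lra.
have : (`|k0| + `|k1| * h) * a <= B * a by rewrite ler_pM2r// /B; lra.
have : 0 <= `|k1| * h * a.
  by apply: mulr_ge0; [apply: mulr_ge0 => //; exact: ltW|exact: ltW].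
lra.
Qed.

(** The test point is the starting point, and [M] is the largest displacement up to time [r]. This
    gives [M ^+ 2 / 2 <= (D + |lam| / 2 * M ^+ 2) * x], and the smallness of [|lam| * h] lets half
    of the left side absorb the term in [lam]. *)
Lemma flow_short_time t h (e0 D : R) : 0 <= t -> 0 <= D -> (E (c t) <= e0%:E)%E ->
  `|lam| * h <= 2^-1 ->
  (forall r, 0 < r -> r <= h -> ((e0 - D)%:E <= E (c (t + r)))%E) ->
  forall r, 0 <= r -> r <= h -> d (c (t + r)) (c t) ^+ 2 <= 4 * r * D.
Proof.
move=> t0 D0 Et lh Hl r r0 rh.
have [ew Ew ewe] := energy_real Eb _ _ Et.
have [x [x0 xr Mx]] := flow_radius_max t r (c t) t0 r0.
set M := d (c (t + x)) (c t) in Mx.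
have M0 : 0 <= M by exact: dist_ge0.
have l0 := normr_ge0 lam.
have := evi_integrated t x (c t) ew (D + `|lam| / 2 * M ^+ 2) 0 t0 x0 Ew.
rewrite (distxx dM) -/M => H.
have {}H : M ^+ 2 / 2 <= 0 ^+ 2 / 2 + (D + `|lam| / 2 * M ^+ 2) * x + 0 * x ^+ 2 / 2.
  apply: H => u u0 ux.
  have := Hl u u0 ltac:(lra); case eu : (E (c (t + u))) => [b| |].
  - rewrite -!EFinD !lee_fin => eb.
    have ur : u <= r by lra.
    have := Mx u (ltW u0) ur; have := dist_ge0 dM (c (t + u)) (c t).
    set a := d _ _ => a0 aM.
    have aa : a ^+ 2 <= M ^+ 2 by nra.
    have : - lam * a ^+ 2 <= `|lam| * M ^+ 2.
      have : - lam <= `|lam| by rewrite -normrN ler_norm.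
      have := sqr_ge0 a; nra.
    lra.
  - by move=> _; rewrite addey// addye// leey.
  - by have := Eb (c (t + u)); rewrite eu ltxx.
have lx : `|lam| * x <= 2^-1 by have : `|lam| * x <= `|lam| * h by [nra]; lra.
have MM : `|lam| * x * M ^+ 2 <= 2^-1 * M ^+ 2 by rewrite ler_wpM2r// sqr_ge0.
have Dx : D * x <= D * r by nra.
have : M ^+ 2 <= 4 * r * D by lra.
apply: le_trans; have := Mx r r0 (lexx r); have := dist_ge0 dM (c (t + r)) (c t); nra.
Qed.

(** The variational inequality sees the energy only at almost every time. Instead, let [x] be the
    last time up to [s] with energy at most [C], attained by lower semicontinuity. Just after [x]
    the energy would stay above [C], so [flow_short_time] with [D = 0] would freeze the flow at
    [c x], whose energy is at most [C]. *)
Lemma energy_nonincreasing t s (C : R) : 0 <= t -> t <= s -> (E (c t) <= C%:E)%E ->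
  (E (c s) <= C%:E)%E.
Proof.
move=> t0 ts EtC; rewrite leNgt; apply/negP => Cs.
pose Z := [set u | [/\ t <= u, u <= s & (E (c u) <= C%:E)%E]].
have Zt : Z t by [].
have hZ : has_sup Z by split; [exists t|exists s => u []].
pose x := sup Z.
have tx : t <= x by apply: ub_le_sup => //; exact: hZ.2.
have xs : x <= s by apply: ge_sup; [exact: hZ.1|move=> u []].
have x0 : 0 <= x by lra.
have Ex : (E (c x) <= C%:E)%E.
  rewrite leNgt; apply/negP => /Elsc[r [r0 H]].
  have [q q0 Hq] := flow_continuous _ x0 _ r0.
  have [u [tu us Eu] xu] := @sup_adherent _ Z _ q0 hZ.
  have ux : u <= x by apply: ub_le_sup; [exact: hZ.2|].
  have u0 : 0 <= u by lra.
  have uq : `|u - x| < q by rewrite -/x in xu; rewrite ltr_norml; lra.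
  have := H (c u); rewrite (dist_sym dM) => /(_ (Hq u u0 uq)).
  by rewrite ltNge Eu.
have xs' : x < s.
  by rewrite lt_neqAle xs andbT; apply/eqP => e; move: Cs; rewrite -e ltNge Ex.
have l0 := normr_ge0 lam.
have l1 : 0 < 2 * (`|lam| + 1) by lra.
pose h := Num.min (s - x) (2 * (`|lam| + 1))^-1.
have h0 : 0 < h by rewrite lt_min invr_gt0 l1 andbT; lra.
have hs : h <= s - x by rewrite ge_min lexx.
have lh : `|lam| * h <= 2^-1.
  have : h * (2 * (`|lam| + 1)) <= 1.
    by rewrite -ler_pdivlMr// mul1r /h ge_min lexx orbT.
  nra.
have above r : 0 < r -> r <= h -> (C%:E < E (c (x + r)))%E.
  move=> r0 rh; rewrite ltNge; apply/negP => Er.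
  have : Z (x + r) by split => //; lra.
  by move=> Zr; have : x + r <= x by [apply: ub_le_sup; [exact: hZ.2|]]; lra.
have := flow_short_time x h C 0 x0 (lexx 0) Ex lh _ h (ltW h0) (lexx h).
rewrite mulr0 => H.
have {}H : d (c (x + h)) (c x) ^+ 2 <= 0.
  by apply: H => r r0 rh; rewrite subr0 ltW// above.
have : d (c (x + h)) (c x) = 0 by have := dist_ge0 dM (c (x + h)) (c x); nra.
move=> /(dist_eq0 dM) e; have := above h h0 (lexx h).
by rewrite e ltNge Ex.
Qed.

(** The variational inequality at one earlier time, tested at a point of finite energy, gives finite
    energy there; monotonicity carries it to [t]. *)
Lemma flow_energy_finite t : 0 < t -> exists e : R, E (c t) = e%:E.
Proof.
move=> t0; have [w [wD _]] := y0D 1 ltr01.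
have [ew Ew] : exists ew : R, E w = ew%:E.
  by move: wD (Eb w); rewrite /domE; case: (E w) => // e _ _; exists e.
have [_ [_ /(_ w) EV]] := GF.
have [s [s0 st /(_ s0)[_]]] := ae_exists _ _ _ t0 EV.
rewrite Ew; case es : (E (c s)) => [b| |].
- move=> _; have Es : (E (c s) <= b%:E)%E by rewrite es.
  have := energy_nonincreasing s t b (ltW s0) (ltW st) Es.
  by move=> /(energy_real Eb)[e -> _]; exists e.
- by rewrite addey// addye// leye_eq.
- by have := Eb (c s); rewrite es ltxx.
Qed.

Lemma energy_fine t : 0 < t -> E (c t) = (fine (E (c t)))%:E.
Proof. by move=> /flow_energy_finite[e ->]. Qed.

Lemma energy_fine_mono s t : 0 < s -> s <= t -> fine (E (c t)) <= fine (E (c s)).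
Proof.
move=> s0 st; have t0 : 0 < t by lra.
have Es : (E (c s) <= (fine (E (c s)))%:E)%E by rewrite -energy_fine.
have := energy_nonincreasing s t _ (ltW s0) st Es.
by rewrite {1}(energy_fine _ t0) lee_fin.
Qed.

(** On the interval the energy is smallest at the final time, which supplies a constant bound for
    [evi_integrated]. *)
Lemma evi_energy s h w (Q : R) : 0 < s -> 0 <= h -> E w = (fine (E w))%:E ->
  (forall r, 0 <= r -> r <= h -> d (c (s + r)) w ^+ 2 <= Q) ->
  d (c (s + h)) w ^+ 2 <= d (c s) w ^+ 2 + 2 * h * (fine (E w) - fine (E (c (s + h))))
    + h * `|lam| * Q.
Proof.
move=> s0 h0 Ew HQ.
have := evi_integrated s h w (fine (E w))
  (fine (E w) - fine (E (c (s + h))) + `|lam| / 2 * Q) 0 (ltW s0) h0 Ew.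
move=> H; have {}H := H _; suff : d (c (s + h)) w ^+ 2 / 2 <= d (c s) w ^+ 2 / 2 +
  (fine (E w) - fine (E (c (s + h))) + `|lam| / 2 * Q) * h + 0 * h ^+ 2 / 2 by lra.
apply: H => r r0 rh.
have sr : 0 < s + r by lra.
rewrite (energy_fine _ sr) -!EFinD lee_fin.
have srh : s + r <= s + h by lra.
have := energy_fine_mono _ _ sr srh; have := HQ r (ltW r0) (ltW rh).
have := sqr_ge0 (d (c (s + r)) w); set q := _ ^+ 2 => q0 qQ.
have : - lam * q <= `|lam| * Q.
  have : - lam <= `|lam| by rewrite -normrN ler_norm.
  have := normr_ge0 lam; nra.
lra.
Qed.

Lemma flow_holder s r h : 0 < s -> 0 <= r -> r <= h -> `|lam| * h <= 2^-1 ->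
  d (c (s + r)) (c s) ^+ 2 <= 4 * r * (fine (E (c s)) - fine (E (c (s + h)))).
Proof.
move=> s0 r0 rh lh.
have sh : s <= s + h by lra.
have D0 := energy_fine_mono _ _ s0 sh.
have Es : (E (c s) <= (fine (E (c s)))%:E)%E by rewrite -energy_fine.
apply: (flow_short_time s h (fine (E (c s))) _ (ltW s0) _ Es lh) => //; first by lra.
move=> u u0 uh; have su : 0 < s + u by lra.
rewrite (energy_fine _ su) lee_fin.
have : s + u <= s + h by lra.
by move=> /(energy_fine_mono _ _ su); lra.
Qed.

(* One step of size [del] of the comparison of the flow with its time shift: the energy
   terms of the two variational inequalities telescope along a partition. *)
Lemma shift_step t del h (M2 D : R) : 0 < t -> 0 <= del -> 0 <= h -> `|lam| * del <= 2^-1 ->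
  fine (E (c t)) - fine (E (c (t + del))) <= D ->
  (forall r, 0 <= r -> r <= del -> d (c (t + r)) (c (t + r + h)) ^+ 2 <= M2) ->
  d (c (t + del)) (c (t + del + h)) ^+ 2 <= d (c t) (c (t + h)) ^+ 2
    + 2 * del * (fine (E (c (t + h))) - fine (E (c (t + del + h))))
    + 2 * del * `|lam| * (2 * M2 + 8 * del * D).
Proof.
move=> t0 del0 h0 ldel ED HM.
have th : 0 < t + h by lra.
have td : 0 < t + del by lra.
have sq a b e : 0 <= a -> a <= b + e -> a ^+ 2 <= 2 * b ^+ 2 + 2 * e ^+ 2 :> R.
  by move=> a0 ab; have := sqr_ge0 (b - e); nra.
have D0 : 0 <= D.
  by have : t <= t + del by [lra]; move=> /(energy_fine_mono _ _ t0); lra.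
have hol r : 0 <= r -> r <= del -> d (c (t + r)) (c t) ^+ 2 <= 4 * del * D.
  move=> r0 rd; apply: le_trans (flow_holder t r del t0 r0 rd ldel) _.
  have : 0 <= fine (E (c t)) - fine (E (c (t + del))).
    by have : t <= t + del by [lra]; move=> /(energy_fine_mono _ _ t0); lra.
  nra.
have H1 := evi_energy t del (c (t + h)) (2 * M2 + 8 * del * D) t0 del0 (energy_fine _ th).
have {}H1 : d (c (t + del)) (c (t + h)) ^+ 2 <= d (c t) (c (t + h)) ^+ 2 +
    2 * del * (fine (E (c (t + h))) - fine (E (c (t + del)))) + del * `|lam| * (2 * M2 + 8 * del * D).
  apply: H1 => r r0 rd.
  have := sq _ _ _ (dist_ge0 dM (c (t + r)) (c (t + h))) (dist_tri dM (c t) (c (t + r)) (c (t + h))).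
  have := hol r r0 rd; have := HM 0 (lexx 0) del0; rewrite addr0; lra.
have H2 := evi_energy (t + h) del (c (t + del)) (2 * M2 + 8 * del * D) th del0 (energy_fine _ td).
have {}H2 : d (c (t + h + del)) (c (t + del)) ^+ 2 <= d (c (t + h)) (c (t + del)) ^+ 2 +
    2 * del * (fine (E (c (t + del))) - fine (E (c (t + h + del)))) + del * `|lam| * (2 * M2 + 8 * del * D).
  apply: H2 => r r0 rd.
  have := sq _ _ _ (dist_ge0 dM (c (t + h + r)) (c (t + del)))
    (dist_tri dM (c (t + r)) (c (t + h + r)) (c (t + del))).
  have := HM r r0 rd; rewrite (dist_sym dM (c (t + r)) (c (t + r + h))).
  have -> : t + r + h = t + h + r by ring.
  have tr : 0 < t + r by lra.
  have dr : 0 <= del - r by lra.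
  have ldr : `|lam| * (del - r) <= 2^-1 by have := normr_ge0 lam; nra.
  have := flow_holder (t + r) (del - r) (del - r) tr dr (lexx _) ldr.
  have -> : t + r + (del - r) = t + del by ring.
  rewrite (dist_sym dM (c (t + del)) (c (t + r))).
  have e1 : fine (E (c (t + r))) <= fine (E (c t)) by apply: energy_fine_mono => //; lra.
  have e2 : fine (E (c (t + del))) <= fine (E (c (t + r))) by apply: energy_fine_mono => //; lra.
  have : (del - r) * (fine (E (c (t + r))) - fine (E (c (t + del)))) <= del * D.
    by apply: ler_pM; lra.
  lra.
have e3 : t + del + h = t + h + del by ring.
rewrite e3 (dist_sym dM (c (t + del)) (c (t + h + del))).
rewrite (dist_sym dM (c (t + h)) (c (t + del))) in H2.
lra.
Qed.

(** [shift_step] is summed over equal steps up to the time [x] of largest distance [M]. The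
    telescoped energy is multiplied by the step length and disappears in the limit; the terms in
    [lam] amount in the limit to at most half of [M ^+ 2], whence the factor [2]. *)
Lemma flow_contraction p q h : 0 < p -> p <= q -> 0 <= h -> `|lam| * (q - p) <= 8^-1 ->
  d (c q) (c (q + h)) ^+ 2 <= 2 * d (c p) (c (p + h)) ^+ 2.
Proof.
move=> p0 pq h0 lpq.
have [x [px xq Mx]] : exists x, [/\ p <= x, x <= q &
    forall s, p <= s -> s <= q -> d (c s) (c (s + h)) <= d (c x) (c (x + h))].
  apply: (@flow_dist_max (fun s => d (c s) (c (s + h)))) => // s ps e e0.
  have e2 : 0 < e / 2 by lra.
  have s0 : 0 <= s by lra.
  have sh0 : 0 <= s + h by lra.
  have [r1 r10 H1] := flow_continuous _ s0 _ e2.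
  have [r2 r20 H2] := flow_continuous _ sh0 _ e2.
  exists (Num.min r1 r2); first by rewrite lt_min r10.
  move=> u pu; rewrite lt_min => /andP[u1 u2].
  have := H1 u ltac:(lra) u1; have := H2 (u + h) ltac:(lra).
  have -> : u + h - (s + h) = u - s by ring.
  move=> /(_ u2).
  have := dist_tri dM (c s) (c u) (c (u + h)); have := dist_tri dM (c (s + h)) (c s) (c (u + h)).
  have := dist_tri dM (c u) (c s) (c (s + h)); have := dist_tri dM (c (u + h)) (c u) (c (s + h)).
  rewrite (dist_sym dM (c s) (c u)) (dist_sym dM (c (s + h)) (c (u + h))).
  by rewrite ltr_norml; lra.
set M := d (c x) (c (x + h)) in Mx.
have M0 : 0 <= M by exact: dist_ge0.
suff : M ^+ 2 <= 2 * d (c p) (c (p + h)) ^+ 2.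
  have := Mx q pq (lexx q); have := dist_ge0 dM (c q) (c (q + h)); nra.
have l0 := normr_ge0 lam.
pose ef t := fine (E (c t)).
have xh : p <= x + h by lra.
pose D := ef p - ef (x + h).
have D0 : 0 <= D by have := energy_fine_mono _ _ p0 xh; rewrite /D /ef; lra.
have part n : M ^+ 2 <= 2 * d (c p) (c (p + h)) ^+ 2 + 8 * D * ((x - p) / n.+1%:R).
  set del := (x - p) / n.+1%:R.
  have n0 : 0 < n.+1%:R :> R by rewrite ltr0Sn.
  have del0 : 0 <= del by apply: divr_ge0; [lra|exact: ltW].
  have delE : del * n.+1%:R = x - p by rewrite divfK// gt_eqF.
  have n1 : 1 <= n.+1%:R :> R by rewrite ler1n.
  have delx : del <= x - p by nra.
  have ldel : `|lam| * del <= 2^-1.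
    have : `|lam| * del <= `|lam| * (q - p) by rewrite ler_wpM2l//; lra.
    lra.
  have ind k : (k <= n.+1)%N -> d (c (p + k%:R * del)) (c (p + k%:R * del + h)) ^+ 2 <=
      d (c p) (c (p + h)) ^+ 2 + 2 * del * (ef (p + h) - ef (p + k%:R * del + h))
      + k%:R * (2 * del * `|lam| * (2 * M ^+ 2 + 8 * del * D)).
    elim: k => [|k IH] kn; first by rewrite !mul0r !addr0 subrr mulr0 addr0.
    have {}IH := IH (ltnW kn).
    have kd0 : 0 <= k%:R * del by rewrite mulr_ge0.
    have kn' : k.+1%:R <= n.+1%:R :> R by rewrite ler_nat.
    have kdx : k.+1%:R * del <= x - p by rewrite -delE mulrC ler_wpM2l.
    have kS : k.+1%:R * del = k%:R * del + del by rewrite -addn1 natrD mulrDl mul1r.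
    rewrite kS in kdx *; rewrite addrA.
    have t0 : 0 < p + k%:R * del by lra.
    have tde : fine (E (c (p + k%:R * del))) - fine (E (c (p + k%:R * del + del))) <= D.
      have a1 : fine (E (c (p + k%:R * del))) <= ef p by apply: energy_fine_mono => //; lra.
      have a2 : ef (x + h) <= fine (E (c (p + k%:R * del + del))) by apply: energy_fine_mono; lra.
      by rewrite /D; lra.
    have := shift_step (p + k%:R * del) del h (M ^+ 2) D t0 del0 h0 ldel tde.
    have HM r : 0 <= r -> r <= del -> d (c (p + k%:R * del + r)) (c (p + k%:R * del + r + h)) ^+ 2 <= M ^+ 2.
      move=> r0 rd; have := Mx (p + k%:R * del + r) ltac:(lra) ltac:(lra).
      by have := dist_ge0 dM (c (p + k%:R * del + r)) (c (p + k%:R * del + r + h)); nra.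
    have kS1 : k.+1%:R = k%:R + 1 :> R by rewrite natr1.
    move=> /(_ HM); rewrite -!/(ef _) kS1.
    by move: IH; move: (k%:R) => K; lra.
  have := ind n.+1 (leqnn _).
  have -> : p + n.+1%:R * del = x by rewrite mulrC delE; ring.
  rewrite -/M.
  have h1 : ef (p + h) - ef (x + h) <= D.
    by have := energy_fine_mono p (p + h) p0; rewrite /D /ef => H; have := H ltac:(lra); lra.
  have h2 : 2 * del * (ef (p + h) - ef (x + h)) <= 2 * del * D by rewrite ler_wpM2l//; lra.
  have -> : n.+1%:R * (2 * del * `|lam| * (2 * M ^+ 2 + 8 * del * D))
    = 2 * (`|lam| * (del * n.+1%:R)) * (2 * M ^+ 2 + 8 * del * D) by ring.
  rewrite delE.
  have h3 : `|lam| * (x - p) <= 8^-1.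
    by have : `|lam| * (x - p) <= `|lam| * (q - p) by [rewrite ler_wpM2l//; lra]; lra.
  have h4 : 0 <= 2 * M ^+ 2 + 8 * del * D.
    by have := sqr_ge0 M; have : 0 <= del * D by [rewrite mulr_ge0]; lra.
  have h5 : 2 * (`|lam| * (x - p)) * (2 * M ^+ 2 + 8 * del * D) <= 2 * 8^-1 * (2 * M ^+ 2 + 8 * del * D).
    by rewrite ler_wpM2r//; lra.
  lra.
apply: le_of_eps => e e0.
have xp : 0 <= D * (x - p) by rewrite mulr_ge0//; lra.
have den : 0 < 8 * D * (x - p) + 1 by lra.
have eden : 0 < e / (8 * D * (x - p) + 1) by exact: divr_gt0.
have [N HN] := invn_small _ eden.
have := part N; have := HN N (leqnn N).
rewrite ltr_pdivlMr//.
have -> : 8 * D * ((x - p) / N.+1%:R) = N.+1%:R^-1 * (8 * D * (x - p)) by ring.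
have : 0 <= N.+1%:R^-1 :> R by rewrite invr_ge0 ler0n.
move: (N.+1%:R^-1) => v; lra.
Qed.

(** By [flow_contraction] the last increment is controlled by every earlier one of the same length,
    and by [flow_holder] each of these is paid for by its own energy drop. Averaging over [n.+1]
    increments telescopes the drops; steps [tau / n.+1%:R] are used so that they tile the interval
    exactly. *)
Lemma flow_left_lipschitz t : 0 < t -> exists C tau, [/\ 0 <= C, 0 < tau, tau < t &
  forall n : nat, d (c (t - tau / n.+1%:R)) (c t) <= C * (tau / n.+1%:R)].
Proof.
move=> t0; have l0 := normr_ge0 lam.
have l1 : 0 < 8 * (`|lam| + 1) by lra.
pose tau := Num.min (t / 2) (8 * (`|lam| + 1))^-1.
have tau0 : 0 < tau by rewrite lt_min invr_gt0 l1 andbT; lra.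
have taut : tau <= t / 2 by rewrite ge_min lexx.
have ltau : `|lam| * tau <= 8^-1.
  have : tau * (8 * (`|lam| + 1)) <= 1.
    by rewrite -ler_pdivlMr// mul1r /tau ge_min lexx orbT.
  nra.
pose ef s := fine (E (c s)).
pose Del := ef (t - tau) - ef t.
have p0 : 0 < t - tau by lra.
have Del0 : 0 <= Del.
  by have : t - tau <= t by [lra]; move=> /(energy_fine_mono _ _ p0); rewrite /Del /ef; lra.
pose C := Num.sqrt (8 * Del / tau).
have C0 : 0 <= C by exact: sqrtr_ge0.
have C2 : C ^+ 2 * tau = 8 * Del.
  rewrite sqr_sqrtr; first by rewrite divfK// gt_eqF.
  by rewrite divr_ge0 ?(ltW tau0)//; lra.
exists C, tau; split => //; first by lra.
move=> n; set h := tau / n.+1%:R.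
have n0 : 0 < n.+1%:R :> R by rewrite ltr0Sn.
have h0 : 0 < h by rewrite divr_gt0.
have hE : h * n.+1%:R = tau by rewrite divfK// gt_eqF.
have n1 : 1 <= n.+1%:R :> R by rewrite ler1n.
have htau : h <= tau by nra.
set X := d (c (t - h)) (c t).
have X0 : 0 <= X by exact: dist_ge0.
have ind k : (k <= n.+1)%N -> k%:R * X ^+ 2 <= 8 * h * (ef (t - tau) - ef (t - tau + k%:R * h)).
  elim: k => [|k IH] kn; first by rewrite !mul0r addr0 subrr mulr0.
  have {}IH := IH (ltnW kn).
  have kn' : k.+1%:R <= n.+1%:R :> R by rewrite ler_nat.
  have kS : k.+1%:R * h = k%:R * h + h by rewrite -addn1 natrD mulrDl mul1r.
  have kdx : k.+1%:R * h <= tau by rewrite -hE mulrC ler_wpM2l// ltW.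
  have kh0 : 0 <= k%:R * h by rewrite mulr_ge0// ltW.
  rewrite kS in kdx *.
  pose p := t - tau + k%:R * h.
  have pp : 0 < p by rewrite /p; lra.
  have pq : p <= t - h by rewrite /p; lra.
  have lq : `|lam| * (t - h - p) <= 8^-1.
    by apply: le_trans ltau; rewrite ler_wpM2l// /p; lra.
  have := flow_contraction p (t - h) h pp pq (ltW h0) lq.
  rewrite subrK -/X => c1.
  have lh : `|lam| * h <= 2^-1.
    by have : `|lam| * h <= `|lam| * tau by [rewrite ler_wpM2l]; lra.
  have := flow_holder p h h pp (ltW h0) (lexx h) lh.
  rewrite (dist_sym dM) -!/(ef _) addrA -/p => c2.
  rewrite -addn1 natrD; move: IH; rewrite -/p; move: (k%:R) => K IH; lra.
have := ind n.+1 (leqnn _).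
have -> : t - tau + n.+1%:R * h = t by rewrite mulrC hE; ring.
rewrite -/Del => H.
have HX : tau * X ^+ 2 <= tau * (C * h) ^+ 2.
  have -> : tau * (C * h) ^+ 2 = (C ^+ 2 * tau) * h ^+ 2 by ring.
  rewrite C2 -{1}hE -mulrA.
  have -> : 8 * Del * h ^+ 2 = h * (8 * h * Del) by ring.
  by rewrite ler_pM2l.
move: HX; rewrite ler_pM2l// => HX.
have : 0 <= C * h by rewrite mulr_ge0// ltW.
nra.
Qed.

(** On an interval ending at [t] the energy is smallest at [t]. Testing with any [w] thus bounds
    [E (c t) - E w] by an increment of squared distance over [h], controlled by the left Lipschitz
    constant [C]. The extra [1] in [C + 1] absorbs the term in [lam] on the chosen ball. *)
Lemma flow_slope_finite t : 0 < t -> (slope d E (c t) < +oo)%E.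
Proof.
move=> t0; have [C [tau [C0 tau0 taut HC]]] := flow_left_lipschitz _ t0.
have l0 := normr_ge0 lam.
have Et := energy_fine _ t0.
have l1 : 0 < `|lam| + 1 by lra.
apply: (@le_lt_trans _ _ (C + 1)%:E); last exact: ltry.
apply: (slope_upper_bound Eb Et _ (`|lam| + 1)^-1); [by rewrite invr_gt0|by lra|].
move=> w; rewrite -[(`|lam| + 1)^-1]mul1r ltr_pdivlMr// => wr.
case ew : (E w) => [b| |]; [|by rewrite leey|by have := Eb w; rewrite ew ltxx].
rewrite lee_fin; set D := d (c t) w in wr *.
have D0 : 0 <= D by exact: dist_ge0.
suff : fine (E (c t)) - b <= C * D + `|lam| / 2 * D ^+ 2.
  by have : `|lam| * D ^+ 2 <= D by [nra]; lra.
apply: le_of_eps => eta eta0.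
pose B := C ^+ 2 * tau + `|lam| * (2 * D + 1) + 1.
have B0 : 0 < B.
  by rewrite /B; have : 0 <= C ^+ 2 * tau by [rewrite mulr_ge0 ?sqr_ge0// ltW]; nra.
pose e := Num.min 1 (eta / B).
have e0 : 0 < e by rewrite lt_min ltr01 divr_gt0.
have e1 : e <= 1 by rewrite ge_min lexx.
have eB : e * B <= eta by rewrite -ler_pdivlMr// ge_min lexx orbT.
have [r r0 Hr] := flow_continuous _ (ltW t0) _ e0.
have rt : 0 < Num.min (r / tau) e by rewrite lt_min divr_gt0.
have [N /(_ N (leqnn N))] := @invn_small R _ rt.
rewrite lt_min ltr_pdivlMr// => /andP[N1 N2].
have := HC N; set h := tau / N.+1%:R.
have iN0 : 0 < N.+1%:R^-1 :> R by rewrite invr_gt0 ltr0Sn.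
have iN1 : N.+1%:R^-1 <= 1 :> R by rewrite invf_le1// ler1n.
have h0 : 0 < h by rewrite divr_gt0.
have htau : h <= tau by rewrite /h ler_piMr// ltW.
have hr : h < r by rewrite /h mulrC.
have he : h <= tau * e by rewrite /h ler_pM2l// ltW.
move=> Ch.
have th : 0 < t - h by lra.
have Ew : E w = (fine (E w))%:E by rewrite ew.
have := evi_energy (t - h) h w ((D + e) ^+ 2) th (ltW h0) Ew.
rewrite subrK ew/= -/D => H.
have {}H : D ^+ 2 <= d (c (t - h)) w ^+ 2 + 2 * h * (b - fine (E (c t))) + h * `|lam| * (D + e) ^+ 2.
  apply: H => u u0 uh.
  have ur : `|t - h + u - t| < r by rewrite ltr_norml; lra.
  have tu0 : 0 <= t - h + u by lra.
  have := Hr _ tu0 ur; have := dist_tri dM (c t) (c (t - h + u)) w.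
  by have := dist_ge0 dM (c (t - h + u)) w; rewrite -/D; nra.
have tri := dist_tri dM (c t) (c (t - h)) w; rewrite -/D in tri.
have g0 := dist_ge0 dM (c (t - h)) w.
have : d (c (t - h)) w ^+ 2 <= D ^+ 2 + h * (2 * C * D + C ^+ 2 * h).
  have : d (c (t - h)) w <= D + C * h by lra.
  by move=> ?; have : 0 <= C * h by [rewrite mulr_ge0// ltW]; nra.
move=> F.
have : h * (2 * (fine (E (c t)) - b)) <= h * (2 * C * D + C ^+ 2 * h + `|lam| * (D + e) ^+ 2) by lra.
rewrite ler_pM2l// => G.
have G1 : C ^+ 2 * h <= C ^+ 2 * tau * e.
  by rewrite -mulrA ler_wpM2l// sqr_ge0.
have G2 : `|lam| * (D + e) ^+ 2 <= `|lam| * D ^+ 2 + `|lam| * (2 * D + 1) * e.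
  have : (D + e) ^+ 2 <= D ^+ 2 + (2 * D + 1) * e by nra.
  by move=> /(ler_wpM2l l0); lra.
rewrite /B in eB; lra.
Qed.

(** A bootstrap. The crude constant [A0], with the factor [4] of [flow_short_time], makes the
    supremum [A] of the quotients finite. The slope then bounds the energy drop at time [u] by
    [(S + ep) * A * u], and the variational inequality returns [A ^+ 2 <= k1], which forces
    [A <= S + eps] for small [h]. *)
Lemma flow_speed_bound s S (e0 eps : R) : 0 <= s -> E (c s) = e0%:E -> 0 <= S ->
  slope d E (c s) = S%:E -> 0 < eps ->
  exists2 h, 0 < h & forall r, 0 < r -> r < h -> d (c (s + r)) (c s) <= (S + eps) * r.
Proof.
move=> s0 Es S0 SE eps0.
pose ep := eps / 2.
have ep0 : 0 < ep by rewrite /ep; lra.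
have [del del0 low] := slope_lower_bound dM Eb Es _ SE _ ep0.
have [r1 r10 Hc] := flow_continuous _ s0 _ del0.
have l0 := normr_ge0 lam.
pose A0 := 4 * (S + ep).
have A00 : 0 < A0 by rewrite /A0; lra.
have l1 : 0 < 2 * (`|lam| + 1) by lra.
have l2 : 0 < `|lam| * A0 + 1 by nra.
pose h := Num.min (r1 / 2) (Num.min (2 * (`|lam| + 1))^-1 (ep / (`|lam| * A0 + 1))).
have h0 : 0 < h.
  rewrite !lt_min; apply/andP; split; first by lra.
  by rewrite invr_gt0 l1 divr_gt0.
have hr1 : h <= r1 / 2 by rewrite ge_min lexx.
have lh : `|lam| * h <= 2^-1.
  have : h * (2 * (`|lam| + 1)) <= 1.
    by rewrite -ler_pdivlMr// mul1r /h !ge_min lexx !orbT.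
  nra.
have hA : h * (`|lam| * A0 + 1) <= ep by rewrite -ler_pdivlMr// !ge_min lexx !orbT.
pose dr r := d (c (s + r)) (c s).
have dr0 r : 0 <= dr r by exact: dist_ge0.
have low' r : 0 <= r -> r <= h -> ((e0 - (S + ep) * dr r)%:E <= E (c (s + r)))%E.
  move=> r0 rh; rewrite /dr (dist_sym dM); apply: low; rewrite (dist_sym dM).
  apply: Hc; first by lra.
  by rewrite addrC addKr ger0_norm//; lra.
have C1 r : 0 <= r -> r <= h -> dr r <= A0 * r.
  move=> r0 rh.
  have [x [x0 xr Mx]] := flow_radius_max s r (c s) s0 r0; rewrite -!/(dr _) in Mx.
  have Es' : (E (c s) <= e0%:E)%E by rewrite Es.
  have SM : 0 <= (S + ep) * dr x by rewrite mulr_ge0//; lra.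
  have lr : `|lam| * r <= 2^-1 by have : `|lam| * r <= `|lam| * h by [rewrite ler_wpM2l]; lra.
  have := flow_short_time s r e0 ((S + ep) * dr x) s0 SM Es' lr.
  rewrite -!/(dr _) => H.
  have {}H : dr x ^+ 2 <= 4 * x * ((S + ep) * dr x).
    apply: H => // u u0 ur; apply: le_trans (low' u (ltW u0) ltac:(lra)).
    rewrite lee_fin lerD2l lerN2 ler_pM2l; [exact: Mx (ltW u0) ur|lra].
  have := Mx r r0 (lexx r); have := dr0 x => X0 rx; apply: le_trans rx _.
  have : dr x <= A0 * x.
    have [X|X] := eqVneq (dr x) 0; first by rewrite X mulr_ge0// ltW.
    have Xp : 0 < dr x by rewrite lt_def X.
    by rewrite -(ler_pM2l Xp) /A0; lra.
  by move=> ?; have : A0 * x <= A0 * r by [rewrite ler_pM2l]; lra.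
pose Q := [set dr r / r | r in [set r | 0 < r /\ r <= h]].
have hQ : has_sup Q.
  split; first by exists (dr h / h), h => //=; split.
  exists A0 => _ [r /= [r0 rh] <-]; rewrite ler_pdivrMr//; exact: C1 (ltW r0) rh.
pose A := sup Q.
have AQ r : 0 < r -> r <= h -> dr r <= A * r.
  move=> r0 rh; rewrite -ler_pdivrMr//; apply: ub_le_sup; first exact: hQ.2.
  by exists r.
have AA0 : A <= A0.
  apply: ge_sup; first exact: hQ.1.
  by move=> _ [r /= [r0 rh] <-]; rewrite ler_pdivrMr//; exact: C1 (ltW r0) rh.
have Ap : 0 <= A.
  apply: le_trans (_ : 0 <= dr h / h) _; first by rewrite divr_ge0// ltW.
  by apply: ub_le_sup; [exact: hQ.2|exists h].
pose k1 := (S + ep) * A + `|lam| / 2 * A ^+ 2 * h.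
have k10 : 0 <= k1.
  by apply: addr_ge0; [apply: mulr_ge0 => //; lra|apply: mulr_ge0; [apply: mulr_ge0; [lra|exact: sqr_ge0]|exact: ltW]].
have C2 r : 0 < r -> r <= h -> dr r ^+ 2 <= k1 * r ^+ 2.
  move=> r0 rh; have := evi_integrated s r (c s) e0 0 k1 s0 (ltW r0) Es.
  rewrite (distxx dM) -/(dr r) => H.
  suff : dr r ^+ 2 / 2 <= 0 ^+ 2 / 2 + 0 * r + k1 * r ^+ 2 / 2 by lra.
  apply: H => u u0 ur.
  have uh : u <= h by lra.
  have := low' u (ltW u0) uh; case eu : (E (c (s + u))) => [b| |].
  - rewrite -!EFinD !lee_fin -/(dr u) => lb.
    have du := AQ u u0 uh.
    have h1 : (S + ep) * dr u <= (S + ep) * (A * u) by rewrite ler_pM2l//; lra.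
    have h2 : dr u ^+ 2 <= A ^+ 2 * h * u.
      have : dr u ^+ 2 <= (A * u) ^+ 2 by have := dr0 u; nra.
      have : (A * u) ^+ 2 <= A ^+ 2 * h * u.
        have -> : (A * u) ^+ 2 = A ^+ 2 * (u * u) by ring.
        have -> : A ^+ 2 * h * u = A ^+ 2 * (h * u) by ring.
        by rewrite ler_wpM2l ?sqr_ge0// ler_pM2r.
      lra.
    have h3 : - lam * dr u ^+ 2 <= `|lam| * (A ^+ 2 * h * u).
      have : - lam <= `|lam| by rewrite -normrN ler_norm.
      have := sqr_ge0 (dr u); nra.
    by rewrite /k1; lra.
  - by move=> _; rewrite addey// addye// leey.
  - by have := Eb (c (s + u)); rewrite eu ltxx.
have AS : A <= S + eps.
  have A2 : A ^+ 2 <= k1.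
    have : A <= Num.sqrt k1.
      apply: ge_sup; first exact: hQ.1.
      move=> _ [r /= [r0 rh] <-]; rewrite ler_pdivrMr//.
      have := C2 r r0 rh; have := sqr_sqrtr k10; have := sqrtr_ge0 k1; have := dr0 r.
      set a := dr r; set b := Num.sqrt k1 => a0 b0 be ab.
      by have : a ^+ 2 <= (b * r) ^+ 2 by [rewrite exprMn be]; have : 0 <= b * r by [rewrite mulr_ge0// ltW]; nra.
    by have := sqr_sqrtr k10; have := sqrtr_ge0 k1; nra.
  rewrite leNgt; apply/negP => lt.
  have Ap' : 0 < A by lra.
  have : A * A <= A * (S + ep + `|lam| / 2 * A * h).
    by move: A2; rewrite /k1; lra.
  rewrite ler_pM2l// => AL.
  have : `|lam| * A * h <= `|lam| * A0 * h by rewrite ler_pM2r// ler_wpM2l.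
  rewrite /ep in hA AL *; lra.
exists h => // r r0 rh; apply: le_trans (AQ r r0 (ltW rh)) _.
by rewrite ler_pM2r.
Qed.

(** The test point [v h] is tied to the final time. The initial half squared distance and the energy
    drop of the flow each contribute about [S ^+ 2 * h ^+ 2 / 2], the decay along [v] about
    [- S ^+ 2 * h ^+ 2]; these cancel, and only multiples of [eta * h ^+ 2] remain. *)
Lemma flow_near_descent s S (e0 eta T : R) v : 0 <= s -> E (c s) = e0%:E -> 0 <= S ->
  slope d E (c s) = S%:E -> 0 < eta -> germ_on d (c s) T S v ->
  (forall t, 0 <= t -> t <= T -> (E (v t) <= (e0 - (S ^+ 2 - eta) * t)%:E)%E) ->
  exists2 h0, 0 < h0 & forall h, 0 < h -> h < h0 ->
    d (c (s + h)) (v h) ^+ 2 <= 3 * eta * h ^+ 2.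
Proof.
move=> s0 Es S0 SE eta0 vG Ev; have [v0 T0 _ _] := vG.
have l0 := normr_ge0 lam.
pose eps := Num.min 1 (eta / (4 * (2 * S + 1))).
have S4 : 0 < 4 * (2 * S + 1) by lra.
have eps0 : 0 < eps by rewrite lt_min ltr01 divr_gt0.
have eps1 : eps <= 1 by rewrite ge_min lexx.
have epsS : eps * (4 * (2 * S + 1)) <= eta by rewrite -ler_pdivlMr// ge_min lexx orbT.
have SS : (S + eps) ^+ 2 <= S ^+ 2 + eta / 4 by nra.
have [h1 h10 speed] := flow_speed_bound _ _ _ _ s0 Es S0 SE eps0.
have [del del0 low] := slope_lower_bound dM Eb Es _ SE _ eps0.
pose P := (2 * S + 1) ^+ 2.
have P0 : 0 <= P by exact: sqr_ge0.
have B0 : 0 < 2 * (`|lam| * P + 1) by nra.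
have S1 : 0 < S + 1 by lra.
pose h0 := Num.min (Num.min h1 T) (Num.min (del / (S + 1)) (eta / (2 * (`|lam| * P + 1)))).
exists h0; first by rewrite !lt_min h10 T0 !divr_gt0.
move=> h hp; rewrite !lt_min => /andP[/andP[hh1 hT] /andP[hd hB]].
move: hd hB; rewrite !ltr_pdivlMr// => hd hB.
have [ew Ew ewb] := energy_real Eb _ _ (Ev h (ltW hp) (ltW hT)).
have dv := germ_on_dist _ _ _ _ vG (ltW hp) (ltW hT).
have := evi_integrated s h (v h) ew (ew - e0 + `|lam| / 2 * (P * h ^+ 2)) ((S + eps) ^+ 2)
  s0 (ltW hp) Ew.
rewrite dv => H.
have {}H : d (c (s + h)) (v h) ^+ 2 / 2 <= (S * h) ^+ 2 / 2
    + (ew - e0 + `|lam| / 2 * (P * h ^+ 2)) * h + (S + eps) ^+ 2 * h ^+ 2 / 2.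
  apply: H => u u0 uh.
  have du := speed u u0 ltac:(lra).
  have d0 := dist_ge0 dM (c (s + u)) (c s).
  have udel : d (c s) (c (s + u)) < del.
    rewrite (dist_sym dM); apply: le_lt_trans du _.
    have : (S + eps) * u <= (S + 1) * h by apply: ler_pM; lra.
    lra.
  have := low _ udel; rewrite (dist_sym dM (c s)).
  case eu : (E (c (s + u))) => [b| |].
  - rewrite -!EFinD !lee_fin => lb.
    have g1 : (S + eps) * d (c (s + u)) (c s) <= (S + eps) ^+ 2 * u.
      by rewrite expr2 -mulrA ler_pM2l//; lra.
    have g2 : d (c (s + u)) (v h) <= (2 * S + 1) * h.
      have := dist_tri dM (c s) (c (s + u)) (v h); rewrite dv.
      have : (S + eps) * u <= (S + 1) * h by apply: ler_pM; lra.
      lra.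
    have g3 : d (c (s + u)) (v h) ^+ 2 <= P * h ^+ 2.
      rewrite /P -exprMn; have := dist_ge0 dM (c (s + u)) (v h).
      by have : 0 <= (2 * S + 1) * h by [rewrite mulr_ge0// ?ltW//; lra]; nra.
    have g4 : - lam * d (c (s + u)) (v h) ^+ 2 <= `|lam| * (P * h ^+ 2).
      have : - lam <= `|lam| by rewrite -normrN ler_norm.
      have := sqr_ge0 (d (c (s + u)) (v h)); nra.
    lra.
  - by move=> _; rewrite addey// addye// leey.
  - by have := Eb (c (s + u)); rewrite eu ltxx.
have hh : 0 < h ^+ 2 by rewrite exprn_gt0.
have k1 : (ew - e0) * h <= - (S ^+ 2 - eta) * h ^+ 2.
  by rewrite expr2 mulrA ler_pM2r//; lra.
have k2 : (S + eps) ^+ 2 * h ^+ 2 <= (S ^+ 2 + eta / 4) * h ^+ 2 by rewrite ler_pM2r.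
have k3 : `|lam| * (P * h ^+ 2) * h <= eta / 2 * h ^+ 2.
  have -> : `|lam| * (P * h ^+ 2) * h = (`|lam| * P * h) * h ^+ 2 by ring.
  by rewrite ler_pM2r//; lra.
have : 0 < eta * h ^+ 2 by exact: mulr_gt0.
rewrite exprMn in H; lra.
Qed.

End Flow.

(* Ekeland's variational principle, localized to a ball on which [E] is bounded below. *)
Lemma slope_finite_dense {R : realType} {Y : Type} {d : Y -> Y -> R} {E : Y -> \bar R} z (ez e : R) :
  is_metric d -> complete_metric d -> (forall y, (-oo < E y)%E) -> lsc d E ->
  E z = ez%:E -> 0 < e ->
  exists w, [/\ d z w < e, domE E w & (slope d E w < +oo)%E].
Proof.
move=> dM cpl Eb Elsc Ez e0.
have zlt : ((ez - 1)%:E < E z)%E by rewrite Ez lte_fin; lra.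
have [r [r0 Hr]] := Elsc _ _ zlt.
pose rho := Num.min r e / 2.
have m0 : 0 < Num.min r e by rewrite lt_min r0.
have rho0 : 0 < rho by rewrite /rho; lra.
have rhor : rho < r by have : Num.min r e <= r by [rewrite ge_min lexx]; rewrite /rho; lra.
have rhoe : rho < e by have : Num.min r e <= e by [rewrite ge_min lexx orbT]; rewrite /rho; lra.
(* Since [E] drops by at most [1] on the ball, this constant keeps the point found within [rho / 2]
   of [z], leaving half the radius for its competitors. *)
pose k := 2 / rho.
have k0 : 0 < k by rewrite divr_gt0.
have kr : k * rho = 2 by rewrite divfK// gt_eqF.
pose f w := fine (E w).
pose G w := d z w <= rho /\ E w = (f w)%:E.
pose F w w' := G w' /\ f w' + k * d w w' <= f w.
have Gz : G z by rewrite /G (distxx dM) /f Ez; split => //; exact: ltW.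
have Gf w : G w -> ez - 1 <= f w.
  by move=> [zw Ew]; rewrite -lee_fin -Ew ltW// Hr//; lra.
have Frefl w : G w -> F w w by move=> Gw; split => //; rewrite (distxx dM) mulr0 addr0.
have Ftrans w w' w'' : F w w' -> F w' w'' -> F w w''.
  move=> [_ h1] [Gw h2]; split => //.
  by have := dist_tri dM w' w w''; rewrite -(ler_pM2l k0); lra.
have next (p : nat * Y) : exists w', G p.2 -> F p.2 w' /\ forall u, F p.2 u -> f w' <= f u + p.1.+1%:R^-1.
  have [Gp|nG] := pselect (G p.2); last by exists z.
  pose A := [set f u | u in F p.2].
  have hA : has_inf A.
    split; first by exists (f p.2), p.2 => //; exact: Frefl.
    by exists (ez - 1) => _ [u [Gu _] <-]; exact: Gf.
  have n0 : 0 < p.1.+1%:R^-1 :> R by rewrite invr_gt0 ltr0Sn.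
  have [_ [w' Fw <-] lt_w] := inf_adherent n0 hA.
  exists w' => _; split => // u Fu; apply: ltW; apply: lt_le_trans lt_w _.
  by rewrite lerD2r; apply: ge_inf; [exact: hA.2|exists u].
have [nx Hnx] := choice next.
pose w := fix w n := if n is m.+1 then nx (m, w m) else z.
have Gw n : G (w n) by elim: n => //= n IH; have [[]] := Hnx (n, w n) IH.
have Fw n : F (w n) (w n.+1) by have [] := Hnx (n, w n) (Gw n).
have wmin n u : F (w n) u -> f (w n.+1) <= f u + n.+1%:R^-1.
  by have [_] := Hnx (n, w n) (Gw n); exact.
have Fwm n m : (n <= m)%N -> F (w n) (w m).
  elim: m => [|m IH]; first by rewrite leqn0 => /eqP->; exact: Frefl.
  rewrite leq_eqVlt => /orP[/eqP->|]; first exact: Frefl.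
  by rewrite ltnS => /IH h; exact: Ftrans h (Fw m).
pose A := [set f (w n) | n in setT].
have hA : has_inf A.
  by split; [exists (f (w 0%N)), 0%N|exists (ez - 1) => _ [n _ <-]; exact: Gf].
have cw : cauchy_seq d w.
  move=> eta eta0; have ke : 0 < k * eta by rewrite mulr_gt0.
  have [_ [N _ <-] HN] := inf_adherent ke hA.
  have ww n m : (N <= n)%N -> (n <= m)%N -> d (w n) (w m) < eta.
    move=> Nn nm; have [_ h1] := Fwm _ _ nm; have [_ h2] := Fwm _ _ Nn.
    have h3 : inf A <= f (w m) by apply: ge_inf; [exact: hA.2|exists m].
    have : k * d (w N) (w n) >= 0 by rewrite mulr_ge0 ?(dist_ge0 dM)// ltW.
    by rewrite -(ltr_pM2l k0); lra.
  exists N => m n Nm Nn; have [mn|/ltnW nm] := leqP m n; first exact: ww.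
  by rewrite (dist_sym dM); exact: ww.
have [l wl] := cpl _ cw.
have zl : d z l <= rho.
  apply: le_of_eps => eta eta0; have [N /(_ N (leqnn N)) HN] := wl _ eta0.
  by have := dist_tri dM (w N) z l; have [] := Gw N; lra.
have El n : (E l <= (f (w n) - k * d (w n) l)%:E)%E.
  rewrite leNgt; apply/negP; set a := f (w n) - _ => al.
  have [b ab bl] : exists2 b, a < b & (b%:E < E l)%E.
    move: al; case: (E l) => [q| |//].
      by rewrite lte_fin => aq; exists ((a + q) / 2); rewrite ?lte_fin; lra.
    by move=> _; exists (a + 1); rewrite ?ltry//; lra.
  have [q [q0 Hq]] := Elsc _ _ bl.
  have eta0 : 0 < Num.min q ((b - a) / (2 * k)) by rewrite lt_min q0 divr_gt0//; lra.
  have [N HN] := wl _ eta0.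
  pose m := maxn n N.
  have := HN m (leq_maxr n N); rewrite lt_min => /andP[d1]; rewrite ltr_pdivlMr; last by lra.
  move=> d2; have := Hq (w m); rewrite (dist_sym dM) => /(_ d1).
  have [_ ->] := Gw m; rewrite lte_fin.
  have [_ h1] := Fwm n m (leq_maxl n N).
  have : k * d (w n) l <= k * d (w n) (w m) + k * d (w m) l.
    by rewrite -mulrDr ler_pM2l//; exact: dist_tri.
  by rewrite /a in ab d2; lra.
have [b bl _] := energy_real Eb _ _ (El 0%N).
have fl : f l = b by rewrite /f bl.
have Fl n : F (w n) l.
  split; first by split => //; rewrite fl.
  by have := El n; rewrite bl lee_fin fl; lra.
(* A violation would make [u] a successor of [l], hence of every [w n]; the vanishing tolerances
   then give [f l <= f u], against the assumed drop. *)
have lmin u : G u -> f l - k * d l u <= f u.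
  move=> Gu; rewrite leNgt; apply/negP => lt_u.
  have Fu : F l u by split => //; lra.
  have lu : f l <= f u.
    apply: le_of_eps => eta eta0; have [N /(_ N (leqnn N)) HN] := @invn_small R _ eta0.
    have := wmin N u (Ftrans _ _ _ (Fl N) Fu); have [_ h] := Fl N.+1.
    have : 0 <= k * d (w N.+1) l by rewrite mulr_ge0 ?(dist_ge0 dM)// ltW.
    by move: (N.+1%:R^-1) HN => v HN; lra.
  have : 0 <= k * d l u by rewrite mulr_ge0 ?(dist_ge0 dM)// ltW.
  lra.
have zl2 : d z l <= rho / 2.
  have [_ h] := Fl 0%N; rewrite /= in h.
  have Gl : G l by split => //; rewrite fl.
  have := Gf l Gl; have : f z = ez by rewrite /f Ez.
  move=> fz; rewrite fz in h => h2.
  have : k * d z l <= k * (rho / 2) by lra.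
  by rewrite ler_pM2l.
exists l; split; first by lra.
  by rewrite /domE bl ltry.
apply: (@le_lt_trans _ _ k%:E); last exact: ltry.
have r2 : 0 < rho / 2 by lra.
apply: (slope_upper_bound Eb bl k _ r2 (ltW k0)) => u lu.
case eu : (E u) => [q| |]; [|by rewrite leey|by have := Eb u; rewrite eu ltxx].
have Gu : G u.
  by split; [have := dist_tri dM l z u; lra|rewrite /f eu].
by have := lmin u Gu; rewrite fl /f eu lee_fin.
Qed.

(** * Elements of minimal norm and convergence of the incremental quotients *)

Section Main.
Context {R : realType} {Y : Type} {d : Y -> Y -> R} {kappa lam : R} {E : Y -> \bar R}.
Hypotheses (HCAT : locally_CAT kappa d) (Eb : forall z, (-oo < E z)%E).
Hypotheses (Ecvx : lconvex d lam E).

Let dM : is_metric d. Proof. by case: HCAT. Qed.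
Let geo : geodesic_space d. Proof. by case: HCAT => _ [_ []]. Qed.

Lemma domE_real z : domE E z -> exists ez : R, E z = ez%:E.
Proof. by move: (Eb z); rewrite /domE; case: (E z) => // e _ _; exists e. Qed.

Lemma minnorm_exists z ez : E z = ez%:E -> (slope d E z < +oo)%E ->
  exists S V, [/\ 0 <= S, slope d E z = S%:E, @descent_seq _ _ d E z ez S V,
    minnorm_elt d lam E z V & tnorm d z V = S].
Proof.
move=> Ez /slope_finite[S S0 SE]; have [r [K [r0 K0 LQ]]] := local_quadraticP HCAT z.
have [V HV] := descent_seq_exists dM geo Eb Ecvx Ez S SE S0.
exists S, V; split => //.
- exact: (descent_minnorm dM geo Eb Ecvx Ez r0 K0 LQ _ _ SE S0 HV).
- by have [] := descent_tcone dM geo Eb Ecvx Ez r0 K0 LQ _ _ SE S0 HV.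
Qed.

Lemma slope_le_tnorm z V : msubdiff d lam E z V -> (slope d E z <= (tnorm d z V)%:E)%E.
Proof.
move=> VS; have [/domE_real[ez Ez] _] := VS.
have [r [K [r0 K0 LQ]]] := local_quadraticP HCAT z.
exact: (msubdiff_slope dM Eb Ez r0 K0 LQ _ VS).
Qed.

(** An index [N] is fixed before [h], and [V N] serves as intermediate vector. The rescaled geodesic
    [g'] reaches the flow point at time [h], so the one-time estimate of [gdist_limit] at [h]
    reduces its tangent distance to [V N] to [flow_near_descent]. *)
Lemma flow_dq_converges y0 c s (es S : R) V :
  c 0 = y0 -> gradient_flow d lam E y0 c -> 0 <= s -> E (c s) = es%:E -> 0 <= S ->
  slope d E (c s) = S%:E -> @descent_seq _ _ d E (c s) es S V ->
  dq_converges kappa d c s V.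
Proof.
move=> c0 GF s0 Es S0 SE HV e e0.
have [r [K [r0 K0 LQ]]] := local_quadraticP HCAT (c s).
have [rb [rb0 Hrb]] := in_rball_near HCAT (c s).
have [VC VN] := descent_tcone dM geo Eb Ecvx Es r0 K0 LQ _ _ SE S0 HV.
have e3 : 0 < e / 3 by lra.
have [N1 HN1] := VC.2 _ e3.
(* The squared error [3 * N.+1%:R^-1] of [flow_near_descent] and the term [C * h ^+ 2] each receive
   [e ^+ 2 / 18], together [(e / 3) ^+ 2]. *)
have e27 : 0 < e ^+ 2 / 54 by rewrite divr_gt0 ?exprn_gt0.
have [N2 HN2] := @invn_small R _ e27.
pose N := maxn N1 N2.
have [T [vG Ev]] := HV N.
have eta0 : 0 < N.+1%:R^-1 :> R by rewrite invr_gt0 ltr0Sn.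
have [h1 h10 near] := flow_near_descent dM Eb c0 GF _ _ _ _ _ _ s0 Es S0 SE eta0 vG Ev.
have [h2 h20 speed] := flow_speed_bound dM Eb c0 GF _ _ _ _ s0 Es S0 SE ltr01.
have [h3 h30 cont] := flow_continuous dM c0 GF _ s0 _ rb0.
have [_ T0 _ _] := vG.
pose L := S + 1.
have L0 : 0 < L by rewrite /L; lra.
pose C := @germ_const _ K L.
have C0 : 0 <= C by exact: germ_const_ge0.
pose h0 := Num.min (Num.min (Num.min h1 h2) (Num.min h3 T))
  (Num.min (Num.min 1 (r / L)) (e ^+ 2 / (18 * (C + 1)))).
have C18 : 0 < 18 * (C + 1) by lra.
exists h0; split; first by rewrite !lt_min h10 h20 h30 T0 ltr01 !divr_gt0// exprn_gt0.
move=> h /andP[hp]; rewrite !lt_min => /andP[/andP[/andP[hh1 hh2] /andP[hh3 hT]] /andP[/andP[hlt1 hr] hC]].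
move: hr hC; rewrite !ltr_pdivlMr// => hr hC.
split.
  apply: Hrb; rewrite (dist_sym dM); apply: cont; first by lra.
  by rewrite addrC addKr gtr0_norm.
move=> g gG.
set D := d (c s) (c (s + h)).
have D0 : 0 <= D by exact: dist_ge0.
have DS : D <= L * h by rewrite /D (dist_sym dM); exact: speed.
pose g' u := g (h^-1 * u).
have hn : h != 0 by rewrite gt_eqF.
have gG' : germ_on d (c s) h (D / h) g'.
  split => //.
  - by rewrite /g' mulr0; case: gG.
  - by rewrite divr_ge0// ltW.
  - have I u : 0 <= u <= h -> 0 <= h^-1 * u <= 1.
      move=> /andP[u0 uh]; rewrite mulr_ge0 ?invr_ge0 ?(ltW hp)//=.
      by rewrite mulrC ler_pdivrMr// mul1r.
    move=> u v uI vI; case: gG => _ [_ ->]; rewrite ?I//.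
    rewrite -mulrBr normrM gtr0_norm ?invr_gt0// -/D; ring.
have germg : germ d (c s) g' by apply/germP; exists h, (D / h).
have gC := of_germ_tcone dM _ germg.
have vN : germ d (c s) (V N) by apply/germP; exists T, S.
have vC := of_germ_tcone dM _ vN.
have tri := tdist_tri dM r0 K0 LQ (of_germ (V N)) (of_germ g') V gC vC VC.
suff : tdist d (of_germ g') (of_germ (V N)) <= e / 3 /\ tdist d (of_germ (V N)) V <= e / 3.
  by rewrite (_ : tscale h^-1 (of_germ g) = of_germ g')//; lra.
split; last first.
  apply: le_of_eps => eta eta_0.
  have [M HM] := tdist_eps dM r0 K0 LQ _ _ vC VC _ eta_0.
  pose m := maxn M N1.
  have := HM m (leq_maxl _ _); rewrite /of_germ.
  have := HN1 N m (leq_maxl _ _) (leq_maxr _ _).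
  by rewrite ltr_norml => ? /andP[? ?]; lra.
rewrite tdist_germ.
have hh : germ_on d (c s) h S (V N) by apply: germ_onW vG hp _; exact: ltW.
have DL : D / h <= L by rewrite ler_pdivrMr.
have SL : S <= L by rewrite /L; lra.
have Lh : L * h < r by rewrite mulrC.
have [gd0 _ /(_ h (D / h) S L h gG' hh DL SL hp (lexx h) Lh)] :=
  gdist_limit dM r0 K0 LQ g' (V N) germg vN.
have -> : g' h = c (s + h) by rewrite /g' mulVf//; case: gG => _ [].
rewrite expr_div_n -/C => gd2.
have nr := near h hp hh1.
have h2p : 0 < h ^+ 2 by rewrite exprn_gt0.
have q1 : d (c (s + h)) (V N h) ^+ 2 / h ^+ 2 <= 3 * N.+1%:R^-1 by rewrite ler_pdivrMr.
have q2 : N.+1%:R^-1 < e ^+ 2 / 54 by apply: HN2; exact: leq_maxr.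
have q3 : C * h ^+ 2 <= e ^+ 2 / 18.
  have : C * h ^+ 2 <= C * h by rewrite ler_wpM2l//; nra.
  lra.
have : gdist d g' (V N) ^+ 2 <= (e / 3) ^+ 2.
  by move: q1 q2 gd2; move: (N.+1%:R^-1) => v q1 q2 gd2; rewrite expr_div_n; lra.
nra.
Qed.

End Main.

Theorem theorem3p10 (R : realType) (Y : Type) (d : Y -> Y -> R) (kappa lam : R)
  (E : Y -> \bar R) (y0 : Y) (c : R -> Y) :
  locally_CAT kappa d ->
  (forall y, (-oo < E y)%E) ->
  lconvex d lam E -> lsc d E ->
  in_closure_dom d E y0 ->
  c 0 = y0 -> gradient_flow d lam E y0 c ->
  (forall t : R, 0 < t -> exists V, minnorm_elt d lam E (c t) V /\ dq_converges kappa d c t V) /\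
  ((exists V, minnorm_elt d lam E y0 V /\ dq_converges kappa d c 0 V) <->
     domE E y0 /\ (slope d E y0 < +oo)%E) /\
  (forall z, domE E z -> (dom_msubdiff d lam E z <-> (slope d E z < +oo)%E)) /\
  (forall z, domE E z ->
     (~ dom_msubdiff d lam E z -> slope d E z = +oo%E) /\
     (dom_msubdiff d lam E z -> exists V, minnorm_elt d lam E z V /\ slope d E z = (tnorm d z V)%:E)) /\
  (forall z, domE E z -> forall e : R, 0 < e -> exists w, dom_msubdiff d lam E w /\ d z w < e).
Proof.
move=> HCAT Eb Ecvx Elsc y0D c0 GF.
have dM : is_metric d by case: HCAT.
have cpl : complete_metric d by case: HCAT => _ [].
have real_of z : domE E z -> exists ez : R, E z = ez%:E by exact: (domE_real Eb).
have converges s es : 0 <= s -> E (c s) = es%:E -> (slope d E (c s) < +oo)%E ->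
    exists V, minnorm_elt d lam E (c s) V /\ dq_converges kappa d c s V.
  move=> s0 Es /(minnorm_exists HCAT Eb Ecvx _ _ Es)[S [V [S0 SE HV Vmin _]]].
  exists V; split => //.
  exact: (flow_dq_converges HCAT Eb Ecvx _ _ _ _ _ _ c0 GF s0 Es S0 SE HV).
have sub_slope z : dom_msubdiff d lam E z -> (slope d E z < +oo)%E.
  by move=> [V /(slope_le_tnorm HCAT Eb) H]; apply: le_lt_trans H (ltry _).
have slope_sub z : domE E z -> (slope d E z < +oo)%E -> dom_msubdiff d lam E z.
  move=> /real_of[ez Ez] /(minnorm_exists HCAT Eb Ecvx _ _ Ez)[S [V [_ _ _ [VS _] _]]].
  by exists V.
split.
  move=> t t0; have [et Et] := flow_energy_finite dM Eb Elsc y0D c0 GF _ t0.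
  by apply: (converges t et (ltW t0) Et); exact: (flow_slope_finite dM Eb Elsc y0D c0 GF).
split.
  split=> [[V [[VS _] _]]|[/real_of[ey Ey] Sy]].
    by split; [case: VS|apply: sub_slope; exists V].
  by have := converges 0 ey (lexx 0); rewrite c0 => /(_ Ey Sy).
split; first by move=> z zD; split; [exact: sub_slope|exact: slope_sub].
split.
  move=> z zD; split=> [nd|/sub_slope Sz].
    by apply/eqP; apply: contrapT => /negP; rewrite -ltey => /(slope_sub z zD).
  have [ez Ez] := real_of z zD.
  have [S [V [_ SE _ Vmin VN]]] := minnorm_exists HCAT Eb Ecvx _ _ Ez Sz.
  by exists V; split => //; rewrite VN.
move=> z /real_of[ez Ez] e e0.
have [w [zw wD Sw]] := slope_finite_dense z ez e dM cpl Eb Elsc Ez e0.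
by exists w; split => //; exact: slope_sub.
Qed.
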